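(* Let $X,Y$ be computable metric spaces and let $f:X\to Y$ be a function. Then the following are equivalent: (1) $f$ is computable relative to the halting problem; (2) $f$ is limit computable and continuous and its global modulus of continuity is computable relative to the halting problem.
   Context: A computable metric space $(X,d,\alpha)$ is a metric space $(X,d)$ with a dense sequence $\alpha:\mathbb{N}\to X$ such that $d\circ(\alpha\times\alpha):\mathbb{N}^2\to\mathbb{R}$ is a computable (double) sequence of reals. It is represented by its Cauchy representation $\delta_X:\subseteq\mathbb{N}^{\mathbb{N}}\to X$, $\delta_X(p):=\lim_{n\to\infty}\alpha p(n)$ with $\mathrm{dom}(\delta_X)=\{p:(\forall k)(\forall n\geq k)\;d(\alpha p(n),\alpha p(k))<2^{-k}$ and $(\alpha p(n))_n$ converges$\}$. $\mathbb{N}^{\mathbb{N}}$ is represented by the identity. For a (multi-valued) function $f:X\rightrightarrows Y$ between represented spaces, a realizer is an $F:\subseteq\mathbb{N}^{\mathbb{N}}\to\mathbb{N}^{\mathbb{N}}$ with $\delta_YF(p)\in f\delta_X(p)$ for all $p\in\mathrm{dom}(f\delta_X)$ (for single-valued $f$: $\delta_YF(p)=f\delta_X(p)$). $f$ is limit computable, or computable relative to the halting problem, if it has a realizer with that property. A partial function $F:\subseteq\mathbb{N}^{\mathbb{N}}\to\mathbb{N}^{\mathbb{N}}$ is computable if there is a Turing machine (infinite input tape, one-way output tape) that on each $p\in\mathrm{dom}(F)$ produces $F(p)$ in the long run; it is limit computable if there is a Turing machine with a two-way output tape (it may revise its output) that on each $p\in\mathrm{dom}(F)$ computes $F(p)$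 such that each output position $n$ has, after finitely many steps, the content $F(p)(n)$ and is never changed again; it is computable relative to $q\in\mathbb{N}^{\mathbb{N}}$ if there is a computable $G$ with $F(p)=G\langle q,p\rangle$ for all $p\in\mathrm{dom}(F)$, where $\langle q,p\rangle(2n):=q(n)$, $\langle q,p\rangle(2n+1):=p(n)$. Nothing is required outside $\mathrm{dom}(F)$. The halting problem $0'\in\mathbb{N}^{\mathbb{N}}$ is given by $0'(i)=1$ if the $i$-th Turing machine halts on input $000\dots$, and $0'(i)=0$ otherwise. For metric spaces $(X,d_X),(Y,d_Y)$ and $f:X\to Y$, a function $m:\mathbb{N}\to\mathbb{N}$ is a modulus of continuity of $f$ at $x\in X$ if for all $y\in X$ and $n\in\mathbb{N}$: $d_X(x,y)<2^{-m(n)}$ implies $d_Y(f(x),f(y))<2^{-n}$. The global modulus of continuity of $f$ is the multi-valued function $M:X\rightrightarrows\mathbb{N}^{\mathbb{N}}$, $x\mapsto\{m\in\mathbb{N}^{\mathbb{N}}:m$ is a modulus of continuity of $f$ at $x\}$. *)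

(* Defs.v *)
From Stdlib Require Import Reals Lra Lia Arith List ClassicalEpsilon.
From Stdlib Require Cantor.
Import ListNotations.

Definition baire : Type := nat -> nat.

Inductive symbol : Set := blank | zero | one.
Inductive move : Set := go_left | stay | go_right.

Definition symbol_eq_dec (a b : symbol) : {a = b} + {a <> b}.
Proof. decide equality. Defined.

(** A sequence [p] occupies a tape as the infinite word
    1^{p(0)} 0 1^{p(1)} 0 1^{p(2)} 0 ...; in particular the sequence 0,0,0,...
    occupies it as 000... *)
Definition drop_cell (p : baire) : baire :=
  match p 0 with
  | 0 => fun n => p (S n)
  | S m => fun n => match n with 0 => m | S _ => p n end
  end.

Fixpoint code (p : baire) (j : nat) : symbol :=
  match j with
  | 0 => match p 0 with 0 => zero | S _ => one end
  | S j' => code (drop_cell p) j'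
  end.

(** Tapes are infinite to the right.  A machine has tape 0 for the (read-only)
    input, tape 1 for the output, and finitely many work tapes among 2, 3, ... *)
Record tape : Type := Tape { head : nat; cell : nat -> symbol }.

Definition input : nat := 0.
Definition output : nat := 1.

(** In state [r_state], if the head of tape [r_tape] scans [r_read], then this
    head writes [r_write] and moves according to [r_move], and the machine enters
    state [r_next].  The first applicable rule of a machine is used, and the
    machine halts when there is none.  The initial state is 0. *)
Record rule : Type := Rule {
  r_state : nat;
  r_tape : nat;
  r_read : symbol;
  r_write : symbol;
  r_move : move;
  r_next : nat }.

Definition machine : Type := list rule.

Record config : Type := Config { state : nat; tapes : nat -> tape }.

Definition scanned (c : config) (t : nat) : symbol :=
  cell (tapes c t) (head (tapes c t)).

Definition applicable (c : config) (r : rule) : bool :=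
  (r_state r =? state c) &&
  (if symbol_eq_dec (r_read r) (scanned c (r_tape r)) then true else false).

(** A head on the leftmost cell does not move when told to go left. *)
Definition move_head (m : move) (h : nat) : nat :=
  match m with go_left => pred h | stay => h | go_right => S h end.

Definition write (s : symbol) (x : tape) : tape :=
  Tape (head x) (fun j => if j =? head x then s else cell x j).

Definition act (r : rule) (x : tape) : tape :=
  let y := if r_tape r =? input then x else write (r_write r) x in
  Tape (move_head (r_move r) (head y)) (cell y).

Definition apply_rule (r : rule) (c : config) : config :=
  Config (r_next r)
    (fun t => if t =? r_tape r then act r (tapes c t) else tapes c t).

Definition step (M : machine) (c : config) : option config :=
  option_map (fun r => apply_rule r c) (find (applicable c) M).

Definition init (p : baire) : config :=
  Config 0 (fun t => Tape 0 (if t =? input then code p else fun _ => blank)).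

Fixpoint run (M : machine) (p : baire) (n : nat) : config :=
  match n with
  | 0 => init p
  | S n' => match step M (run M p n') with
            | Some c => c
            | None => run M p n'
            end
  end.

Definition halts (M : machine) (p : baire) : Prop :=
  exists n, step M (run M p n) = None.

(** Every cell of the output tape eventually has the content prescribed by [q]
    and is not changed any more. *)
Definition outputs (M : machine) (p q : baire) : Prop :=
  forall j, exists n0, forall n, n0 <= n ->
    cell (tapes (run M p n) output) j = code q j.

(** The output tape is one-way: each use of it moves its head to the right, so
    that no cell is visited twice. *)
Definition one_way (M : machine) : Prop :=
  forall r, In r M -> r_tape r = output -> r_move r = go_right.

Fixpoint decode_list_fuel (fuel n : nat) : list nat :=
  match fuel, n with
  | S k, S m => let '(a, b) := Cantor.of_nat m in a :: decode_list_fuel k b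
  | _, _ => []
  end.

Definition decode_list (n : nat) : list nat := decode_list_fuel n n.

Definition decode_symbol (n : nat) : symbol :=
  match n with 0 => blank | 1 => zero | _ => one end.

Definition decode_move (n : nat) : move :=
  match n with 0 => go_left | 1 => stay | _ => go_right end.

Definition decode_rule (n : nat) : rule :=
  let '(q, n1) := Cantor.of_nat n in
  let '(t, n2) := Cantor.of_nat n1 in
  let '(s, n3) := Cantor.of_nat n2 in
  let '(s', n4) := Cantor.of_nat n3 in
  let '(m, q') := Cantor.of_nat n4 in
  Rule q t (decode_symbol s) (decode_symbol s') (decode_move m) q'.

Definition nth_machine (i : nat) : machine := map decode_rule (decode_list i).

Lemma decode_list_fuel_onto (l : list nat) :
  exists n, forall fuel, n <= fuel -> decode_list_fuel fuel n = l.
Proof.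
  induction l as [|a l [n IH]].
  - exists 0. intros [|k] _; reflexivity.
  - exists (S (Cantor.to_nat (a, n))). intros [|k] Hk; [lia|].
    cbn [decode_list_fuel]. rewrite Cantor.cancel_of_to. f_equal. apply IH.
    pose proof (Cantor.to_nat_non_decreasing a n). lia.
Qed.

Lemma decode_rule_onto (r : rule) : exists n, decode_rule n = r.
Proof.
  destruct r as [q t s s' m q'].
  assert (Hs : forall x, exists k, decode_symbol k = x).
  { intros []; [exists 0 | exists 1 | exists 2]; reflexivity. }
  assert (Hm : exists k, decode_move k = m).
  { destruct m; [exists 0 | exists 1 | exists 2]; reflexivity. }
  destruct (Hs s) as [a Ha], (Hs s') as [b Hb], Hm as [c Hc].
  exists (Cantor.to_nat (q, Cantor.to_nat (t, Cantor.to_nat (a,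
            Cantor.to_nat (b, Cantor.to_nat (c, q')))))).
  unfold decode_rule. rewrite !Cantor.cancel_of_to. congruence.
Qed.

Lemma nth_machine_onto (M : machine) : exists i, nth_machine i = M.
Proof.
  assert (H : exists l, map decode_rule l = M).
  { induction M as [|r M [l IH]]; [exists []; reflexivity|].
    destruct (decode_rule_onto r) as [n Hn].
    exists (n :: l). simpl. congruence. }
  destruct H as [l Hl]. destruct (decode_list_fuel_onto l) as [n Hn].
  exists n. unfold nth_machine, decode_list. rewrite Hn; auto.
Qed.

Definition halting_problem : baire := fun i =>
  if excluded_middle_informative (halts (nth_machine i) (fun _ => 0))
  then 1 else 0.

Record pfun (A B : Type) : Type := PFun {
  graph :> A -> B -> Prop;
  graph_functional : forall a b b', graph a b -> graph a b' -> b = b' }.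

Definition computable (F : pfun baire baire) : Prop :=
  exists M, one_way M /\ forall p q, F p q -> outputs M p q.

Definition limit_computable (F : pfun baire baire) : Prop :=
  exists M, forall p q, F p q -> outputs M p q.

Definition pair_seq (q p : baire) : baire := fun n =>
  if Nat.even n then q (Nat.div2 n) else p (Nat.div2 n).

Definition computable_relative (q : baire) (F : pfun baire baire) : Prop :=
  exists G, computable G /\ forall p r, F p r -> G (pair_seq q p) r.

Definition computable_point (p : baire) : Prop :=
  exists M, one_way M /\ outputs M (fun _ => 0) p.

Record represented_space : Type := RepSpace {
  carrier :> Type;
  delta : pfun baire carrier;
  delta_onto : forall x, exists p, delta p x }.

Definition id_pfun : pfun baire baire :=
  PFun baire baire (fun p q => q = p)
    (fun _ _ _ H H' => eq_trans H (eq_sym H')).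

Definition baire_space : represented_space :=
  RepSpace baire id_pfun (fun p => ex_intro _ p eq_refl).

(** A multi-valued function is given by its graph; its domain consists of the
    points with at least one value. *)
Definition mfun (X Y : Type) : Type := X -> Y -> Prop.

Definition single_valued {X Y : Type} (f : X -> Y) : mfun X Y :=
  fun x y => y = f x.

Definition realizer {X Y : represented_space} (f : mfun X Y)
    (F : pfun baire baire) : Prop :=
  forall p x, delta X p x -> (exists y, f x y) ->
    exists q y, F p q /\ delta Y q y /\ f x y.

Definition mfun_limit_computable {X Y : represented_space} (f : mfun X Y) : Prop :=
  exists F, realizer f F /\ limit_computable F.

Definition mfun_halting_computable {X Y : represented_space} (f : mfun X Y) : Prop :=
  exists F, realizer f F /\ computable_relative halting_problem F.

Open Scope R_scope.

Definition nu_Q (n : nat) : R :=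
  let '(a, n1) := Cantor.of_nat n in
  let '(b, c) := Cantor.of_nat n1 in
  (INR a - INR b) / (INR c + 1).

Definition computable_double_sequence (x : nat -> nat -> R) : Prop :=
  exists p, computable_point p /\
    forall i j k,
      Rabs (x i j - nu_Q (p (Cantor.to_nat (i, Cantor.to_nat (j, k))))) <= / 2 ^ k.

Record computable_metric_space : Type := CMS {
  space :> Metric_Space;
  alpha : nat -> Base space;
  alpha_dense : forall x eps, eps > 0 -> exists n, dist space (alpha n) x < eps;
  alpha_computable :
    computable_double_sequence (fun i j => dist space (alpha i) (alpha j)) }.

Definition converges {X : Metric_Space} (u : nat -> Base X) (x : Base X) : Prop :=
  forall eps, eps > 0 -> exists N, forall n, (N <= n)%nat -> dist X (u n) x < eps.

Definition cauchy_name (X : computable_metric_space) (p : baire) (x : Base X) : Prop :=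
  (forall k n, (k <= n)%nat -> dist X (alpha X (p n)) (alpha X (p k)) < / 2 ^ k) /\
  converges (fun n => alpha X (p n)) x.

Lemma cauchy_name_functional (X : computable_metric_space) p (x x' : Base X) :
  cauchy_name X p x -> cauchy_name X p x' -> x = x'.
Proof.
  intros [_ H] [_ H']. apply (dist_refl X).
  destruct (Rle_lt_or_eq_dec 0 (dist X x x')) as [Hlt|Heq];
    [apply Rge_le, dist_pos | | auto].
  exfalso.
  destruct (H (dist X x x' / 2) ltac:(lra)) as [N HN].
  destruct (H' (dist X x x' / 2) ltac:(lra)) as [N' HN'].
  specialize (HN _ (Nat.le_max_l N N')). specialize (HN' _ (Nat.le_max_r N N')).
  cbv beta in HN, HN'.
  pose proof (dist_tri X x x' (alpha X (p (Nat.max N N')))) as T.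
  rewrite (dist_sym X x (alpha X _)) in T. lra.
Qed.

Lemma cauchy_name_onto (X : computable_metric_space) (x : Base X) :
  exists p, cauchy_name X p x.
Proof.
  assert (pos : forall k, 0 < / 2 ^ k).
  { intro k. apply Rinv_0_lt_compat, pow_lt. lra. }
  destruct (choice (fun k n => dist X (alpha X n) x < / 2 ^ (S k))) as [p Hp].
  { intro k. apply alpha_dense, pos. }
  assert (half : forall k, / 2 ^ S k = / 2 ^ k / 2).
  { intro k. simpl. rewrite Rinv_mult. lra. }
  assert (mono : forall k n, (k <= n)%nat -> / 2 ^ n <= / 2 ^ k).
  { intros k n Hkn. apply Rinv_le_contravar; [apply pow_lt; lra|].
    apply Rle_pow; [lra | exact Hkn]. }
  exists p. split.
  - intros k n Hkn.
    pose proof (dist_tri X (alpha X (p n)) (alpha X (p k)) x) as T.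
    rewrite (dist_sym X x (alpha X _)) in T.
    pose proof (Hp n) as Hn. pose proof (Hp k) as Hk.
    pose proof (mono _ _ Hkn). rewrite half in Hn, Hk. lra.
  - intros eps Heps.
    destruct (pow_lt_1_zero (/ 2) ltac:(rewrite Rabs_pos_eq; lra) eps Heps) as [N HN].
    exists N. intros n Hn. specialize (HN n Hn).
    rewrite pow_inv, Rabs_pos_eq in HN by (left; apply pos).
    pose proof (Hp n) as H. rewrite half in H. pose proof (pos n). lra.
Qed.

Definition cauchy_space (X : computable_metric_space) : represented_space :=
  RepSpace (Base X)
    (PFun baire (Base X) (cauchy_name X) (cauchy_name_functional X))
    (cauchy_name_onto X).

Definition continuous {X Y : Metric_Space} (f : Base X -> Base Y) : Prop :=
  forall x, limit_in X Y f (fun _ => True) x (f x).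

Definition modulus_at {X Y : Metric_Space} (f : Base X -> Base Y) (x : Base X)
    (m : nat -> nat) : Prop :=
  forall y n, dist X x y < / 2 ^ (m n) -> dist Y (f x) (f y) < / 2 ^ n.

Definition global_modulus {X Y : Metric_Space} (f : Base X -> Base Y) :
    mfun (Base X) (nat -> nat) :=
  fun x m => modulus_at f x m.

Definition limit_computable_map (X Y : computable_metric_space)
    (f : Base X -> Base Y) : Prop :=
  mfun_limit_computable (X := cauchy_space X) (Y := cauchy_space Y)
    (single_valued f).

Definition halting_computable_map (X Y : computable_metric_space)
    (f : Base X -> Base Y) : Prop :=
  mfun_halting_computable (X := cauchy_space X) (Y := cauchy_space Y)
    (single_valued f).

Definition halting_computable_modulus (X Y : computable_metric_space)
    (f : Base X -> Base Y) : Prop :=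
  mfun_halting_computable (X := cauchy_space X) (Y := baire_space)
    (global_modulus f).

(* Main.v *)
(** A realizer relative to the halting problem [0'] becomes limit computable when [0']
    is replaced by its approximations after [s] steps.  It also yields a modulus: if the
    machine has written enough output after [s] steps on a name [p] of [x], it has read
    at most [s] terms of [p], so every [y] with a name extending this prefix gets the same
    output; after dropping the first two terms of [p], all points close to [x] have such
    names.  Conversely, [0'] and a modulus at [x] give a point [alpha i] with [f (alpha i)]
    close to [f x].  Since [i,i,i,...] is a name of [alpha i], whether a finite part of
    the output of a limit machine on [alpha i] has become stable is a question about [i]
    alone, which [0'] answers.

    All the machines needed are obtained by compiling primitive recursive functions (with
    the input as an oracle), and computations of machines are in turn simulated by
    primitive recursive functions; this also provides the index, computed from [i], of a
    machine searching for a later change of the output. *)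
From Stdlib Require Import Reals Lra Lia Arith List Bool FunctionalExtensionality ClassicalEpsilon.
From Stdlib Require Cantor.
Require Import Defs.
Import ListNotations.
Local Open Scope nat_scope.

(** * Structured programs for Turing machines *)

(** The halting problem answers questions about finite data, posed to machines on the input 000...,
    whereas a limit machine on a name of [x] raises questions about an infinite input. The modulus
    removes this obstacle: it replaces [x] by an index [i], and the constant name lets one number
    stand for the whole input. This number has to be built into the machine asked about, which is
    why an index must be computed from it.

    Unbounded processes are kept apart from the compiled functions: these are total, and only a few
    fixed loops run them on successive stages. One loop emits terms once and for all, another
    rewrites ever longer initial segments of the output, and a third halts upon success and serves
    the reduction to the halting problem.

    Convergence of the output concerns every moment of a run, including those in the middle of a
    round, so the program logic carries a condition on the output tape through each single step. *)

Inductive cmd : Type :=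
| Skip
| Do (t : nat) (s : option symbol) (m : move)
| Seq (c1 c2 : cmd)
| If (t : nat) (s : symbol) (c1 c2 : cmd)
| While (t : nat) (s : symbol) (c : cmd).

(** States are counted, not rules: a conditional spends one state on its test and one on the jump
    over the second branch, a loop one on its test and one on the jump back. *)
Fixpoint size (c : cmd) : nat :=
  match c with
  | Skip => 0
  | Do _ _ _ => 1
  | Seq c1 c2 => size c1 + size c2
  | If _ _ c1 c2 => 1 + size c1 + 1 + size c2
  | While _ _ c => 1 + size c + 1
  end.

Definition branch (a t : nat) (w : symbol -> symbol) (m : move) (nx : symbol -> nat)
    : machine :=
  map (fun x => Rule a t x (w x) m (nx x)) [blank; zero; one].

(** Every rule reads some tape, so even an unconditional jump needs one rule per symbol, writing
    back what it has read. *)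
Definition jump (a t b : nat) : machine := branch a t (fun x => x) stay (fun _ => b).

Definition sel {A : Type} (s x : symbol) (u v : A) : A :=
  if symbol_eq_dec x s then u else v.

Fixpoint compile (c : cmd) (a : nat) : machine :=
  match c with
  | Skip => []
  | Do t s m =>
      branch a t (fun x => match s with Some y => y | None => x end) m (fun _ => S a)
  | Seq c1 c2 => compile c1 a ++ compile c2 (a + size c1)
  | If t s c1 c2 =>
      branch a t (fun x => x) stay
        (fun x => sel s x (S a) (S a + size c1 + 1))
      ++ compile c1 (S a)
      ++ jump (S a + size c1) t (S a + size c1 + 1 + size c2)
      ++ compile c2 (S a + size c1 + 1)
  | While t s c =>
      branch a t (fun x => x) stay
        (fun x => sel s x (S a) (S a + size c + 1))
      ++ compile c (S a)
      ++ jump (S a + size c) t a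
  end.

Definition scan (T : nat -> tape) (t : nat) : symbol := cell (T t) (head (T t)).

Definition act_on (t : nat) (w : symbol) (m : move) (T : nat -> tape) : nat -> tape :=
  fun u => if u =? t then act (Rule 0 t blank w m 0) (T u) else T u.

(** A terminating big-step semantics would lose sight of the intermediate configurations; [Q] is
    therefore demanded of the output tape after each elementary action. *)
Inductive exec (Q : tape -> Prop) : cmd -> (nat -> tape) -> (nat -> tape) -> Prop :=
| exec_skip T : exec Q Skip T T
| exec_do t s m T :
    let T' := act_on t (match s with Some y => y | None => scan T t end) m T in
    Q (T' output) -> exec Q (Do t s m) T T'
| exec_seq c1 c2 T T1 T2 :
    exec Q c1 T T1 -> exec Q c2 T1 T2 -> exec Q (Seq c1 c2) T T2
| exec_if_true t s c1 c2 T T' :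
    scan T t = s -> exec Q c1 T T' -> exec Q (If t s c1 c2) T T'
| exec_if_false t s c1 c2 T T' :
    scan T t <> s -> exec Q c2 T T' -> exec Q (If t s c1 c2) T T'
| exec_while_false t s c T : scan T t <> s -> exec Q (While t s c) T T
| exec_while_true t s c T T1 T2 :
    scan T t = s -> exec Q c T T1 -> exec Q (While t s c) T1 T2 ->
    exec Q (While t s c) T T2.

Lemma exec_invariant Q c T T' : exec Q c T T' -> Q (T output) -> Q (T' output).
Proof. induction 1; auto. Qed.

Inductive reach (M : machine) (Q : tape -> Prop) : nat -> config -> config -> Prop :=
| reach_refl c : reach M Q 0 c c
| reach_step n c c1 c2 :
    step M c = Some c1 -> Q (tapes c1 output) -> reach M Q n c1 c2 ->
    reach M Q (S n) c c2.

Lemma reach_one (M : machine) (Q : tape -> Prop) c a T :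
  step M c = Some (Config a T) -> Q (T output) -> reach M Q 1 c (Config a T).
Proof. intros. eapply reach_step; [eassumption|assumption|constructor]. Qed.

Lemma reach_trans M Q n m c1 c2 c3 :
  reach M Q n c1 c2 -> reach M Q m c2 c3 -> reach M Q (n + m) c1 c3.
Proof.
  induction 1; simpl; auto. intros. econstructor; eauto.
Qed.

(** Since [run] repeats a halting configuration, reaching [c] does not by itself exclude an earlier
    halt; the second conclusion does, and later shows that an unsuccessful search never halts. *)
Lemma reach_run M Q n p k c :
  reach M Q n (run M p k) c ->
  run M p (k + n) = c /\
  (forall i, i < n -> step M (run M p (k + i)) <> None /\
                      Q (tapes (run M p (k + S i)) output)).
Proof.
  intro H. remember (run M p k) as c0 eqn:E. revert k E.
  induction H as [|n c c1 c2 Hs HQ H IH]; intros k ->.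
  - rewrite Nat.add_0_r. split; auto. lia.
  - assert (E : run M p (S k) = c1) by (simpl; now rewrite Hs).
    destruct (IH (S k) (eq_sym E)) as [IH1 IH2].
    replace (k + S n) with (S k + n) by lia. split; [assumption|].
    intros [|i] Hi.
    + rewrite Nat.add_0_r, Nat.add_1_r, E. split; [congruence|assumption].
    + replace (k + S i) with (S k + i) by lia.
      replace (k + S (S i)) with (S k + S i) by lia. apply IH2. lia.
Qed.

(** * Locality of rule lookup and correctness of compilation *)

Definition rules_of (q : nat) (M : machine) : machine :=
  filter (fun r => r_state r =? q) M.

Lemma find_rules_of M c :
  find (applicable c) M = find (applicable c) (rules_of (state c) M).
Proof.
  induction M as [|r M IH]; simpl; auto.
  destruct (r_state r =? state c) eqn:E; simpl.
  - destruct (applicable c r); auto.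
  - unfold applicable at 1. now rewrite E.
Qed.

Lemma rules_of_app q M N : rules_of q (M ++ N) = rules_of q M ++ rules_of q N.
Proof. apply filter_app. Qed.

Lemma rules_of_branch a t w m nx : rules_of a (branch a t w m nx) = branch a t w m nx.
Proof. unfold rules_of, branch. simpl. now rewrite Nat.eqb_refl. Qed.

Lemma rules_of_branch_ne q a t w m nx : q <> a -> rules_of q (branch a t w m nx) = [].
Proof.
  intro H. unfold rules_of, branch. simpl.
  destruct (Nat.eqb_spec a q); [congruence|reflexivity].
Qed.

Lemma rules_of_none q M : (forall r, In r M -> r_state r <> q) -> rules_of q M = [].
Proof.
  induction M as [|r M IH]; simpl; auto. intro H.
  destruct (Nat.eqb_spec (r_state r) q) as [E|]; auto.
  exfalso. apply (H r); auto.
Qed.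

Lemma compile_states c : forall a r,
  In r (compile c a) -> a <= r_state r < a + size c.
Proof.
  induction c as [|t s m|c1 IH1 c2 IH2|t s c1 IH1 c2 IH2|t s c IH]; intros a r H;
    cbn [compile size] in *; rewrite ?in_app_iff in H.
  - destruct H.
  - unfold branch in H. simpl in H. intuition (subst; simpl; lia).
  - destruct H as [H|H]; [apply IH1 in H|apply IH2 in H]; lia.
  - destruct H as [H|[H|[H|H]]].
    + unfold branch in H. simpl in H. intuition (subst; simpl; lia).
    + apply IH1 in H. lia.
    + unfold jump, branch in H. simpl in H. intuition (subst; simpl; lia).
    + apply IH2 in H. lia.
  - destruct H as [H|[H|H]].
    + unfold branch in H. simpl in H. intuition (subst; simpl; lia).
    + apply IH in H. lia.
    + unfold jump, branch in H. simpl in H. intuition (subst; simpl; lia).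
Qed.

Lemma rules_of_compile_ne q c a :
  q < a \/ a + size c <= q -> rules_of q (compile c a) = [].
Proof.
  intros H. apply rules_of_none. intros r Hr E. apply compile_states in Hr. lia.
Qed.

(** Equality state by state, not mere containment of rules: the first applicable rule wins, so a
    foreign rule for one of these states could take precedence. *)
Definition embeds (M : machine) (c : cmd) (a : nat) : Prop :=
  forall q, a <= q < a + size c -> rules_of q M = rules_of q (compile c a).

Lemma step_branch M a T t w m nx :
  rules_of a M = branch a t w m nx ->
  step M (Config a T) =
    Some (Config (nx (scan T t)) (act_on t (w (scan T t)) m T)).
Proof.
  intro H. unfold step. rewrite find_rules_of. cbn [state]. rewrite H.
  unfold branch. cbn [map find]. unfold applicable. cbn [r_state r_read r_tape state].
  rewrite Nat.eqb_refl. unfold scanned. cbn [tapes]. fold (scan T t).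
  destruct (scan T t); cbn [andb]; repeat (destruct (symbol_eq_dec _ _); try congruence);
    cbn [option_map]; unfold apply_rule, act_on; cbn [r_next r_tape tapes];
    do 3 f_equal.
Qed.

Lemma act_on_stay T t : act_on t (scan T t) stay T = T.
Proof.
  apply functional_extensionality. intro u. unfold act_on.
  destruct (Nat.eqb_spec u t) as [->|]; [|reflexivity].
  unfold act, scan. cbn [r_tape r_write r_move move_head].
  destruct (T t) as [h f]. destruct (t =? input); simpl; [reflexivity|].
  f_equal. apply functional_extensionality. intro j.
  destruct (Nat.eqb_spec j h) as [->|]; reflexivity.
Qed.

Ltac rules_at H q :=
  let H' := fresh in
  pose proof (H q) as H'; cbn [size compile] in H'; rewrite H' by lia; clear H';
  unfold jump; rewrite ?rules_of_app, ?rules_of_branch;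
  repeat match goal with
  | |- context [rules_of ?p (branch ?a ?t ?w ?m ?nx)] =>
      rewrite (rules_of_branch_ne p a t w m nx) by lia
  | |- context [rules_of ?p (compile ?c ?a)] =>
      rewrite (rules_of_compile_ne p c a) by lia
  end;
  rewrite ?app_nil_r, ?app_nil_l; try reflexivity.

Lemma embeds_seq_l M c1 c2 a : embeds M (Seq c1 c2) a -> embeds M c1 a.
Proof. intros H q Hq. rules_at H q. Qed.

Lemma embeds_seq_r M c1 c2 a : embeds M (Seq c1 c2) a -> embeds M c2 (a + size c1).
Proof. intros H q Hq. rules_at H q. Qed.

Lemma embeds_if_l M t s c1 c2 a : embeds M (If t s c1 c2) a -> embeds M c1 (S a).
Proof. intros H q Hq. rules_at H q. Qed.

Lemma embeds_if_r M t s c1 c2 a :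
  embeds M (If t s c1 c2) a -> embeds M c2 (S a + size c1 + 1).
Proof. intros H q Hq. rules_at H q. Qed.

Lemma embeds_while M t s c a : embeds M (While t s c) a -> embeds M c (S a).
Proof. intros H q Hq. rules_at H q. Qed.

Lemma step_stay M a T t nx :
  rules_of a M = branch a t (fun x => x) stay nx ->
  step M (Config a T) = Some (Config (nx (scan T t)) T).
Proof. intro H. rewrite (step_branch _ _ _ _ _ _ _ H). now rewrite act_on_stay. Qed.

Lemma step_while M t s c a T : embeds M (While t s c) a ->
  step M (Config a T) =
    Some (Config (sel s (scan T t) (S a) (S a + size c + 1)) T).
Proof.
  intro H. apply (step_stay M a T t (fun x => sel s x (S a) (S a + size c + 1))).
  rules_at H a.
Qed.

Lemma step_while_back M t s c a T : embeds M (While t s c) a ->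
  step M (Config (S a + size c) T) = Some (Config a T).
Proof. intro H. apply (step_stay M _ T t (fun _ => a)). rules_at H (S a + size c). Qed.

Lemma step_if M t s c1 c2 a T : embeds M (If t s c1 c2) a ->
  step M (Config a T) =
    Some (Config (sel s (scan T t) (S a) (S a + size c1 + 1)) T).
Proof.
  intro H. apply (step_stay M a T t (fun x => sel s x (S a) (S a + size c1 + 1))).
  rules_at H a.
Qed.

Lemma step_if_join M t s c1 c2 a T : embeds M (If t s c1 c2) a ->
  step M (Config (S a + size c1) T) = Some (Config (a + size (If t s c1 c2)) T).
Proof.
  intro H. replace (a + size (If t s c1 c2)) with (S a + size c1 + 1 + size c2)
    by (cbn [size]; lia).
  apply (step_stay M _ T t (fun _ => S a + size c1 + 1 + size c2)).
  rules_at H (S a + size c1).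
Qed.

Lemma exec_reach M Q c T T' :
  exec Q c T T' -> Q (T output) -> forall a, embeds M c a ->
  exists n, reach M Q n (Config a T) (Config (a + size c) T').
Proof.
  induction 1 as [T|t s m T T' HQ'|c1 c2 T T1 T2 H1 IH1 H2 IH2
                 |t s c1 c2 T T' Hs H1 IH1|t s c1 c2 T T' Hs H1 IH1
                 |t s c T Hs|t s c T T1 T2 Hs H1 IH1 H2 IH2]; intros HQ a He.
  - exists 0. cbn [size]. rewrite Nat.add_0_r. constructor.
  - exists 1. cbn [size]. rewrite Nat.add_1_r.
    apply (reach_step M Q 0 _ (Config (S a) T')); [|exact HQ'|constructor].
    rewrite (step_branch M a T t (fun x => match s with Some y => y | None => x end) m
               (fun _ => S a)).
    + reflexivity.
    + rules_at He a.
  - destruct (IH1 HQ a (embeds_seq_l _ _ _ _ He)) as [n1 R1].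
    destruct (IH2 (exec_invariant _ _ _ _ H1 HQ) _ (embeds_seq_r _ _ _ _ He)) as [n2 R2].
    exists (n1 + n2). cbn [size]. rewrite Nat.add_assoc. eapply reach_trans; eauto.
  - destruct (IH1 HQ _ (embeds_if_l _ _ _ _ _ _ He)) as [n1 R1].
    exists (1 + (n1 + 1)).
    eapply reach_trans; [|eapply reach_trans; [exact R1|]].
    + apply reach_one with (2 := HQ).
      rewrite (step_if _ _ _ _ _ _ _ He), Hs. unfold sel.
      destruct (symbol_eq_dec s s); [reflexivity|congruence].
    + apply reach_one with (2 := exec_invariant _ _ _ _ H1 HQ).
      apply (step_if_join _ _ _ _ _ _ _ He).
  - destruct (IH1 HQ _ (embeds_if_r _ _ _ _ _ _ He)) as [n1 R1].
    exists (1 + n1).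
    eapply reach_trans.
    + apply reach_one with (2 := HQ).
      rewrite (step_if _ _ _ _ _ _ _ He). unfold sel.
      destruct (symbol_eq_dec (scan T t) s); [congruence|reflexivity].
    + replace (a + size (If t s c1 c2)) with (S a + size c1 + 1 + size c2)
        by (cbn [size]; lia). exact R1.
  - exists 1. apply reach_one with (2 := HQ).
    rewrite (step_while _ _ _ _ _ _ He). unfold sel.
    destruct (symbol_eq_dec (scan T t) s); [congruence|].
    do 2 f_equal. cbn [size]. lia.
  - destruct (IH1 HQ _ (embeds_while _ _ _ _ _ He)) as [n1 R1].
    pose proof (exec_invariant _ _ _ _ H1 HQ) as HQ1.
    destruct (IH2 HQ1 _ He) as [n2 R2].
    exists (1 + (n1 + (1 + n2))).
    eapply reach_trans; [|eapply reach_trans; [exact R1|eapply reach_trans; [|exact R2]]].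
    + apply reach_one with (2 := HQ).
      rewrite (step_while _ _ _ _ _ _ He), Hs. unfold sel.
      destruct (symbol_eq_dec s s); [reflexivity|congruence].
    + apply reach_one with (2 := HQ1). apply (step_while_back _ _ _ _ _ _ He).
Qed.

(** The successor matters: a round takes at least one step, so infinitely many rounds exhaust all
    later times. *)
Lemma while_reach M Q t s c T T' a :
  embeds M (While t s c) a -> scan T t = s -> Q (T output) -> exec Q c T T' ->
  exists n, reach M Q (S n) (Config a T) (Config a T').
Proof.
  intros He Hs HQ H. pose proof (exec_invariant _ _ _ _ H HQ) as HQ'.
  destruct (exec_reach M _ _ _ _ H HQ _ (embeds_while _ _ _ _ _ He)) as [n R].
  exists (n + 1). apply (reach_trans M Q 1 (n + 1) _ (Config (S a) T)).
  - apply reach_one with (2 := HQ).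
    rewrite (step_while _ _ _ _ _ _ He), Hs. unfold sel.
    destruct (symbol_eq_dec s s); [reflexivity|congruence].
  - eapply reach_trans; [exact R|].
    apply reach_one with (2 := HQ'). apply (step_while_back _ _ _ _ _ _ He).
Qed.

(** Rounds follow each other without gaps and [Q i] holds throughout round [i], so an invariant at
    the beginnings of rounds yields a statement about all late times. *)
Lemma forever_run M p t s c a (Inv : nat -> (nat -> tape) -> Prop)
    (Q : nat -> tape -> Prop) :
  embeds M (While t s c) a ->
  (forall i T, Inv i T -> scan T t = s /\ Q i (T output) /\
     exists T', exec (Q i) c T T' /\ Inv (S i) T') ->
  forall T k, run M p k = Config a T -> Inv 0 T ->
  forall i, exists k', forall m, k' <= m ->
    step M (run M p m) <> None /\ exists i', i <= i' /\ Q i' (tapes (run M p m) output).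
Proof.
  intros He Hinv T0 k0 Hk0 HI0.
  assert (next : forall i T k, run M p k = Config a T -> Inv i T ->
    exists n T', run M p (k + S n) = Config a T' /\ Inv (S i) T' /\
      forall j, j <= n -> step M (run M p (k + j)) <> None /\
        Q i (tapes (run M p (k + j)) output)).
  { intros i T k Hk HI. destruct (Hinv i T HI) as (Hs & HQ & T' & HE & HI').
    destruct (while_reach M (Q i) t s c T T' a He Hs HQ HE) as [n R].
    rewrite <- Hk in R. destruct (reach_run _ _ _ _ _ _ R) as [R1 R2].
    exists n, T'. split; [assumption|]. split; [assumption|].
    intros [|j] Hj.
    - split; [apply R2; lia|]. now rewrite Nat.add_0_r, Hk.
    - split; [apply R2; lia|]. apply (R2 j). lia. }
  assert (start : forall i, exists k T, run M p k = Config a T /\ Inv i T).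
  { induction i as [|i (k & T & Hk & HI)]; [eauto|].
    destruct (next i T k Hk HI) as (n & T' & H1 & H2 & _). eauto. }
  (* Induction on the length [d] of a time window: either [m] falls into the current round, or the
     window shrinks by at least one with the next round. *)
  assert (later : forall d i k T, run M p k = Config a T -> Inv i T ->
    forall m, k <= m < k + d -> step M (run M p m) <> None /\
      exists i', i <= i' /\ Q i' (tapes (run M p m) output)).
  { induction d as [|d IH]; intros i k T Hk HI m Hm; [lia|].
    destruct (next i T k Hk HI) as (n & T' & H1 & H2 & H3).
    destruct (le_lt_dec m (k + n)) as [Hle|Hlt].
    - destruct (H3 (m - k)) as [H4 H5]; [lia|].
      replace (k + (m - k)) with m in * by lia. eauto.
    - destruct (IH (S i) (k + S n) T' H1 H2 m) as [H4 (i' & H5 & H6)]; [lia|].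
      split; [assumption|]. exists i'. split; [lia|assumption]. }
  intro i. destruct (start i) as (k & T & Hk & HI). exists k. intros m Hm.
  apply (later (S (m - k)) i k T Hk HI). lia.
Qed.

(** Register [r] lives on tape [r + 2]: its value is the position of the head.  Cell 0
    is blank and all other visited cells are non-blank, so that no initialisation is
    needed.  Register 0 keeps track of the head of the input tape. *)
Definition holds (x : tape) (v : nat) : Prop :=
  head x = v /\ cell x 0 = blank /\ forall j, 1 <= j <= v -> cell x j = one.

Definition rep (p : baire) (T : nat -> tape) (R : nat -> nat) : Prop :=
  (forall r, holds (T (r + 2)) (R r)) /\ cell (T 0) = code p /\ head (T 0) = R 0.

Definition upd (R : nat -> nat) (r v : nat) : nat -> nat :=
  fun u => if u =? r then v else R u.

(** [mach n c] executes [c] with [n] in register 1 and 0 in all other registers; [n] is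
    hard-wired as the number of states passed through before [c] is entered. *)
Definition mach (n : nat) (c : cmd) : machine :=
  let b := S (S (size c)) in
  Rule 0 3 blank blank go_right (b + n) ::
  nat_rect (fun _ => machine)
    (Rule b 3 blank blank go_left 1 :: compile c 1)
    (fun k M => Rule (S (b + k)) 3 blank one go_right (b + k) :: M) n.

Lemma mach_embeds n c : embeds (mach n c) c 1.
Proof.
  intros q Hq. unfold mach. unfold rules_of at 1. cbn [filter r_state].
  destruct (Nat.eqb_spec 0 q); [lia|].
  induction n as [|n IH]; cbn [nat_rect filter r_state].
  - destruct (Nat.eqb_spec (S (S (size c))) q); [lia|]. reflexivity.
  - destruct (Nat.eqb_spec (S (S (S (size c)) + n)) q); [lia|]. exact IH.
Qed.

(** The states that write [n] start at [size c + 2], which leaves the exit state of [c] without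
    rules: finishing [c] means halting. *)
Lemma mach_stop n c : rules_of (1 + size c) (mach n c) = [].
Proof.
  apply rules_of_none. unfold mach. cbn [In].
  intros r [<-|H]; [simpl; lia|].
  induction n as [|n IH]; cbn [nat_rect In] in H.
  - destruct H as [<-|H]; [cbn [r_state]; lia|]. apply compile_states in H. lia.
  - destruct H as [<-|H]; [cbn [r_state]; lia|]. auto.
Qed.

Lemma step_single M a T t w m b :
  rules_of a M = [Rule a t blank w m b] -> scan T t = blank ->
  step M (Config a T) = Some (Config b (act_on t w m T)).
Proof.
  intros H Hs. unfold step. rewrite find_rules_of. cbn [state]. rewrite H.
  cbn [find]. unfold applicable. cbn [r_state r_read r_tape state].
  rewrite Nat.eqb_refl. unfold scanned. cbn [tapes]. fold (scan T t). rewrite Hs.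
  cbn [andb]. destruct (symbol_eq_dec blank blank); [|congruence]. reflexivity.
Qed.

Lemma mach_rules_0 n c :
  rules_of 0 (mach n c) = [Rule 0 3 blank blank go_right (S (S (size c)) + n)].
Proof.
  unfold mach, rules_of. cbn [filter r_state Nat.eqb]. f_equal.
  apply (rules_of_none 0). intros r H.
  induction n as [|n IH]; cbn [nat_rect In] in H.
  - destruct H as [<-|H]; [cbn [r_state]; lia|]. apply compile_states in H. lia.
  - destruct H as [<-|H]; [cbn [r_state]; lia|]. auto.
Qed.

Lemma mach_rules_b n c :
  rules_of (S (S (size c))) (mach n c) =
    [Rule (S (S (size c))) 3 blank blank go_left 1].
Proof.
  unfold mach. unfold rules_of. cbn [filter r_state].
  destruct (Nat.eqb_spec 0 (S (S (size c)))); [lia|].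
  induction n as [|n IH]; cbn [nat_rect filter r_state].
  - rewrite Nat.eqb_refl. f_equal. apply (rules_of_compile_ne (S (S (size c)))). lia.
  - destruct (Nat.eqb_spec (S (S (S (size c)) + n)) (S (S (size c)))); [lia|]. exact IH.
Qed.

Lemma mach_rules_k n c k : k < n ->
  rules_of (S (S (S (size c)) + k)) (mach n c) =
    [Rule (S (S (S (size c)) + k)) 3 blank one go_right (S (S (size c)) + k)].
Proof.
  intro Hk. unfold mach. unfold rules_of. cbn [filter r_state].
  destruct (Nat.eqb_spec 0 (S (S (S (size c)) + k))); [lia|].
  induction n as [|n IH]; [lia|]. cbn [nat_rect filter r_state].
  destruct (Nat.eqb_spec (S (S (S (size c)) + n)) (S (S (S (size c)) + k))) as [E|E].
  - replace n with k by lia. f_equal.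
    apply (rules_of_none (S (S (S (size c)) + k))). intros r H.
    assert (Hr : forall i, In r (nat_rect (fun _ => machine)
      (Rule (S (S (size c))) 3 blank blank go_left 1 :: compile c 1)
      (fun k M => Rule (S (S (S (size c)) + k)) 3 blank one go_right (S (S (size c)) + k)
                  :: M) i) -> r_state r < S (S (S (size c)) + i)).
    { clear. induction i as [|i IH]; cbn [nat_rect In].
      - intros [<-|H]; [cbn [r_state]; lia|]. apply compile_states in H. lia.
      - intros [<-|H]; [cbn [r_state]; lia|]. apply IH in H. lia. }
    apply Hr in H. lia.
  - apply IH. lia.
Qed.

(** Tape 3 carries register 1. The head leaves the blank cell 0, writes [n] symbols and steps back
    once, which puts it on cell [n] as [holds] demands, also when [n] is 0. *)
Lemma mach_start n c p :
  exists T, run (mach n c) p (n + 2) = Config 1 T /\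
    rep p T (upd (fun _ => 0) 1 n) /\ T output = tapes (init p) output.
Proof.
  assert (H : forall i, i <= n -> exists T,
    run (mach n c) p (1 + i) = Config (S (S (size c)) + (n - i)) T /\
    head (T 3) = S i /\ cell (T 3) 0 = blank /\
    (forall j, 1 <= j <= i -> cell (T 3) j = one) /\
    (forall j, i < j -> cell (T 3) j = blank) /\
    (forall t, t <> 3 -> T t = tapes (init p) t)).
  { induction i as [|i IH]; intro Hi.
    - exists (act_on 3 blank go_right (tapes (init p))).
      cbn [Nat.add run]. unfold init at 1.
      rewrite (step_single _ _ _ _ _ _ _ (mach_rules_0 n c)) by reflexivity.
      split; [f_equal; lia|]. cbn. repeat split; auto.
      + intros. lia.
      + intros [|j] ?; [lia|reflexivity].
      + intros t Ht. unfold act_on. destruct (Nat.eqb_spec t 3); [lia|reflexivity].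
    - destruct IH as (T & H1 & H2 & H3 & H4 & H5 & H6); [lia|].
      exists (act_on 3 one go_right T).
      replace (1 + S i) with (S (1 + i)) by lia. cbn [run]. rewrite H1.
      replace (S (S (size c)) + (n - i)) with (S (S (S (size c)) + (n - S i))) by lia.
      rewrite (step_single _ _ _ _ _ _ _ (mach_rules_k n c (n - S i) ltac:(lia))).
      2:{ unfold scan. rewrite H2. apply H5. lia. }
      split; [reflexivity|]. unfold act_on. cbn [Nat.eqb]. unfold act.
      cbn [r_tape input Nat.eqb r_write r_move move_head write head cell].
      rewrite H2. repeat split.
      + exact H3.
      + intros j Hj. destruct (Nat.eqb_spec j (S i)); [reflexivity|]. apply H4. lia.
      + intros j Hj. destruct (Nat.eqb_spec j (S i)); [lia|]. apply H5. lia.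
      + intros t Ht. destruct (Nat.eqb_spec t 3); [lia|]. auto. }
  destruct (H n (le_n n)) as (T & H1 & H2 & H3 & H4 & H5 & H6).
  exists (act_on 3 blank go_left T).
  replace (n + 2) with (S (1 + n)) by lia. cbn [run]. rewrite H1.
  replace (S (S (size c)) + (n - n)) with (S (S (size c))) by lia.
  rewrite (step_single _ _ _ _ _ _ _ (mach_rules_b n c)).
  2:{ unfold scan. rewrite H2. apply H5. lia. }
  split; [reflexivity|]. split; [split; [|split]|].
  - intro r. unfold act_on, upd. destruct (Nat.eqb_spec r 1) as [->|Hr].
    + cbn. unfold holds. cbn. rewrite H2. cbn. repeat split; auto.
      intros j Hj. destruct (Nat.eqb_spec j (S n)); [lia|auto].
    + destruct (Nat.eqb_spec (r + 2) 3); [lia|]. rewrite H6 by assumption.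
      unfold init, holds. cbn [tapes head cell].
      destruct (Nat.eqb_spec (r + 2) input) as [E|E]; [unfold input in E; lia|].
      repeat split; auto. intros. lia.
  - unfold act_on. cbn. rewrite H6; [reflexivity|lia].
  - unfold act_on. cbn. rewrite H6; [reflexivity|lia].
  - unfold act_on. cbn. apply H6. discriminate.
Qed.

(** Tests and jumps leave the head of the tested tape where it is, so the output tape must not be
    tested. *)
Fixpoint forward (c : cmd) : Prop :=
  match c with
  | Skip => True
  | Do t _ m => t = output -> m = go_right
  | Seq c1 c2 => forward c1 /\ forward c2
  | If t _ c1 c2 => t <> output /\ forward c1 /\ forward c2
  | While t _ c => t <> output /\ forward c
  end.

Lemma compile_one_way c : forall a, forward c -> one_way (compile c a).
Proof.
  induction c as [|t s m|c1 IH1 c2 IH2|t s c1 IH1 c2 IH2|t s c IH]; intros a H r Hr;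
    cbn [compile forward] in *; rewrite ?in_app_iff in Hr.
  - destruct Hr.
  - unfold branch in Hr. simpl in Hr. intuition (subst; simpl in *; auto).
  - destruct H, Hr as [Hr|Hr]; [eapply IH1|eapply IH2]; eauto.
  - destruct H as (H & H1 & H2).
    destruct Hr as [Hr|[Hr|[Hr|Hr]]]; [|eapply IH1; eauto| |eapply IH2; eauto];
      unfold jump, branch in Hr; simpl in Hr; intuition (subst; simpl in *; congruence).
  - destruct H as (H & H1).
    destruct Hr as [Hr|[Hr|Hr]]; [|eapply IH; eauto|];
      unfold jump, branch in Hr; simpl in Hr; intuition (subst; simpl in *; congruence).
Qed.

Lemma mach_one_way n c : forward c -> one_way (mach n c).
Proof.
  intros H r Hr. unfold mach in Hr. destruct Hr as [<-|Hr]; [discriminate|].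
  induction n as [|n IH]; cbn [nat_rect In] in Hr.
  - destruct Hr as [<-|Hr]; [discriminate|]. eapply compile_one_way; eauto.
  - destruct Hr as [<-|Hr]; [discriminate|auto].
Qed.

(** * Programs acting on registers *)

(** A Hoare triple for total correctness. Register contents and output tape are given exactly, so
    that side conditions become equations between functions. *)
Definition triple (p : baire) (Q : tape -> Prop) (c : cmd)
    (R : nat -> nat) (o : tape) (R' : nat -> nat) (o' : tape) : Prop :=
  forall T, rep p T R -> T output = o -> Q o ->
    exists T', exec Q c T T' /\ rep p T' R' /\ T' output = o'.

(** For [t = output] the truncated subtraction would yield register 0; this case is excluded
    wherever [test] is used. *)
Definition test (p : baire) (R : nat -> nat) (t : nat) : symbol :=
  if t =? input then code p (R 0) else if R (t - 2) =? 0 then blank else one.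

Lemma rep_scan p T R t : t <> output -> rep p T R -> scan T t = test p R t.
Proof.
  intros Ht (H1 & H2 & H3). unfold test, scan.
  destruct (Nat.eqb_spec t input) as [->|Hi]; [unfold input; congruence|].
  unfold input, output in *.
  replace (T t) with (T (t - 2 + 2)) by (f_equal; lia).
  destruct (H1 (t - 2)) as (E1 & E2 & E3). rewrite E1.
  destruct (Nat.eqb_spec (R (t - 2)) 0) as [->|]; [exact E2|]. apply E3. lia.
Qed.

Lemma triple_eq p Q c R o R1 R' o' :
  triple p Q c R o R1 o' -> R1 = R' -> triple p Q c R o R' o'.
Proof. now intros H <-. Qed.

Lemma triple_skip p Q R o : triple p Q Skip R o R o.
Proof. intros T H Ho HQ. exists T. repeat split; try apply H; auto. constructor. Qed.

Lemma triple_seq p Q c1 c2 R o R1 o1 R2 o2 :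
  triple p Q c1 R o R1 o1 -> triple p Q c2 R1 o1 R2 o2 ->
  triple p Q (Seq c1 c2) R o R2 o2.
Proof.
  intros H1 H2 T H Ho HQ. destruct (H1 T H Ho HQ) as (T1 & E1 & P1 & O1).
  destruct (H2 T1 P1 O1) as (T2 & E2 & P2 & O2).
  - rewrite <- O1. apply (exec_invariant _ _ _ _ E1). congruence.
  - exists T2. repeat split; try apply P2; auto. econstructor; eauto.
Qed.

Lemma triple_if p Q t s c1 c2 R o R' o' : t <> output ->
  (test p R t = s -> triple p Q c1 R o R' o') ->
  (test p R t <> s -> triple p Q c2 R o R' o') ->
  triple p Q (If t s c1 c2) R o R' o'.
Proof.
  intros Ht H1 H2 T H Ho HQ. pose proof (rep_scan _ _ _ _ Ht H) as E.
  destruct (symbol_eq_dec (test p R t) s) as [Es|Es].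
  - destruct (H1 Es T H Ho HQ) as (T' & E' & P' & O').
    exists T'. split; [|auto]. apply exec_if_true; congruence.
  - destruct (H2 Es T H Ho HQ) as (T' & E' & P' & O').
    exists T'. split; [|auto]. apply exec_if_false; congruence.
Qed.

Lemma triple_while_false p Q t s c R o : t <> output ->
  test p R t <> s -> triple p Q (While t s c) R o R o.
Proof.
  intros Ht Hs T H Ho HQ. exists T. split; [|auto].
  apply exec_while_false. rewrite (rep_scan _ _ _ _ Ht H). assumption.
Qed.

Lemma triple_while_true p Q t s c R o R1 o1 R2 o2 : t <> output ->
  test p R t = s -> triple p Q c R o R1 o1 ->
  triple p Q (While t s c) R1 o1 R2 o2 -> triple p Q (While t s c) R o R2 o2.
Proof.
  intros Ht Hs H1 H2 T H Ho HQ. destruct (H1 T H Ho HQ) as (T1 & E1 & P1 & O1).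
  destruct (H2 T1 P1 O1) as (T2 & E2 & P2 & O2).
  - rewrite <- O1. apply (exec_invariant _ _ _ _ E1). congruence.
  - exists T2. split; [|auto]. apply exec_while_true with T1; auto.
    rewrite (rep_scan _ _ _ _ Ht H). assumption.
Qed.

(** [I i] and [O i] describe the situation when [i] rounds remain to be done. *)
Lemma triple_while p Q t s c (I : nat -> nat -> nat) (O : nat -> tape) n :
  t <> output ->
  (forall i, i < n -> test p (I (S i)) t = s /\
     triple p Q c (I (S i)) (O (S i)) (I i) (O i)) ->
  test p (I 0) t <> s ->
  triple p Q (While t s c) (I n) (O n) (I 0) (O 0).
Proof.
  intros Ht H H0. induction n as [|n IH].
  - now apply triple_while_false.
  - destruct (H n) as [H1 H2]; [lia|]. eapply triple_while_true; eauto.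
Qed.

(** Decrementing leaves stale symbols to the right of the head. [holds] ignores those cells, and
    incrementing overwrites the one it enters. *)
Definition Inc (r : nat) : cmd :=
  Seq (Do (r + 2) None go_right) (Do (r + 2) (Some one) stay).
Definition Dec (r : nat) : cmd := Do (r + 2) None go_left.
Definition IfNZ (r : nat) (c1 c2 : cmd) : cmd := If (r + 2) one c1 c2.
Definition WhileNZ (r : nat) (c : cmd) : cmd := While (r + 2) one c.
Definition Loop (r : nat) (c : cmd) : cmd := WhileNZ r (Seq (Dec r) c).
Definition Next : cmd := Seq (Do input None go_right) (Inc 0).
Definition Prev : cmd := Seq (Do input None go_left) (Dec 0).
Definition WhileOne (c : cmd) : cmd := While input one c.
Definition Out (s : symbol) : cmd := Do output (Some s) go_right.

Lemma act_on_eq t w m T : act_on t w m T t =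
  Tape (move_head m (head (T t)))
    (if t =? input then cell (T t)
     else fun j => if j =? head (T t) then w else cell (T t) j).
Proof.
  unfold act_on. rewrite Nat.eqb_refl. unfold act. cbn [r_tape r_write r_move].
  destruct (t =? input); reflexivity.
Qed.

Lemma act_on_ne t w m T u : u <> t -> act_on t w m T u = T u.
Proof. intro H. unfold act_on. destruct (Nat.eqb_spec u t); congruence. Qed.

Lemma exec_inc Q r T v : holds (T (r + 2)) v -> Q (T output) ->
  exists T', exec Q (Inc r) T T' /\ holds (T' (r + 2)) (S v) /\
    forall u, u <> r + 2 -> T' u = T u.
Proof.
  intros (H1 & H2 & H3) HQ. eexists. split; [|split].
  - eapply exec_seq; apply exec_do.
    + rewrite act_on_ne by (unfold output; lia). exact HQ.
    + rewrite !act_on_ne by (unfold output; lia). exact HQ.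
  - unfold holds. rewrite !act_on_eq. cbn [move_head head cell].
    destruct (Nat.eqb_spec (r + 2) input) as [E|_]; [unfold input in E; lia|].
    cbn [head cell]. rewrite H1.
    split; [reflexivity|split].
    + destruct (Nat.eqb_spec 0 (S v)); [lia|]. unfold scan. rewrite H1.
      destruct (Nat.eqb_spec 0 v) as [<-|]; assumption.
    + intros j Hj. destruct (Nat.eqb_spec j (S v)); [reflexivity|].
      unfold scan. rewrite H1. destruct (Nat.eqb_spec j v) as [->|]; apply H3; lia.
  - intros u Hu. now rewrite !act_on_ne by assumption.
Qed.

Lemma exec_dec Q r T v : holds (T (r + 2)) v -> Q (T output) ->
  exists T', exec Q (Dec r) T T' /\ holds (T' (r + 2)) (pred v) /\
    forall u, u <> r + 2 -> T' u = T u.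
Proof.
  intros (H1 & H2 & H3) HQ. eexists. split; [|split].
  - apply exec_do. rewrite act_on_ne by (unfold output; lia). exact HQ.
  - unfold holds. rewrite !act_on_eq. cbn [move_head head cell].
    destruct (Nat.eqb_spec (r + 2) input) as [E|_]; [unfold input in E; lia|].
    cbn [head cell]. unfold scan. rewrite H1.
    split; [reflexivity|split].
    + destruct (Nat.eqb_spec 0 v) as [<-|]; assumption.
    + intros j Hj. destruct (Nat.eqb_spec j v) as [->|]; apply H3; lia.
  - intros u Hu. now rewrite !act_on_ne by assumption.
Qed.

Lemma triple_inc p Q r R o : r <> 0 ->
  triple p Q (Inc r) R o (upd R r (S (R r))) o.
Proof.
  intros Hr T (H1 & H2 & H3) Ho HQ. subst o.
  destruct (exec_inc Q r T _ (H1 r) HQ) as (T' & E & H & F).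
  exists T'. split; [exact E|]. split; [split; [|split]|].
  - intro u. unfold upd. destruct (Nat.eqb_spec u r) as [->|]; [exact H|].
    rewrite F by lia. apply H1.
  - rewrite F by lia. exact H2.
  - rewrite F by lia. unfold upd. destruct (Nat.eqb_spec 0 r); [lia|exact H3].
  - apply F. unfold output. lia.
Qed.

Lemma triple_dec p Q r R o : r <> 0 ->
  triple p Q (Dec r) R o (upd R r (pred (R r))) o.
Proof.
  intros Hr T (H1 & H2 & H3) Ho HQ. subst o.
  destruct (exec_dec Q r T _ (H1 r) HQ) as (T' & E & H & F).
  exists T'. split; [exact E|]. split; [split; [|split]|].
  - intro u. unfold upd. destruct (Nat.eqb_spec u r) as [->|]; [exact H|].
    rewrite F by lia. apply H1.
  - rewrite F by lia. exact H2.
  - rewrite F by lia. unfold upd. destruct (Nat.eqb_spec 0 r); [lia|exact H3].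
  - apply F. unfold output. lia.
Qed.

Lemma triple_next p Q R o : triple p Q Next R o (upd R 0 (S (R 0))) o.
Proof.
  intros T (H1 & H2 & H3) Ho HQ. subst o.
  set (T1 := act_on input (scan T input) go_right T).
  destruct (exec_inc Q 0 T1 (R 0)) as (T' & E & H & F).
  - unfold T1. rewrite act_on_ne by (unfold input; lia). apply H1.
  - unfold T1. rewrite act_on_ne by discriminate. exact HQ.
  - exists T'. split; [|split; [split; [|split]|]].
    + eapply exec_seq; [|exact E]. apply exec_do.
      rewrite act_on_ne by discriminate. exact HQ.
    + intro u. unfold upd. destruct (Nat.eqb_spec u 0) as [->|]; [exact H|].
      rewrite F by lia. unfold T1. rewrite act_on_ne by (unfold input; lia). apply H1.
    + rewrite F by lia. unfold T1. rewrite act_on_eq. exact H2.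
    + rewrite F by lia. unfold T1. rewrite act_on_eq. cbn. now rewrite H3.
    + rewrite F by discriminate. unfold T1. rewrite act_on_ne; [reflexivity|discriminate].
Qed.

Lemma triple_prev p Q R o : triple p Q Prev R o (upd R 0 (pred (R 0))) o.
Proof.
  intros T (H1 & H2 & H3) Ho HQ. subst o.
  set (T1 := act_on input (scan T input) go_left T).
  destruct (exec_dec Q 0 T1 (R 0)) as (T' & E & H & F).
  - unfold T1. rewrite act_on_ne by (unfold input; lia). apply H1.
  - unfold T1. rewrite act_on_ne by discriminate. exact HQ.
  - exists T'. split; [|split; [split; [|split]|]].
    + eapply exec_seq; [|exact E]. apply exec_do.
      rewrite act_on_ne by discriminate. exact HQ.
    + intro u. unfold upd. destruct (Nat.eqb_spec u 0) as [->|]; [exact H|].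
      rewrite F by lia. unfold T1. rewrite act_on_ne by (unfold input; lia). apply H1.
    + rewrite F by lia. unfold T1. rewrite act_on_eq. exact H2.
    + rewrite F by lia. unfold T1. rewrite act_on_eq. cbn. now rewrite H3.
    + rewrite F by discriminate. unfold T1. rewrite act_on_ne; [reflexivity|discriminate].
Qed.

Definition put (s : symbol) (o : tape) : tape :=
  Tape (S (head o)) (fun j => if j =? head o then s else cell o j).

Lemma triple_do_output p Q w m R o :
  let o' := Tape (move_head m (head o)) (fun j => if j =? head o then
     match w with Some y => y | None => cell o (head o) end else cell o j) in
  (Q o -> Q o') -> triple p Q (Do output w m) R o R o'.
Proof.
  intros o' HQ' T (H1 & H2 & H3) Ho HQ. eexists. split; [|split; [split; [|split]|]].
  - apply exec_do. rewrite act_on_eq, Ho. unfold scan. rewrite Ho. auto.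
  - intro r. rewrite act_on_ne by (unfold output; lia). apply H1.
  - rewrite act_on_ne by discriminate. exact H2.
  - rewrite act_on_ne by discriminate. exact H3.
  - rewrite act_on_eq, Ho. unfold scan. rewrite Ho. reflexivity.
Qed.

Lemma triple_out p Q s R o : (Q o -> Q (put s o)) -> triple p Q (Out s) R o R (put s o).
Proof. intro H. exact (triple_do_output p Q (Some s) go_right R o H). Qed.

Lemma test_reg p R r : test p R (r + 2) = if R r =? 0 then blank else one.
Proof.
  unfold test. destruct (Nat.eqb_spec (r + 2) input) as [E|_]; [unfold input in E; lia|].
  now replace (r + 2 - 2) with r by lia.
Qed.

Lemma test_reg_nz p R r : R r <> 0 -> test p R (r + 2) = one.
Proof. intro H. rewrite test_reg. destruct (Nat.eqb_spec (R r) 0); congruence. Qed.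

Lemma test_reg_z p R r : R r = 0 -> test p R (r + 2) <> one.
Proof. intro H. rewrite test_reg, H. discriminate. Qed.

Lemma reg_ne_output r : r + 2 <> output.
Proof. unfold output. lia. Qed.

Lemma triple_ifnz p Q r c1 c2 R o R' o' :
  (R r <> 0 -> triple p Q c1 R o R' o') ->
  (R r = 0 -> triple p Q c2 R o R' o') ->
  triple p Q (IfNZ r c1 c2) R o R' o'.
Proof.
  intros H1 H2. apply triple_if; [apply reg_ne_output| |];
    rewrite test_reg; destruct (Nat.eqb_spec (R r) 0); intro; auto; congruence.
Qed.

Lemma triple_loop p Q r c (I : nat -> nat -> nat) (O : nat -> tape) n :
  r <> 0 -> (forall i, i <= n -> I i r = i) ->
  (forall i, i < n -> triple p Q c (upd (I (S i)) r i) (O (S i)) (I i) (O i)) ->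
  triple p Q (Loop r c) (I n) (O n) (I 0) (O 0).
Proof.
  intros Hr HI H. apply triple_while; [apply reg_ne_output| |].
  - intros i Hi. split; [apply test_reg_nz; rewrite HI; lia|].
    eapply triple_seq; [apply triple_dec; assumption|].
    rewrite HI by lia. apply H. assumption.
  - apply test_reg_z. apply HI. lia.
Qed.

(** A stack frame at [k] on top of the registers of [R]. All registers beyond the list are 0, so a
    subprogram finds its scratch registers clear. *)
Definition stk (R : nat -> nat) (k : nat) (l : list nat) : nat -> nat :=
  fun r => if r <? k then R r else nth (r - k) l 0.

Ltac stk_eq :=
  apply functional_extensionality; intro;
  unfold stk, upd;
  repeat match goal with
  | |- context [?a <? ?b] => destruct (Nat.ltb_spec a b); try lia
  | |- context [?a =? ?b] => destruct (Nat.eqb_spec a b); try lia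
  end; subst; try reflexivity;
  repeat match goal with
  | |- context [?a - ?b] =>
      is_var a; let d := fresh "d" in
      remember (a - b) as d eqn:?;
      destruct d as [|[|[|[|[|d]]]]]; cbn [nth]; try lia; try reflexivity
  | |- context [?a - ?b] =>
      let d := fresh "d" in
      remember (a - b) as d eqn:?;
      destruct d as [|[|[|[|[|d]]]]]; cbn [nth]; try lia; try reflexivity
  end; cbn [nth]; try lia; auto.

Ltac stk_at :=
  unfold stk, upd;
  repeat match goal with
  | |- context [?a <? ?b] => destruct (Nat.ltb_spec a b); try lia
  | |- context [?a =? ?b] => destruct (Nat.eqb_spec a b); try lia
  end;
  repeat match goal with
  | |- context [?a - ?b] =>
      let d := fresh "d" in
      remember (a - b) as d eqn:?;
      destruct d as [|[|[|[|[|d]]]]]; cbn [nth]; try lia; try reflexivity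
  end; cbn [nth]; try lia; auto.

Definition Move (a b : nat) : cmd := Loop a (Inc b).
Definition Copy (a b t : nat) : cmd := Seq (Loop a (Seq (Inc b) (Inc t))) (Move t a).
Definition Clear (a : nat) : cmd := Loop a Skip.

Lemma triple_move p Q a b R o : a <> 0 -> b <> 0 -> a <> b ->
  triple p Q (Move a b) R o (upd (upd R b (R b + R a)) a 0) o.
Proof.
  intros Ha Hb Hab.
  set (I i := upd (upd R b (R b + (R a - i))) a i).
  eapply triple_eq; [replace R with (I (R a)) at 1|].
  - apply (triple_loop p Q a (Inc b) I (fun _ => o)); auto.
    + intros i _. unfold I, upd. now rewrite Nat.eqb_refl.
    + intros i Hi. eapply triple_eq; [apply triple_inc; assumption|].
      unfold I. stk_eq.
  - unfold I. stk_eq.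
  - unfold I. stk_eq.
Qed.

Lemma triple_copy p Q a b t R o : a <> 0 -> b <> 0 -> t <> 0 ->
  a <> b -> a <> t -> b <> t -> R t = 0 ->
  triple p Q (Copy a b t) R o (upd R b (R b + R a)) o.
Proof.
  intros Ha Hb Ht Hab Hat Hbt Hz.
  set (I i := upd (upd (upd R b (R b + (R a - i))) a i) t (R a - i)).
  eapply triple_seq.
  - replace R with (I (R a)) at 1.
    + apply (triple_loop p Q a (Seq (Inc b) (Inc t)) I (fun _ => o)); auto.
      * intros i _. unfold I. stk_at.
      * intros i Hi. eapply triple_seq; [apply triple_inc; assumption|].
        eapply triple_eq; [apply triple_inc; assumption|]. unfold I. stk_eq.
    + unfold I. stk_eq.
  - eapply triple_eq; [apply triple_move; auto|]. unfold I. stk_eq.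
Qed.

Lemma triple_clear p Q a R o : a <> 0 -> triple p Q (Clear a) R o (upd R a 0) o.
Proof.
  intros Ha. set (I i := upd R a i).
  replace R with (I (R a)) at 1.
  - apply (triple_loop p Q a Skip I (fun _ => o)); auto.
    + intros i _. unfold I. stk_at.
    + intros i Hi. eapply triple_eq; [apply triple_skip|]. unfold I. stk_eq.
  - unfold I. stk_eq.
Qed.

(** * Compiling primitive recursive functions *)

(** The cell at which the block of [p n] begins. *)
Fixpoint pos (p : baire) (n : nat) : nat :=
  match n with 0 => 0 | S n' => pos p n' + S (p n') end.

Lemma code_first p j : j <= p 0 -> code p j = if j <? p 0 then one else zero.
Proof.
  revert p. induction j as [|j IH]; intros p Hj; simpl.
  - destruct (p 0); reflexivity.
  - rewrite IH; unfold drop_cell; destruct (p 0) as [|m]; try lia. reflexivity.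
Qed.

Lemma code_tail p j : code p (S (p 0) + j) = code (fun n => p (S n)) j.
Proof.
  remember (p 0) as v eqn:E. revert p E. induction v as [|v IH]; intros p E.
  - simpl. f_equal. unfold drop_cell. now rewrite <- E.
  - change (code (drop_cell p) (S v + j) = code (fun n => p (S n)) j). rewrite (IH (drop_cell p)).
    + f_equal. unfold drop_cell. now rewrite <- E.
    + unfold drop_cell. now rewrite <- E.
Qed.

Lemma pos_tail p n : pos p (S n) = S (p 0) + pos (fun i => p (S i)) n.
Proof.
  induction n as [|n IH]; [simpl; lia|].
  change (pos p (S (S n))) with (pos p (S n) + S (p (S n))). rewrite IH. simpl. lia.
Qed.

Lemma code_pos p n j : j <= p n ->
  code p (pos p n + j) = if j <? p n then one else zero.
Proof.
  revert p. induction n as [|n IH]; intros p Hj.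
  - now apply code_first.
  - rewrite pos_tail, <- Nat.add_assoc, code_tail. now apply IH.
Qed.

Lemma pos_mono p n m : n <= m -> pos p n <= pos p m.
Proof. induction 1; simpl; lia. Qed.

Lemma le_pos p n : n <= pos p n.
Proof. induction n; simpl; lia. Qed.

(** Unary functions on Cantor codes, so that one register serves as argument and result. Iteration
    replaces primitive recursion, because a pair can carry the counter along. *)
Inductive tm : Type :=
| Id | Zero | Succ | Fst | Snd
| Pair (f g : tm)
| Comp (f g : tm)
| Iter (f : tm)
| Orc.

Fixpoint eval (p : baire) (t : tm) (n : nat) : nat :=
  match t with
  | Id => n
  | Zero => 0
  | Succ => S n
  | Fst => fst (Cantor.of_nat n)
  | Snd => snd (Cantor.of_nat n)
  | Pair f g => Cantor.to_nat (eval p f n, eval p g n)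
  | Comp f g => eval p f (eval p g n)
  | Iter f => Nat.iter (fst (Cantor.of_nat n)) (eval p f) (snd (Cantor.of_nat n))
  | Orc => p n
  end.

(** Walks along the diagonals of the Cantor enumeration: (x+1, y) is followed by (x, y+1), and (0,
    y) by (y+1, 0). *)
Definition Unpair (k : nat) : cmd :=
  Loop k (IfNZ (k + 1) (Seq (Dec (k + 1)) (Inc (k + 2)))
                       (Seq (Move (k + 2) (k + 1)) (Inc (k + 1)))).

(** Evaluates y + (1 + 2 + ... + (x+y)): the first loop leaves y in [k] and x+y in [k + 1], the
    second adds the triangular number. *)
Definition Pairing (k : nat) : cmd :=
  Seq (Loop (k + 2) (Seq (Inc k) (Inc (k + 1))))
      (Loop (k + 1) (Seq (Inc k) (Copy (k + 1) k (k + 2)))).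

(** Skip [n] blocks, count the next one, rewind. The input tape has no mark at its left end, so the
    rewinding is controlled by register 0. *)
Definition Query (k : nat) : cmd :=
  Seq (Loop k (Seq (WhileOne Next) Next))
      (Seq (WhileOne (Seq Next (Inc k))) (WhileNZ 0 Prev)).

Fixpoint comp (k : nat) (t : tm) : cmd :=
  match t with
  | Id => Skip
  | Zero => Clear k
  | Succ => Inc k
  | Fst => Seq (Unpair k) (Seq (Clear (k + 2)) (Move (k + 1) k))
  | Snd => Seq (Unpair k) (Seq (Clear (k + 1)) (Move (k + 2) k))
  | Pair f g =>
      Seq (Copy k (k + 1) (k + 2)) (Seq (comp (k + 1) f) (Seq (Move k (k + 2))
        (Seq (comp (k + 2) g) (Pairing k))))
  | Comp f g => Seq (comp k g) (comp k f)
  | Iter f =>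
      Seq (Unpair k) (Seq (Loop (k + 1) (comp (k + 2) f)) (Move (k + 2) k))
  | Orc => Query k
  end.

Section Programs.
Variables (p : baire) (Q : tape -> Prop) (R : nat -> nat) (o : tape) (k : nat).
Hypothesis k_pos : k <> 0.

Lemma of_nat_S n : Cantor.of_nat (S n) =
  let '(x, y) := Cantor.of_nat n in
  match x with 0 => (S y, 0) | S x' => (x', S y) end.
Proof. unfold Cantor.of_nat at 1. cbn [nat_rec nat_rect]. fold (Cantor.of_nat n).
  destruct (Cantor.of_nat n) as [[|x] y]; reflexivity. Qed.

Lemma triple_unpair n : triple p Q (Unpair k) (stk R k [n]) o
  (stk R k [0; fst (Cantor.of_nat n); snd (Cantor.of_nat n)]) o.
Proof.
  set (I i := stk R k [i; fst (Cantor.of_nat (n - i)); snd (Cantor.of_nat (n - i))]).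
  eapply triple_eq; [replace (stk R k [n]) with (I n)|].
  - apply (triple_loop p Q k _ I (fun _ => o)); auto.
    + intros i _. unfold I. stk_at.
    + intros i Hi. unfold I. replace (n - i) with (S (n - S i)) by lia.
      rewrite of_nat_S. destruct (Cantor.of_nat (n - S i)) as [x y]. cbn [fst snd].
      apply triple_ifnz.
      * intro H. destruct x as [|x].
        { exfalso. apply H. stk_at. }
        eapply triple_seq; [apply triple_dec; lia|].
        eapply triple_eq; [apply triple_inc; lia|]. cbn [fst snd]. stk_eq.
      * intro H. destruct x as [|x].
        2:{ exfalso. revert H. stk_at. }
        eapply triple_seq; [apply triple_move; lia|].
        eapply triple_eq; [apply triple_inc; lia|]. cbn [fst snd]. stk_eq.
  - unfold I. rewrite Nat.sub_diag. cbn. stk_eq.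
  - unfold I. now rewrite Nat.sub_0_r.
Qed.

Lemma to_nat_sum x y : Cantor.to_nat (x, y) =
  y + nat_rect (fun _ => nat) 0 (fun i m => S i + m) (x + y).
Proof. unfold Cantor.to_nat. now rewrite (Nat.add_comm y x). Qed.

Lemma triple_pairing x y : triple p Q (Pairing k) (stk R k [0; x; y]) o
  (stk R k [Cantor.to_nat (x, y)]) o.
Proof.
  eapply triple_seq.
  - set (I i := stk R k [y - i; x + (y - i); i]).
    replace (stk R k [0; x; y]) with (I y).
    + apply (triple_loop p Q (k + 2) _ I (fun _ => o)); auto; [lia| |].
      * intros i _. unfold I. stk_at.
      * intros i Hi. eapply triple_seq; [apply triple_inc; lia|].
        eapply triple_eq; [apply triple_inc; lia|]. unfold I. stk_eq.
    + unfold I. stk_eq.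
  - cbv beta. rewrite Nat.sub_0_r, to_nat_sum.
    set (F := nat_rect (fun _ => nat) 0 (fun i m => S i + m)).
    assert (FS : forall i, F (S i) = S i + F i) by reflexivity.
    (* The invariant subtracts [F i] from [F (x + y)] in the natural numbers; monotonicity keeps
       this difference exact. *)
    assert (FM : forall i, i <= x + y -> F i <= F (x + y)).
    { intros i Hi. induction Hi as [|m Hm IH]; [lia|]. rewrite FS. lia. }
    set (I i := stk R k [y + (F (x + y) - F i); i]).
    eapply triple_eq; [replace (stk R k [y; x + y; 0]) with (I (x + y))|].
    + apply (triple_loop p Q (k + 1) _ I (fun _ => o)); auto; [lia| |].
      * intros i _. unfold I. stk_at.
      * intros i Hi. eapply triple_seq; [apply triple_inc; lia|].
        pose proof (FM (S i) Hi). rewrite FS in H.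
        eapply triple_eq; [apply triple_copy; try lia|]; unfold I; rewrite ?FS.
        { stk_at. }
        stk_eq.
    + unfold I. stk_eq.
    + unfold I. change (F 0) with 0. stk_eq.
Qed.

Lemma triple_query n : R 0 = 0 ->
  triple p Q (Query k) (stk R k [n]) o (stk R k [p n]) o.
Proof.
  intro H0. set (at_ l i := upd (stk R k l) 0 i).
  assert (at_0 : forall l, at_ l 0 = stk R k l).
  { intro l. unfold at_. stk_eq. }
  assert (at_r : forall l i, at_ l i 0 = i) by reflexivity.
  assert (Hn : forall l i, upd (at_ l i) 0 (S i) = at_ l (S i)).
  { intros. unfold at_. stk_eq. }
  assert (Hi : input <> output) by discriminate.
  assert (Ht : forall l m j, j <= p m ->
    test p (at_ l (pos p m + j)) input = if j <? p m then one else zero).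
  { intros l m j Hj. unfold test. cbn. now apply code_pos. }
  eapply triple_seq; [|eapply triple_seq].
  - set (I i := at_ [i] (pos p (n - i))).
    replace (stk R k [n]) with (I n).
    + apply (triple_loop p Q k _ I (fun _ => o)); auto.
      * intros i _. unfold I, at_. stk_at.
      * intros i Hin. unfold I. replace (n - i) with (S (n - S i)) by lia.
        set (m := n - S i). replace (upd (at_ [S i] (pos p m)) k i) with (at_ [i] (pos p m))
          by (unfold at_; stk_eq).
        eapply triple_seq.
        { set (J j := at_ [i] (pos p m + (p m - j))).
          replace (at_ [i] (pos p m)) with (J (p m)) by (unfold J; now rewrite Nat.sub_diag, Nat.add_0_r).
          apply (triple_while p Q input one Next J (fun _ => o) (p m)); auto.
          - intros j Hj. split; unfold J.
            + rewrite Ht by lia. destruct (Nat.ltb_spec (p m - S j) (p m)); [auto|lia].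
            + eapply triple_eq; [apply triple_next|]. rewrite at_r, Hn. f_equal. lia.
          - unfold J. rewrite Ht by lia.
            destruct (Nat.ltb_spec (p m - 0) (p m)); [lia|discriminate]. }
        eapply triple_eq; [apply triple_next|]. rewrite at_r, Hn. f_equal. simpl. lia.
    + unfold I. rewrite Nat.sub_diag. apply at_0.
  - cbv beta. rewrite Nat.sub_0_r.
    set (J j := at_ [p n - j] (pos p n + (p n - j))).
    replace (at_ [0] (pos p n)) with (J (p n)) by (unfold J; now rewrite Nat.sub_diag, Nat.add_0_r).
    apply (triple_while p Q input one _ J (fun _ => o) (p n)); auto.
    + intros j Hj. split; unfold J.
      * rewrite Ht by lia. destruct (Nat.ltb_spec (p n - S j) (p n)); [auto|lia].
      * eapply triple_seq; [apply triple_next|].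
        eapply triple_eq; [apply triple_inc; assumption|]. unfold at_. stk_eq.
    + unfold J. rewrite Ht by lia.
      destruct (Nat.ltb_spec (p n - 0) (p n)); [lia|discriminate].
  - cbv beta. rewrite Nat.sub_0_r.
    eapply triple_eq; [|apply at_0].
    apply (triple_while p Q (0 + 2) one Prev (at_ [p n]) (fun _ => o)).
    + discriminate.
    + intros i _. split; [apply test_reg_nz; rewrite at_r; lia|].
      eapply triple_eq; [apply triple_prev|]. rewrite at_r. unfold at_. stk_eq.
    + apply test_reg_z. apply at_r.
Qed.

End Programs.

(** [R 0 = 0] says that the input head is at the left end, where every oracle query begins and to
    which it returns. *)
Lemma triple_comp p Q o t : forall k R n, k <> 0 -> R 0 = 0 ->
  triple p Q (comp k t) (stk R k [n]) o (stk R k [eval p t n]) o.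
Proof.
  induction t as [| | | | |f IHf g IHg|f IHf g IHg|f IHf|];
    intros k R n Hk HR; cbn [comp eval].
  - apply triple_skip.
  - eapply triple_eq; [apply triple_clear; assumption|]. stk_eq.
  - eapply triple_eq; [apply triple_inc; assumption|]. stk_eq.
  - eapply triple_seq; [apply triple_unpair; assumption|].
    eapply triple_seq; [apply triple_clear; lia|].
    eapply triple_eq; [apply triple_move; lia|]. stk_eq.
  - eapply triple_seq; [apply triple_unpair; assumption|].
    eapply triple_seq; [apply triple_clear; lia|].
    eapply triple_eq; [apply triple_move; lia|]. stk_eq.
  - eapply triple_seq.
    (* The copied argument is viewed as a new frame at [k + 1], with the old frame as its
       environment, so that the induction hypothesis for [f] applies. *)
    { eapply triple_eq; [apply triple_copy; try lia; stk_at|].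
      instantiate (1 := stk (stk R k [n]) (k + 1) [n]). stk_eq. }
    eapply triple_seq.
    { apply IHf; [lia|]. stk_at. }
    eapply triple_seq.
    { eapply triple_eq; [apply triple_move; lia|].
      instantiate (1 := stk (stk R k [0; eval p f n]) (k + 2) [n]). stk_eq. }
    eapply triple_seq.
    { eapply triple_eq; [apply IHg; [lia|stk_at]|].
      instantiate (1 := stk R k [0; eval p f n; eval p g n]). stk_eq. }
    apply triple_pairing. assumption.
  - eapply triple_seq; [apply IHg; assumption|]. apply IHf; assumption.
  - eapply triple_seq; [apply triple_unpair; assumption|].
    destruct (Cantor.of_nat n) as [m x]. cbn [fst snd].
    eapply triple_seq.
    + set (I i := stk (stk R k [0; i]) (k + 2) [Nat.iter (m - i) (eval p f) x]).
      replace (stk R k [0; m; x]) with (I m).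
      * apply (triple_loop p Q (k + 1) _ I (fun _ => o)); [lia| |].
        { intros i _. unfold I. stk_at. }
        intros i Hi. unfold I.
        replace (m - i) with (S (m - S i)) by lia.
        eapply triple_eq; [|apply (f_equal (fun v => stk (stk R k [0; i]) (k + 2) [v]))].
        { match goal with |- triple _ _ _ ?X _ _ _ =>
            replace X with (stk (stk R k [0; i]) (k + 2)
              [Nat.iter (m - S i) (eval p f) x]) by stk_eq end.
          apply IHf; [lia|]. stk_at. }
        reflexivity.
      * unfold I. rewrite Nat.sub_diag. cbn [Nat.iter nat_rect]. stk_eq.
    + cbv beta. rewrite Nat.sub_0_r. eapply triple_eq; [apply triple_move; lia|]. stk_eq.
  - apply triple_query; assumption.
Qed.

Lemma comp_forward t : forall k, forward (comp k t).
Proof.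
  assert (H : forall r, r + 2 = output -> False) by (unfold output; lia).
  assert (H' : forall r, r + 2 <> output) by (unfold output; lia).
  induction t; intro k; cbn [comp];
    unfold Unpair, Pairing, Query, Copy, Move, Clear, Loop, WhileNZ, WhileOne, IfNZ,
      Next, Prev, Inc, Dec; cbn [forward];
    repeat split; auto; try (intro E; exfalso; first [exact (H _ E)|discriminate]).
Qed.

(** * Machines running a primitive recursive function forever *)

Definition zeros : nat -> nat := fun _ => 0.

Lemma test_tracker p R : R 0 = 0 -> test p R 2 = blank.
Proof. intro H. change 2 with (0 + 2). rewrite test_reg, H. reflexivity. Qed.

Lemma mach_loop_run n t s c p (Inv : nat -> (nat -> tape) -> Prop)
    (Q : nat -> tape -> Prop) :
  (forall i T, Inv i T -> scan T t = s /\ Q i (T output) /\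
     exists T', exec (Q i) c T T' /\ Inv (S i) T') ->
  (forall T, rep p T (stk zeros 1 [n]) -> T output = tapes (init p) output -> Inv 0 T) ->
  forall i, exists k, forall m, k <= m -> exists i', i <= i' /\
    Q i' (tapes (run (mach n (While t s c)) p m) output).
Proof.
  intros H H0 i. destruct (mach_start n (While t s c) p) as (T & H1 & H2 & H3).
  destruct (forever_run _ p t s c 1 Inv Q (mach_embeds n _) H T _ H1) with (i := i)
    as [k Hk].
  - apply H0; auto. replace (stk zeros 1 [n]) with (upd (fun _ => 0) 1 n); [exact H2|].
    unfold zeros. stk_eq.
  - exists k. intros m Hm. apply Hk. assumption.
Qed.

(** At time [u] in register 1, the value 0 of [t] means waiting and [S v] means emitting the block
    of [v]. A one-way output cannot be revised, so waiting must be expressible. *)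
Definition stream_body (t : tm) : cmd :=
  Seq (Copy 1 2 3) (Seq (comp 2 t) (Seq
    (IfNZ 2 (Seq (Dec 2) (Seq (Loop 2 (Out one)) (Out zero))) Skip) (Inc 1))).

(** Tape 2 holds register 0, which is 0 between rounds; its test for [blank] always succeeds and
    makes the loop infinite. *)
Definition stream_machine (t : tm) : machine := mach 0 (While 2 blank (stream_body t)).

Lemma stream_one_way t : one_way (stream_machine t).
Proof.
  apply mach_one_way. cbn. pose proof (comp_forward t 2).
  repeat split; auto; discriminate.
Qed.

Fixpoint put_ones (v : nat) (o : tape) : tape :=
  match v with 0 => o | S v' => put one (put_ones v' o) end.

Lemma put_ones_spec v o : head (put_ones v o) = head o + v /\
  forall j, cell (put_ones v o) j =
    if (head o <=? j) && (j <? head o + v) then one else cell o j.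
Proof.
  induction v as [|v [IH1 IH2]]; cbn [put_ones].
  - split; [lia|]. intro j.
    destruct (Nat.leb_spec (head o) j), (Nat.ltb_spec j (head o + 0)); try lia; reflexivity.
  - unfold put. cbn [head cell]. split; [lia|]. intro j. rewrite IH1, IH2.
    destruct (Nat.eqb_spec j (head o + v)), (Nat.leb_spec (head o) j),
      (Nat.ltb_spec j (head o + v)), (Nat.ltb_spec j (head o + S v)); try lia; reflexivity.
Qed.

(** Here [cnt u] is the number of terms emitted before time [u]. *)
Lemma stream_machine_outputs t p q (cnt : nat -> nat) :
  cnt 0 = 0 ->
  (forall u, eval p t u = 0 /\ cnt (S u) = cnt u \/
     eval p t u = S (q (cnt u)) /\ cnt (S u) = S (cnt u)) ->
  (forall n, exists u, n <= cnt u) ->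
  outputs (stream_machine t) p q.
Proof.
  intros H0 HS Hinf.
  (* Cells left of the head are final, so [good] survives every write at the head, in particular an
     incomplete block in the middle of a round. *)
  set (good := fun (N : nat) (o : tape) => pos q N <= head o /\
    forall j, j < pos q N -> cell o j = code q j).
  assert (good_put : forall N s o, good N o -> good N (put s o)).
  { intros N s o [G1 G2]. unfold good, put. cbn [head cell]. split; [lia|].
    intros j Hj. destruct (Nat.eqb_spec j (head o)); [lia|auto]. }
  set (Inv u T := rep p T (stk zeros 1 [u]) /\ good (cnt u) (T output) /\
    head (T output) = pos q (cnt u)).
  assert (Hmono : forall i i', i <= i' -> cnt i <= cnt i').
  { induction 1 as [|m Hm IH]; [lia|]. destruct (HS m) as [[_ E]|[_ E]]; lia. }
  intro j. destruct (Hinf (S j)) as [u Hu].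
  destruct (mach_loop_run 0 2 blank (stream_body t) p Inv (fun u => good (cnt u))) with (i := u)
    as [k Hk].
  - intros i T (HR & HG & Hh). split; [|split].
    + rewrite (rep_scan p T _ 2 ltac:(discriminate) HR). now apply test_tracker.
    + exact HG.
    + set (o := T output) in *. set (v := eval p t i).
      assert (E1 : forall R' o', triple p (good (cnt i))
          (Seq (IfNZ 2 (Seq (Dec 2) (Seq (Loop 2 (Out one)) (Out zero))) Skip) (Inc 1))
          (stk zeros 1 [i; v]) o R' o' ->
        triple p (good (cnt i)) (stream_body t) (stk zeros 1 [i]) o R' o').
      { intros R' o' H. eapply triple_seq; [apply triple_copy; try lia; reflexivity|].
        eapply triple_seq; [|exact H].
        eapply triple_eq.
        - match goal with |- triple _ _ _ ?X _ _ _ =>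
            replace X with (stk (stk zeros 1 [i]) 2 [i]) by stk_eq end.
          apply triple_comp; [lia|reflexivity].
        - unfold v. stk_eq. }
      destruct (HS i) as [[Ev Ec]|[Ev Ec]]; fold v in Ev.
      * assert (E : triple p (good (cnt i)) (stream_body t) (stk zeros 1 [i]) o
          (stk zeros 1 [S i]) o).
        { apply E1. rewrite Ev. eapply triple_seq.
          - apply triple_ifnz; intro H; [now exfalso; apply H|apply triple_skip].
          - eapply triple_eq; [apply triple_inc; lia|]. stk_eq. }
        destruct (E T HR eq_refl HG) as (T' & X1 & X2 & X3).
        exists T'. split; [exact X1|]. unfold Inv. rewrite X3, Ec. auto.
      * set (w := q (cnt i)) in *.
        assert (E : triple p (good (cnt i)) (stream_body t) (stk zeros 1 [i]) o
          (stk zeros 1 [S i]) (put zero (put_ones w o))).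
        { apply E1. rewrite Ev.
          apply (triple_seq _ _ _ _ _ _ (stk zeros 1 [i; 0]) (put zero (put_ones w o))).
          - apply triple_ifnz; intro H; [|discriminate].
            eapply triple_seq; [apply triple_dec; lia|].
            apply (triple_seq _ _ _ _ _ _ (stk zeros 1 [i; 0]) (put_ones w o));
              [|apply triple_out; apply good_put].
            set (I x := stk zeros 1 [i; x]). set (O x := put_ones (w - x) o).
            replace o with (O w) at 1 by (unfold O; now rewrite Nat.sub_diag).
            replace (put_ones w o) with (O 0) by (unfold O; now rewrite Nat.sub_0_r).
            match goal with |- triple _ _ _ ?X _ _ _ =>
              replace X with (I w) by (unfold I; stk_eq) end.
            change (stk zeros 1 [i; 0]) with (I 0).
            apply (triple_loop p _ 2 (Out one) I O); [lia| |].
            + intros x _. reflexivity.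
            + intros x Hx. change (O x) with (put_ones (w - x) o).
              replace (w - x) with (S (w - S x)) by lia.
              replace (upd (I (S x)) 2 x) with (I x) by (unfold I; stk_eq).
              apply triple_out, good_put.
          - eapply triple_eq; [apply triple_inc; lia|]. stk_eq. }
        destruct (E T HR eq_refl HG) as (T' & X1 & X2 & X3).
        exists T'. split; [exact X1|]. unfold Inv. rewrite X3, Ec. split; [exact X2|].
        destruct (put_ones_spec w o) as [P1 P2]. unfold good, put. cbn [head cell pos].
        rewrite P1, Hh. fold w. destruct HG as [G1 G2].
        split; [split; [lia|]|lia]. intros x Hx. rewrite P2, Hh.
        destruct (Nat.eqb_spec x (pos q (cnt i) + w)) as [->|Hne].
        { rewrite code_pos by (fold w; lia). fold w.
          destruct (Nat.ltb_spec w w); [lia|reflexivity]. }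
        destruct (Nat.leb_spec (pos q (cnt i)) x), (Nat.ltb_spec x (pos q (cnt i) + w));
          cbn [andb]; try (apply G2; lia); try lia.
        replace x with (pos q (cnt i) + (x - pos q (cnt i))) by lia.
        rewrite code_pos by (fold w; lia). fold w.
        destruct (Nat.ltb_spec (x - pos q (cnt i)) w); [reflexivity|lia].
  - intros T HR Ho. unfold Inv. rewrite H0, Ho. split; [exact HR|]. cbn.
    split; [split; [cbn; lia|cbn; intros; lia]|reflexivity].
  - exists k. intros m Hm. destruct (Hk m Hm) as (i' & Hi & [_ G]). apply G.
    apply Nat.lt_le_trans with (pos q (cnt u)).
    + pose proof (le_pos q (cnt u)). lia.
    + apply pos_mono. auto.
Qed.

(** Round [s] rewrites the cells 0 to [s] and moves the head back by as many steps, so each cell is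
    renewed in all but finitely many rounds. *)
Definition rewrite_body (t : tm) : cmd :=
  Seq (Copy 1 2 3) (Seq (Inc 2) (Seq
    (Loop 2 (Seq (Copy 1 5 6) (Seq (Copy 3 6 7) (Seq (Pairing 4) (Seq (comp 4 t)
      (Seq (IfNZ 4 (Out one) (Out zero)) (Seq (Clear 4) (Inc 3))))))))
    (Seq (Loop 3 (Do output None go_left)) (Inc 1)))).

Definition rewrite_machine (t : tm) : machine :=
  mach 0 (While 2 blank (rewrite_body t)).

Definition bit (n : nat) : symbol := if n =? 0 then zero else one.

Lemma rewrite_machine_outputs t p q :
  (forall j, exists s0, forall s, s0 <= s ->
     bit (eval p t (Cantor.to_nat (s, j))) = code q j) ->
  outputs (rewrite_machine t) p q.
Proof.
  intros H j0. destruct (H j0) as [s1 Hs1].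
  (* The summand [j0] makes round [s0] long enough to rewrite cell [j0]. During that round the old
     content may still be there, hence the strict inequality in [Q]; later rounds only write the
     same symbol again. *)
  set (s0 := s1 + j0).
  set (b s i := bit (eval p t (Cantor.to_nat (s, i)))).
  set (Q s (o : tape) := s0 < s -> cell o j0 = code q j0).
  set (Inv s T := rep p T (stk zeros 1 [s]) /\ head (T output) = 0 /\
    forall s', s = S s' -> forall i, i <= s' -> cell (T output) i = b s' i).
  set (W (o : tape) s j := Tape j (fun i => if i <? j then b s i else cell o i)).
  destruct (mach_loop_run 0 2 blank (rewrite_body t) p Inv Q) with (i := S s0)
    as [k Hk].
  - intros s T (HR & Hh & Hc). split; [|split].
    + rewrite (rep_scan p T _ 2 ltac:(discriminate) HR). now apply test_tracker.
    + intro Hs. destruct s as [|s]; [lia|]. rewrite (Hc s eq_refl) by (unfold s0 in Hs; lia).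
      apply Hs1. unfold s0 in Hs. lia.
    + assert (E : forall o, head o = 0 ->
        triple p (Q s) (rewrite_body t) (stk zeros 1 [s]) o (stk zeros 1 [S s])
          (Tape 0 (cell (W o s (S s))))).
      { intros o Ho. eapply triple_seq; [apply triple_copy; try lia; reflexivity|].
        eapply triple_seq; [apply triple_inc; lia|].
        eapply triple_seq; [|eapply triple_seq].
        - set (I i := stk zeros 1 [s; i; S s - i]). set (O i := W o s (S s - i)).
          match goal with |- triple _ _ _ ?X _ _ _ =>
            replace X with (I (S s)) by (unfold I; stk_eq) end.
          replace o with (O (S s)) at 1.
          + apply (triple_loop p (Q s) 2 _ I O); [lia|reflexivity|].
            intros i Hi. set (j := S s - S i).
            eapply triple_seq; [apply triple_copy; try lia; reflexivity|].
            eapply triple_seq; [apply triple_copy; try lia; reflexivity|].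
            match goal with |- triple _ _ _ ?X _ _ _ =>
              replace X with (stk (stk zeros 1 [s; i; j]) 4 [0; s; j])
                by (unfold I; fold j; stk_eq) end.
            eapply triple_seq; [apply triple_pairing; lia|].
            eapply triple_seq; [apply triple_comp; [lia|reflexivity]|].
            eapply triple_seq.
            { instantiate (1 := O i).
              instantiate (1 := stk (stk zeros 1 [s; i; j]) 4 [eval p t (Cantor.to_nat (s, j))]).
              assert (EO : O i = put (b s j) (O (S i))).
              { unfold O, W, put. fold j. cbn [head cell].
                replace (S s - i) with (S j) by lia. f_equal.
                apply functional_extensionality. intro x.
                destruct (Nat.eqb_spec x j) as [Hx|Hx], (Nat.ltb_spec x (S j));
                  try lia; [now rewrite Hx| |];
                  destruct (Nat.ltb_spec x j); try lia; reflexivity. }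
              assert (EQ : Q s (O (S i)) -> Q s (O i)).
              { intros HQ Hs. specialize (HQ Hs). unfold O, W in *. cbn [cell] in *.
                fold j in HQ. replace (S s - i) with (S j) by lia.
                destruct (Nat.ltb_spec j0 (S j)).
                - apply Hs1. unfold s0 in Hs. lia.
                - destruct (Nat.ltb_spec j0 j); [lia|assumption]. }
              rewrite EO in EQ |- *. clear EO. unfold b, bit in EQ |- *.
              apply triple_ifnz; intro Hb; change (stk (stk zeros 1 [s; i; j]) 4
                  [eval p t (Cantor.to_nat (s, j))] 4)
                  with (eval p t (Cantor.to_nat (s, j))) in Hb;
                destruct (Nat.eqb_spec (eval p t (Cantor.to_nat (s, j))) 0);
                try congruence; apply triple_out; exact EQ. }
            eapply triple_seq; [apply triple_clear; lia|].
            eapply triple_eq; [apply triple_inc; lia|]. unfold I.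
            replace (S s - i) with (S j) by lia. stk_eq.
          + unfold O, W. rewrite Nat.sub_diag. destruct o as [h f].
            cbn in Ho. subst h. reflexivity.
        - cbv beta. rewrite Nat.sub_0_r.
          set (I i := stk zeros 1 [s; 0; i]). set (O i := Tape i (cell (W o s (S s)))).
          apply (triple_loop p (Q s) 3 _ I O (S s)); [lia|reflexivity|].
          intros i Hi. replace (upd (I (S i)) 3 i) with (I i) by (unfold I; stk_eq).
          replace (O i) with (Tape (move_head go_left (head (O (S i)))) (fun j =>
            if j =? head (O (S i)) then cell (O (S i)) (head (O (S i)))
            else cell (O (S i)) j)).
          + apply (triple_do_output p (Q s) None go_left).
            intros HQ Hs. cbn [cell]. destruct (Nat.eqb_spec j0 (head (O (S i)))) as [<-|]; auto.
          + unfold O. cbn [head cell move_head pred]. f_equal.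
            apply functional_extensionality. intro x.
            destruct (Nat.eqb_spec x (S i)) as [->|]; reflexivity.
        - eapply triple_eq; [apply triple_inc; lia|]. stk_eq. }
      destruct (E (T output) Hh T HR eq_refl) as (T' & X1 & X2 & X3).
      { intro Hs. destruct s as [|s]; [lia|]. rewrite (Hc s eq_refl) by (unfold s0 in Hs; lia).
        apply Hs1. unfold s0 in Hs. lia. }
      exists T'. split; [exact X1|]. unfold Inv. rewrite X3. split; [exact X2|].
      split; [reflexivity|]. intros s' [= <-] i Hi. unfold W. cbn [cell].
      destruct (Nat.ltb_spec i (S s)); [reflexivity|lia].
  - intros T HR Ho. unfold Inv. rewrite Ho. split; [exact HR|]. cbn. split; [reflexivity|].
    discriminate.
  - exists k. intros m Hm. destruct (Hk m Hm) as (i' & Hi & G). apply G. lia.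
Qed.

(** Register 2 is set to 1 to force a first round. The counter is increased before each test, so the
    search starts at 1 and not at 0. *)
Definition search_cmd (t : tm) : cmd :=
  Seq (comp 1 (Pair Id Zero)) (Seq (Inc 2)
    (WhileNZ 2 (Seq (Clear 2) (Seq (comp 1 (Pair Fst (Comp Succ Snd)))
      (Seq (Copy 1 2 3) (comp 2 t)))))).

Lemma run_stays M p n m : step M (run M p n) = None -> n <= m -> run M p m = run M p n.
Proof. intros H. induction 1 as [|m Hm IH]; auto. cbn [run]. now rewrite IH, H. Qed.

Lemma search_halts t n p :
  halts (mach n (search_cmd t)) p <-> exists s, eval p t (Cantor.to_nat (n, S s)) = 0.
Proof.
  set (g s := eval p t (Cantor.to_nat (n, s))).
  destruct (mach_start n (search_cmd t) p) as (T & H1 & H2 & H3).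
  assert (HR : rep p T (stk zeros 1 [n])).
  { replace (stk zeros 1 [n]) with (upd (fun _ => 0) 1 n); [exact H2|].
    unfold zeros. stk_eq. }
  set (I s v := stk zeros 1 [Cantor.to_nat (n, s); v]).
  set (body := Seq (Clear 2) (Seq (comp 1 (Pair Fst (Comp Succ Snd)))
      (Seq (Copy 1 2 3) (comp 2 t)))).
  assert (Hinit : forall Q o, triple p Q (Seq (comp 1 (Pair Id Zero)) (Inc 2))
    (stk zeros 1 [n]) o (I 0 1) o).
  { intros Q o. eapply triple_seq; [apply triple_comp; [lia|reflexivity]|].
    eapply triple_eq; [apply triple_inc; lia|]. unfold I. cbn [eval]. stk_eq. }
  assert (Hbody : forall Q o s v, triple p Q body (I s v) o (I (S s) (g (S s))) o).
  { intros Q o s v. eapply triple_seq; [apply triple_clear; lia|].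
    match goal with |- triple _ _ _ ?X _ _ _ =>
      replace X with (stk zeros 1 [Cantor.to_nat (n, s)]) by (unfold I; stk_eq) end.
    eapply triple_seq; [apply triple_comp; [lia|reflexivity]|].
    cbn [eval]. rewrite Cantor.cancel_of_to. cbn [fst snd].
    eapply triple_seq; [apply triple_copy; try lia; reflexivity|].
    match goal with |- triple _ _ _ ?X _ _ _ =>
      replace X with (stk (stk zeros 1 [Cantor.to_nat (n, S s)]) 2 [Cantor.to_nat (n, S s)])
        by stk_eq end.
    eapply triple_eq; [apply triple_comp; [lia|reflexivity]|]. unfold I, g. stk_eq. }
  destruct (Hinit (fun _ => True) (T output) T HR eq_refl Logic.I) as (T0 & X1 & X2 & X3).
  (* Sequencing is associative in compiled code, so the program may be rebracketed into
     initialisation and loop. *)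
  assert (Hem : embeds (mach n (search_cmd t)) (Seq (Seq (comp 1 (Pair Id Zero)) (Inc 2))
    (WhileNZ 2 body)) 1).
  { intros q Hq. rewrite (mach_embeds n (search_cmd t) q).
    - unfold search_cmd. fold body. cbn [compile]. rewrite <- app_assoc.
      cbn [size]. now rewrite Nat.add_assoc.
    - revert Hq. unfold search_cmd. fold body. cbn [size]. lia. }
  split.
  - intros [m Hm]. apply Classical_Prop.NNPP. intro Hno.
    assert (Hg : forall s, g (S s) <> 0) by (intros s E; apply Hno; eauto).
    destruct (exec_reach _ _ _ _ _ X1 Logic.I 1 (embeds_seq_l _ _ _ _ Hem)) as [k0 R0].
    rewrite <- H1 in R0. destruct (reach_run _ _ _ _ _ _ R0) as [R1 _].
    (* Without success the loop never ends. A halt at time [m] would persist, contradicting that all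
       late configurations have a successor. *)
    destruct (forever_run _ p _ _ _ _
      (fun i T => exists v, v <> 0 /\ rep p T (I i v)) (fun _ _ => True)
      (embeds_seq_r _ _ _ _ Hem)) with (T := T0) (i := 0) (k := n + 2 + k0) as [k Hk].
    + intros i T' (v & Hv & HT'). split; [|split; [auto|]].
      * rewrite (rep_scan p T' _ _ (reg_ne_output 2) HT'). now apply test_reg_nz.
      * destruct (Hbody (fun _ => True) _ i v T' HT' eq_refl Logic.I) as (T'' & Y1 & Y2 & _).
        exists T''. split; [exact Y1|]. exists (g (S i)). split; [apply Hg|exact Y2].
    + exact R1.
    + exists 1. split; [lia|exact X2].
    + destruct (Hk (m + k)) as [Hk' _]; [lia|]. apply Hk'.
      rewrite (run_stays _ _ m); [exact Hm|exact Hm|lia].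
  - intros [s Hs].
    assert (Hleast : exists N, g (S N) = 0 /\ forall i, i < N -> g (S i) <> 0).
    { clear -Hs. change (g (S s) = 0) in Hs. revert Hs. induction s as [s IH] using lt_wf_ind.
      intro Hs. destruct (Classical_Prop.classic (exists i, i < s /\ g (S i) = 0)) as [(i & Hi & E)|H].
      - eauto.
      - exists s. split; [assumption|]. intros i Hi E. apply H. eauto. }
    destruct Hleast as (N & HN & HN').
    assert (Hloop : triple p (fun _ => True) (WhileNZ 2 body) (I 0 1) (T output)
      (I (S N) 0) (T output)).
    { set (J i := I (S N - i) (if i =? S N then 1 else g (S N - i))).
      replace (I 0 1) with (J (S N)).
      2:{ unfold J. now rewrite Nat.sub_diag, Nat.eqb_refl. }
      replace (I (S N) 0) with (J 0).
      2:{ unfold J. now rewrite Nat.sub_0_r, HN. }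
      apply (triple_while p _ _ one body J (fun _ => T output)); [discriminate| |].
      - intros i Hi. split.
        + apply test_reg_nz. unfold J. change (I ?a ?b 2) with b.
          destruct (Nat.eqb_spec (S i) (S N)); [discriminate|].
          replace (S N - S i) with (S (N - S i)) by lia. apply HN'. lia.
        + unfold J. destruct (Nat.eqb_spec i (S N)); [lia|].
          replace (S N - i) with (S (S N - S i)) by lia. apply Hbody.
      - apply test_reg_z. unfold J. change (I ?a ?b 2) with b.
        rewrite Nat.sub_0_r. exact HN. }
    destruct (Hloop T0 X2 X3 Logic.I) as (T1 & Y1 & _ & _).
    destruct (exec_reach _ _ _ _ _ (exec_seq _ _ _ _ _ _ X1 Y1) Logic.I 1 Hem) as [k R0].
    rewrite <- H1 in R0. destruct (reach_run _ _ _ _ _ _ R0) as [R1 _].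
    exists (n + 2 + k). rewrite R1. unfold step. rewrite find_rules_of. cbn [state].
    replace (1 + size (Seq (Seq (comp 1 (Pair Id Zero)) (Inc 2)) (WhileNZ 2 body)))
      with (1 + size (search_cmd t)).
    + now rewrite mach_stop.
    + unfold search_cmd. fold body. cbn [size]. lia.
Qed.

(** * Closure properties of primitive recursive functions *)

(** Only a coding is required, without injectivity or a decoding; case analysis inspects the code
    directly. *)
Class Enc (A : Type) := enc : A -> nat.

#[export] Instance enc_nat : Enc nat := fun n => n.
#[export] Instance enc_bool : Enc bool := fun b => if b then 1 else 0.
#[export] Instance enc_prod {A B} `{Enc A} `{Enc B} : Enc (A * B) :=
  fun x => Cantor.to_nat (enc (fst x), enc (snd x)).
#[export] Instance enc_option {A} `{Enc A} : Enc (option A) :=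
  fun o => match o with None => 0 | Some a => S (enc a) end.
(** Chosen to match [decode_list], as the codings of symbols, moves and rules match their decodings;
    thus the code of a machine is an index of it. *)
#[export] Instance enc_list {A} `{Enc A} : Enc (list A) :=
  fix f l := match l with [] => 0 | a :: l' => S (Cantor.to_nat (enc a, f l')) end.
#[export] Instance enc_symbol : Enc symbol :=
  fun s => match s with blank => 0 | zero => 1 | one => 2 end.
#[export] Instance enc_move : Enc move :=
  fun m => match m with go_left => 0 | stay => 1 | go_right => 2 end.
#[export] Instance enc_rule : Enc rule := fun r =>
  enc (r_state r, (r_tape r, (r_read r, (r_write r, (r_move r, r_next r))))).

(** [CF f]: the function [f] is primitive recursive relative to its first argument, with values
    and arguments coded as natural numbers. *)
Definition CF {A B} `{Enc A} `{Enc B} (f : baire -> A -> B) : Prop :=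
  exists t, forall p a, eval p t (enc a) = enc (f p a).

Lemma enc_pair {A B} `{Enc A} `{Enc B} (a : A) (b : B) :
  enc (a, b) = Cantor.to_nat (enc a, enc b).
Proof. reflexivity. Qed.

(** [CF] sees only codes, so passing to another type with the same codes costs nothing. *)
Lemma cf_recode {A} `{Enc A} {B C} `{Enc B} `{Enc C} (f : baire -> A -> B) (g : baire -> A -> C) :
  CF f -> (forall p a, enc (f p a) = enc (g p a)) -> CF g.
Proof. intros [t Ht] E. exists t. intros. now rewrite Ht. Qed.

Lemma cf_ext {A} `{Enc A} {B} `{Enc B} (f g : baire -> A -> B) :
  CF f -> (forall p a, f p a = g p a) -> CF g.
Proof. intros Hf E. apply (cf_recode f); auto. intros. now rewrite E. Qed.

Lemma cf_comp {A} `{Enc A} {B C} `{Enc B} `{Enc C} (g : baire -> B -> C) (f : baire -> A -> B) :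
  CF g -> CF f -> CF (fun p x => g p (f p x)).
Proof. intros [t Ht] [u Hu]. exists (Comp t u). intros. cbn. now rewrite Hu, Ht. Qed.

Lemma cf_id {A} `{Enc A} : CF (fun (_ : baire) (x : A) => x).
Proof. exists Id. reflexivity. Qed.

Lemma cf_const {A} `{Enc A} {B} `{Enc B} (c : B) : CF (fun (_ : baire) (_ : A) => c).
Proof.
  generalize (enc c) as n. intro n.
  assert (E : exists t, forall p a, eval p t a = enc c).
  { generalize (enc c). clear. induction n as [|n [t IH]].
    - exists Zero. reflexivity.
    - exists (Comp Succ t). intros. cbn. now rewrite IH. }
  destruct E as [t Ht]. exists t. auto.
Qed.

Lemma cf_S {A} `{Enc A} (f : baire -> A -> nat) : CF f -> CF (fun p x => S (f p x)).
Proof. intros [t Ht]. exists (Comp Succ t). intros. cbn. now rewrite Ht. Qed.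

Lemma cf_pair {A} `{Enc A} {B C} `{Enc B} `{Enc C} (f : baire -> A -> B) (g : baire -> A -> C) :
  CF f -> CF g -> CF (fun p x => (f p x, g p x)).
Proof.
  intros [t Ht] [u Hu]. exists (Pair t u). intros. cbn [eval]. now rewrite Ht, Hu.
Qed.

Lemma cf_fst {A} `{Enc A} {B C} `{Enc B} `{Enc C} (f : baire -> A -> B * C) :
  CF f -> CF (fun p x => fst (f p x)).
Proof.
  intros [t Ht]. exists (Comp Fst t). intros. cbn [eval]. rewrite Ht.
  unfold enc at 1, enc_prod. now rewrite Cantor.cancel_of_to.
Qed.

Lemma cf_snd {A} `{Enc A} {B C} `{Enc B} `{Enc C} (f : baire -> A -> B * C) :
  CF f -> CF (fun p x => snd (f p x)).
Proof.
  intros [t Ht]. exists (Comp Snd t). intros. cbn [eval]. rewrite Ht.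
  unfold enc at 1, enc_prod. now rewrite Cantor.cancel_of_to.
Qed.

Lemma cf_orc {A} `{Enc A} (f : baire -> A -> nat) : CF f -> CF (fun p x => p (f p x)).
Proof. intros [t Ht]. exists (Comp Orc t). intros. cbn. now rewrite Ht. Qed.

Lemma cf_of_nat {A} `{Enc A} (f : baire -> A -> nat) : CF f -> CF (fun p x => Cantor.of_nat (f p x)).
Proof.
  intro Hf. apply (cf_recode f); [assumption|]. intros.
  unfold enc, enc_prod, enc, enc_nat. now rewrite <- surjective_pairing, Cantor.cancel_to_of.
Qed.

Lemma cf_to_nat {A} `{Enc A} (f : baire -> A -> nat * nat) :
  CF f -> CF (fun p x => Cantor.to_nat (f p x)).
Proof.
  intro Hf. apply (cf_recode f); [assumption|]. intros.
  unfold enc, enc_prod, enc, enc_nat. now rewrite <- surjective_pairing.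
Qed.

Lemma cf_iter {A} `{Enc A} {B} `{Enc B} (n : baire -> A -> nat) (s : baire -> A -> B -> B)
    (b : baire -> A -> B) :
  CF n -> CF b -> CF (fun p (y : A * B) => s p (fst y) (snd y)) ->
  CF (fun p x => Nat.iter (n p x) (s p x) (b p x)).
Proof.
  intros [tn Hn] [tb Hb] [ts Hs].
  (* [Iter] passes on nothing but its state, so the parameter is carried along as its first
     component. *)
  exists (Comp Snd (Comp (Iter (Pair Fst ts)) (Pair tn (Pair Id tb)))).
  intros p a. cbn [eval]. rewrite Hn, Hb, Cantor.cancel_of_to. cbn [fst snd].
  match goal with |- snd (Cantor.of_nat ?X) = _ =>
    replace X with (enc (a, Nat.iter (n p a) (s p a) (b p a))) end.
  - unfold enc at 1, enc_prod. now rewrite Cantor.cancel_of_to.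
  - change (enc (n p a)) with (n p a). induction (n p a) as [|m IH]; [reflexivity|].
    rewrite !Nat.iter_succ, <- IH. cbv beta. rewrite Hs, (enc_pair a).
    rewrite (enc_pair a (Nat.iter m _ _)), Cantor.cancel_of_to. reflexivity.
Qed.


(** An extension point, redefined when further closure properties are available. *)
Ltac cf_hook := fail.

Ltac cf_step :=
  lazymatch goal with
  | |- CF (fun _ _ => (_, _)) => apply cf_pair
  | |- CF (fun _ _ => fst _) => apply cf_fst
  | |- CF (fun _ _ => snd _) => apply cf_snd
  | |- CF (fun _ _ => S _) => apply cf_S
  | |- CF (fun _ _ => Cantor.of_nat _) => apply cf_of_nat
  | |- CF (fun _ _ => Cantor.to_nat _) => apply cf_to_nat
  | |- CF (fun p _ => p _) => apply cf_orc
  | |- _ => cf_hook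
  end.

Ltac cf := cbv beta; repeat first [ assumption | apply cf_const | apply cf_id | cf_step ].

(** Kleene's trick: iterate on pairs of a number and its predecessor. *)
Lemma cf_pred {A} `{Enc A} (f : baire -> A -> nat) : CF f -> CF (fun p x => pred (f p x)).
Proof.
  intro Hf. apply (cf_ext (fun p x => snd (Nat.iter (f p x)
    (fun y : nat * nat => (S (fst y), fst y)) (0, 0)))).
  - apply cf_snd. apply (cf_iter f (fun _ _ y => (S (fst y), fst y)) (fun _ _ => (0, 0))); cf.
  - intros p a. assert (E : forall m, Nat.iter m (fun y : nat * nat => (S (fst y), fst y)) (0, 0)
      = (m, pred m)).
    { induction m as [|m IH]; [reflexivity|]. cbn [Nat.iter nat_rect]. unfold Nat.iter in IH.
      now rewrite IH. }
    now rewrite E.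
Qed.

(** In each type of interest one case has code 0 and the other the successor of the code of its
    content. The step of the iteration below ignores its previous result: no round leaves the value
    of [f], and any positive number of rounds gives that of [g]. *)
Lemma cf_case {A} `{Enc A} {O B C} `{Enc O} `{Enc B} `{Enc C} (o : baire -> A -> O)
    (f : baire -> A -> C) (g : baire -> A * B -> C) (h : baire -> A -> C) :
  CF o -> CF f -> CF g ->
  (forall p a, (enc (o p a) = 0 /\ h p a = f p a) \/
     exists b, enc (o p a) = S (enc b) /\ h p a = g p (a, b)) ->
  CF h.
Proof.
  intros Ho [tf Hf] [tg Hg] Hh.
  assert (Ho' : CF (fun p a => enc (o p a))) by (apply (cf_recode o); auto).
  destruct (cf_pred _ Ho') as [tp Hp]. destruct Ho' as [to Hto].
  exists (Comp Snd (Comp (Iter (Pair Fst (Comp tg Fst))) (Pair to (Pair (Pair Id tp) tf)))).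
  intros p a. cbn [eval]. rewrite Hto, Hp, Hf, Cantor.cancel_of_to. cbn [fst snd].
  change (enc (enc (o p a))) with (enc (o p a)).
  destruct (Hh p a) as [[E ->]|(b & E & ->)]; rewrite E.
  - cbn [Nat.iter nat_rect]. rewrite Cantor.cancel_of_to. reflexivity.
  - cbn [pred].
    match goal with |- context [Nat.iter _ ?F _] => set (G := F) end.
    set (u := Cantor.to_nat (enc a, enc b)).
    assert (Hu : forall v, G (Cantor.to_nat (u, v)) = Cantor.to_nat (u, enc (g p (a, b)))).
    { intro v. unfold G. rewrite Cantor.cancel_of_to. cbn [fst]. now rewrite <- Hg. }
    assert (HG : forall m v, Nat.iter (S m) G (Cantor.to_nat (u, v)) =
        Cantor.to_nat (u, enc (g p (a, b)))).
    { induction m as [|m IH]; intro v; [apply Hu|]. rewrite Nat.iter_succ, IH. apply Hu. }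
    change (enc (enc b)) with (enc b). fold u.
    rewrite HG, Cantor.cancel_of_to. reflexivity.
Qed.

Lemma cf_if {A} `{Enc A} {C} `{Enc C} (b : baire -> A -> bool) (f g : baire -> A -> C) :
  CF b -> CF f -> CF g -> CF (fun p x => if b p x then f p x else g p x).
Proof.
  intros Hb Hf Hg. apply (cf_case (B := nat) b g (fun p y => f p (fst y))); auto.
  - apply (cf_comp f); cf.
  - intros p a. destruct (b p a); [right; exists 0|left]; auto.
Qed.

Lemma cf_natcase {A} `{Enc A} {C} `{Enc C} (n : baire -> A -> nat) (f : baire -> A -> C)
    (g : baire -> A -> nat -> C) :
  CF n -> CF f -> CF (fun p (y : A * nat) => g p (fst y) (snd y)) ->
  CF (fun p x => match n p x with 0 => f p x | S m => g p x m end).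
Proof.
  intros Hn Hf Hg. apply (cf_case _ _ _ _ Hn Hf Hg).
  intros p a. destruct (n p a) as [|m]; [left|right; exists m]; auto.
Qed.

Lemma cf_optcase {A} `{Enc A} {B C} `{Enc B} `{Enc C} (o : baire -> A -> option B)
    (f : baire -> A -> C) (g : baire -> A -> B -> C) :
  CF o -> CF f -> CF (fun p (y : A * B) => g p (fst y) (snd y)) ->
  CF (fun p x => match o p x with None => f p x | Some b => g p x b end).
Proof.
  intros Ho Hf Hg. apply (cf_case _ _ _ _ Ho Hf Hg).
  intros p a. destruct (o p a) as [b|]; [right; exists b|left]; auto.
Qed.

Lemma cf_listcase {A} `{Enc A} {B C} `{Enc B} `{Enc C} (l : baire -> A -> list B)
    (f : baire -> A -> C) (g : baire -> A -> B -> list B -> C) :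
  CF l -> CF f -> CF (fun p (y : A * (B * list B)) => g p (fst y) (fst (snd y)) (snd (snd y))) ->
  CF (fun p x => match l p x with [] => f p x | b :: l' => g p x b l' end).
Proof.
  intros Hl Hf Hg. apply (cf_case _ _ _ _ Hl Hf Hg).
  intros p a. destruct (l p a) as [|b l']; [left|right; exists (b, l')]; auto.
Qed.

Lemma cf_Some {A} `{Enc A} {B} `{Enc B} (f : baire -> A -> B) : CF f -> CF (fun p x => Some (f p x)).
Proof. intros [t Ht]. exists (Comp Succ t). intros. cbn. now rewrite Ht. Qed.

Lemma cf_cons {A} `{Enc A} {B} `{Enc B} (f : baire -> A -> B) (l : baire -> A -> list B) :
  CF f -> CF l -> CF (fun p x => f p x :: l p x).
Proof.
  intros [t Ht] [u Hu]. exists (Comp Succ (Pair t u)). intros. cbn [eval].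
  now rewrite Ht, Hu.
Qed.

Lemma cf_add {A} `{Enc A} (f g : baire -> A -> nat) : CF f -> CF g -> CF (fun p x => f p x + g p x).
Proof.
  intros Hf Hg. apply (cf_ext (fun p x => Nat.iter (f p x) S (g p x))).
  - apply (cf_iter f (fun _ _ => S) g); cf.
  - intros p a. induction (f p a) as [|m IH]; cbn; auto.
Qed.

Lemma cf_sub {A} `{Enc A} (f g : baire -> A -> nat) : CF f -> CF g -> CF (fun p x => f p x - g p x).
Proof.
  intros Hf Hg. apply (cf_ext (fun p x => Nat.iter (g p x) pred (f p x))).
  - apply (cf_iter g (fun _ _ => pred) f); auto. apply cf_pred. cf.
  - intros p a. induction (g p a) as [|m IH]; [cbn; lia|]. rewrite Nat.iter_succ, IH. lia.
Qed.

Lemma cf_leb {A} `{Enc A} (f g : baire -> A -> nat) : CF f -> CF g -> CF (fun p x => f p x <=? g p x).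
Proof.
  intros Hf Hg. apply (cf_ext (fun p x => match f p x - g p x with 0 => true | S _ => false end)).
  - apply (cf_natcase _ _ (fun _ _ _ => false)); [apply cf_sub; assumption|cf|cf].
  - intros p a. destruct (Nat.leb_spec (f p a) (g p a)), (f p a - g p a) eqn:E; auto; lia.
Qed.

Lemma cf_ltb {A} `{Enc A} (f g : baire -> A -> nat) : CF f -> CF g -> CF (fun p x => f p x <? g p x).
Proof. intros Hf Hg. unfold Nat.ltb. apply cf_leb; [apply cf_S|]; assumption. Qed.

Lemma cf_andb {A} `{Enc A} (f g : baire -> A -> bool) : CF f -> CF g -> CF (fun p x => f p x && g p x).
Proof. intros Hf Hg. unfold andb. apply cf_if; cf. Qed.

Lemma cf_negb {A} `{Enc A} (f : baire -> A -> bool) : CF f -> CF (fun p x => negb (f p x)).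
Proof. intros Hf. unfold negb. apply cf_if; cf. Qed.

Lemma cf_eqb {A} `{Enc A} (f g : baire -> A -> nat) : CF f -> CF g -> CF (fun p x => f p x =? g p x).
Proof.
  intros Hf Hg. apply (cf_ext (fun p x => (f p x <=? g p x) && (g p x <=? f p x))).
  - apply cf_andb; apply cf_leb; assumption.
  - intros p a. destruct (Nat.leb_spec (f p a) (g p a)), (Nat.leb_spec (g p a) (f p a)),
      (Nat.eqb_spec (f p a) (g p a)); auto; lia.
Qed.

Lemma cf_enc {A} `{Enc A} {B} `{Enc B} (f : baire -> A -> B) : CF f -> CF (fun p x => enc (f p x)).
Proof. intro Hf. now apply (cf_recode f). Qed.

Ltac cf_arith :=
  lazymatch goal with
  | |- CF (fun _ _ => if _ then _ else _) => apply cf_if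
  | |- CF (fun _ _ => pred _) => apply cf_pred
  | |- CF (fun _ _ => Some _) => apply cf_Some
  | |- CF (fun _ _ => _ :: _) => apply cf_cons
  | |- CF (fun _ _ => _ + _) => apply cf_add
  | |- CF (fun _ _ => _ - _) => apply cf_sub
  | |- CF (fun _ _ => _ <=? _) => apply cf_leb
  | |- CF (fun _ _ => _ <? _) => apply cf_ltb
  | |- CF (fun _ _ => _ =? _) => apply cf_eqb
  | |- CF (fun _ _ => _ && _) => apply cf_andb
  | |- CF (fun _ _ => negb _) => apply cf_negb
  | |- CF (fun _ _ => enc _) => apply cf_enc
  end.

Ltac cf_hook ::= cf_arith.

(** * Lists, parity and halving *)

Lemma length_le_enc {B} `{Enc B} (l : list B) : length l <= enc l.
Proof.
  induction l as [|b l IH]; [cbn; lia|].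
  change (enc (b :: l)) with (S (Cantor.to_nat (enc b, enc l))). cbn [length].
  pose proof (Cantor.to_nat_non_decreasing (enc b) (enc l)). lia.
Qed.

Lemma cf_fold_left {A} `{Enc A} {B C} `{Enc B} `{Enc C} (s : baire -> A -> C -> B -> C)
    (l : baire -> A -> list B) (b : baire -> A -> C) :
  CF (fun p (y : A * (C * B)) => s p (fst y) (fst (snd y)) (snd (snd y))) ->
  CF l -> CF b -> CF (fun p x => fold_left (s p x) (l p x) (b p x)).
Proof.
  intros Hs Hl Hb.
  set (F p x (st : list B * C) := match fst st with
    | [] => st | e :: l' => (l', s p x (snd st) e) end).
  (* The code of a list bounds its length, and surplus rounds do nothing once the list is used
     up. *)
  apply (cf_ext (fun p x => snd (Nat.iter (enc (l p x)) (F p x) (l p x, b p x)))).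
  - apply cf_snd. apply (cf_iter _ F _); [cf|cf|]. unfold F.
    apply (cf_listcase (fun p y => fst (snd y)) (fun p y => snd y)
      (fun p y e l' => (l', s p (fst y) (snd (snd y)) e))); [cf|cf|].
    apply cf_pair; [cf|].
    apply (cf_comp (fun p (y : A * (C * B)) => s p (fst y) (fst (snd y)) (snd (snd y)))
      (fun p (y : A * (list B * C) * (B * list B)) =>
         (fst (fst y), (snd (snd (fst y)), fst (snd y))))); cf.
  - intros p a. generalize (length_le_enc (l p a)). generalize (enc (l p a)) as k.
    generalize (b p a). generalize (l p a).
    induction l0 as [|e l0 IH]; intros c k Hk.
    + clear Hk. induction k as [|k IHk]; [reflexivity|]. rewrite Nat.iter_succ_r. exact IHk.
    + destruct k as [|k]; [cbn in Hk; lia|]. rewrite Nat.iter_succ_r. cbn in Hk.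
      apply IH. lia.
Qed.

Lemma cf_rev {A} `{Enc A} {B} `{Enc B} (l : baire -> A -> list B) : CF l -> CF (fun p x => rev (l p x)).
Proof.
  intro Hl. apply (cf_ext (fun p x => fold_left (fun acc e => e :: acc) (l p x) [])).
  - apply (cf_fold_left (fun _ _ acc e => e :: acc)); cf.
  - intros p a. rewrite <- fold_left_rev_right.
    induction (rev (l p a)) as [|e m IH]; cbn; congruence.
Qed.

Lemma cf_fold_right {A} `{Enc A} {B C} `{Enc B} `{Enc C} (s : baire -> A -> B -> C -> C)
    (l : baire -> A -> list B) (b : baire -> A -> C) :
  CF (fun p (y : A * (B * C)) => s p (fst y) (fst (snd y)) (snd (snd y))) ->
  CF l -> CF b -> CF (fun p x => fold_right (s p x) (b p x) (l p x)).
Proof.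
  intros Hs Hl Hb.
  apply (cf_ext (fun p x => fold_left (fun c e => s p x e c) (rev (l p x)) (b p x))).
  - apply (cf_fold_left (fun p x c e => s p x e c)); [|apply cf_rev; assumption|assumption].
    apply (cf_comp _ (fun p (y : A * (C * B)) => (fst y, (snd (snd y), fst (snd y)))) Hs); cf.
  - intros p a. rewrite <- fold_left_rev_right, rev_involutive. reflexivity.
Qed.

Lemma cf_map {A} `{Enc A} {B C} `{Enc B} `{Enc C} (f : baire -> A -> B -> C) (l : baire -> A -> list B) :
  CF (fun p (y : A * B) => f p (fst y) (snd y)) -> CF l ->
  CF (fun p x => map (f p x) (l p x)).
Proof.
  intros Hf Hl. apply (cf_ext (fun p x => fold_right (fun e acc => f p x e :: acc) [] (l p x))).
  - apply (cf_fold_right (fun p x e acc => f p x e :: acc)); [|cf|cf].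
    apply cf_cons; [|cf].
    apply (cf_comp _ (fun p (y : A * (B * list C)) => (fst y, fst (snd y))) Hf); cf.
  - intros p a. induction (l p a); cbn; congruence.
Qed.

Lemma cf_find {A} `{Enc A} {B} `{Enc B} (f : baire -> A -> B -> bool) (l : baire -> A -> list B) :
  CF (fun p (y : A * B) => f p (fst y) (snd y)) -> CF l ->
  CF (fun p x => find (f p x) (l p x)).
Proof.
  intros Hf Hl. apply (cf_ext (fun p x => fold_right (fun e acc => if f p x e then Some e else acc)
    None (l p x))).
  - apply (cf_fold_right (fun p x e acc => if f p x e then Some e else acc)); [|cf|cf].
    apply cf_if; [|cf|cf].
    apply (cf_comp _ (fun p (y : A * (B * option B)) => (fst y, fst (snd y))) Hf); cf.
  - intros p a. induction (l p a) as [|e m IH]; cbn; [reflexivity|]. destruct (f p a e); auto.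
Qed.

Lemma cf_even {A} `{Enc A} (f : baire -> A -> nat) : CF f -> CF (fun p x => Nat.even (f p x)).
Proof.
  intro Hf. apply (cf_ext (fun p x => Nat.iter (f p x) negb true)).
  - apply (cf_iter f (fun _ _ => negb) (fun _ _ => true)); cf.
  - intros p a. induction (f p a) as [|m IH]; [reflexivity|].
    now rewrite Nat.iter_succ, IH, Nat.even_succ, <- Nat.negb_even.
Qed.

Lemma cf_div2 {A} `{Enc A} (f : baire -> A -> nat) : CF f -> CF (fun p x => Nat.div2 (f p x)).
Proof.
  intro Hf. set (F := fun y : nat * nat => (snd y, S (fst y))).
  apply (cf_ext (fun p x => fst (Nat.iter (f p x) F (0, 0)))).
  - apply cf_fst. apply (cf_iter f (fun _ _ => F) (fun _ _ => (0, 0))); unfold F; cf.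
  - intros p a. assert (E : forall m, Nat.iter m F (0, 0) = (Nat.div2 m, Nat.div2 (S m))).
    { induction m as [|m IH]; [reflexivity|]. rewrite Nat.iter_succ, IH. reflexivity. }
    now rewrite E.
Qed.

(** * Rules and machines as data *)

Lemma cf_rule {A} `{Enc A} (a b : baire -> A -> nat) (c d : baire -> A -> symbol)
    (m : baire -> A -> move) (n : baire -> A -> nat) :
  CF a -> CF b -> CF c -> CF d -> CF m -> CF n ->
  CF (fun p x => Rule (a p x) (b p x) (c p x) (d p x) (m p x) (n p x)).
Proof.
  intros. apply (cf_recode (fun p x => (a p x, (b p x, (c p x, (d p x, (m p x, n p x)))))));
    [cf|reflexivity].
Qed.

Lemma cf_fields {A} `{Enc A} (f : baire -> A -> rule) : CF f ->
  CF (fun p x => (r_state (f p x), (r_tape (f p x), (r_read (f p x), (r_write (f p x),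
    (r_move (f p x), r_next (f p x))))))).
Proof. intros [t Ht]. exists t. exact Ht. Qed.

Lemma cf_r_state {A} `{Enc A} (f : baire -> A -> rule) : CF f -> CF (fun p x => r_state (f p x)).
Proof. intro Hf. exact (cf_fst _ (cf_fields _ Hf)). Qed.

Lemma cf_r_tape {A} `{Enc A} (f : baire -> A -> rule) : CF f -> CF (fun p x => r_tape (f p x)).
Proof. intro Hf. exact (cf_fst _ (cf_snd _ (cf_fields _ Hf))). Qed.

Lemma cf_r_read {A} `{Enc A} (f : baire -> A -> rule) : CF f -> CF (fun p x => r_read (f p x)).
Proof. intro Hf. exact (cf_fst _ (cf_snd _ (cf_snd _ (cf_fields _ Hf)))). Qed.

Lemma cf_r_write {A} `{Enc A} (f : baire -> A -> rule) : CF f -> CF (fun p x => r_write (f p x)).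
Proof. intro Hf. exact (cf_fst _ (cf_snd _ (cf_snd _ (cf_snd _ (cf_fields _ Hf))))). Qed.

Lemma cf_r_move {A} `{Enc A} (f : baire -> A -> rule) : CF f -> CF (fun p x => r_move (f p x)).
Proof.
  intro Hf. exact (cf_fst _ (cf_snd _ (cf_snd _ (cf_snd _ (cf_snd _ (cf_fields _ Hf)))))).
Qed.

Lemma cf_r_next {A} `{Enc A} (f : baire -> A -> rule) : CF f -> CF (fun p x => r_next (f p x)).
Proof.
  intro Hf. exact (cf_snd _ (cf_snd _ (cf_snd _ (cf_snd _ (cf_snd _ (cf_fields _ Hf)))))).
Qed.

Lemma cf_move_head {A} `{Enc A} (m : baire -> A -> move) (h : baire -> A -> nat) :
  CF m -> CF h -> CF (fun p x => move_head (m p x) (h p x)).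
Proof.
  intros Hm Hh. apply (cf_ext (fun p x => if enc (m p x) =? 0 then pred (h p x)
    else if enc (m p x) =? 1 then h p x else S (h p x))); [cf|].
  intros p a. destruct (m p a); reflexivity.
Qed.

Lemma cf_decode_symbol {A} `{Enc A} (f : baire -> A -> nat) :
  CF f -> CF (fun p x => decode_symbol (f p x)).
Proof.
  intro Hf. apply (cf_ext (fun p x => if f p x =? 0 then blank else
    if f p x =? 1 then zero else one)); [cf|].
  intros p a. destruct (f p a) as [|[|n]]; reflexivity.
Qed.

Lemma cf_decode_move {A} `{Enc A} (f : baire -> A -> nat) :
  CF f -> CF (fun p x => decode_move (f p x)).
Proof.
  intro Hf. apply (cf_ext (fun p x => if f p x =? 0 then go_left else
    if f p x =? 1 then stay else go_right)); [cf|].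
  intros p a. destruct (f p a) as [|[|n]]; reflexivity.
Qed.

Ltac cf_machines :=
  lazymatch goal with
  | |- CF (fun _ _ => Nat.even _) => apply cf_even
  | |- CF (fun _ _ => Nat.div2 _) => apply cf_div2
  | |- CF (fun _ _ => Rule _ _ _ _ _ _) => apply cf_rule
  | |- CF (fun _ _ => r_state _) => apply cf_r_state
  | |- CF (fun _ _ => r_tape _) => apply cf_r_tape
  | |- CF (fun _ _ => r_read _) => apply cf_r_read
  | |- CF (fun _ _ => r_write _) => apply cf_r_write
  | |- CF (fun _ _ => r_move _) => apply cf_r_move
  | |- CF (fun _ _ => r_next _) => apply cf_r_next
  | |- CF (fun _ _ => move_head _ _) => apply cf_move_head
  | |- CF (fun _ _ => decode_symbol _) => apply cf_decode_symbol
  | |- CF (fun _ _ => decode_move _) => apply cf_decode_move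
  | |- _ => cf_arith
  end.

Ltac cf_hook ::= cf_machines.

Lemma cf_decode_rule {A} `{Enc A} (f : baire -> A -> nat) :
  CF f -> CF (fun p x => decode_rule (f p x)).
Proof.
  intro Hf. apply (cf_comp (fun _ n => decode_rule n)); [|assumption].
  apply (cf_ext (fun _ n =>
    let n1 := Cantor.of_nat n in let n2 := Cantor.of_nat (snd n1) in
    let n3 := Cantor.of_nat (snd n2) in let n4 := Cantor.of_nat (snd n3) in
    let n5 := Cantor.of_nat (snd n4) in
    Rule (fst n1) (fst n2) (decode_symbol (fst n3)) (decode_symbol (fst n4))
      (decode_move (fst n5)) (snd n5))).
  - cbv zeta. cf.
  - intros _ n. unfold decode_rule.
    repeat (destruct (Cantor.of_nat _) as [? ?]; cbn [fst snd]). reflexivity.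
Qed.

Lemma enc_decode_list n : enc (decode_list n) = n.
Proof.
  unfold decode_list. enough (E : forall k n, n <= k -> enc (decode_list_fuel k n) = n)
    by (apply E; lia).
  clear n. induction k as [|k IH]; intros n Hn.
  - replace n with 0 by lia. reflexivity.
  - destruct n as [|n]; [reflexivity|]. cbn [decode_list_fuel].
    destruct (Cantor.of_nat n) as [a b] eqn:E.
    change (S (Cantor.to_nat (enc a, enc (decode_list_fuel k b))) = S n).
    pose proof (Cantor.cancel_to_of n) as E'. rewrite E in E'.
    pose proof (Cantor.to_nat_non_decreasing a b).
    rewrite IH by lia. now rewrite <- E' at 1.
Qed.

Lemma decode_enc_list (l : list nat) : decode_list (enc l) = l.
Proof.
  unfold decode_list. enough (E : forall k, enc l <= k -> decode_list_fuel k (enc l) = l)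
    by (apply E; lia).
  induction l as [|a l IH]; intros k Hk; [destruct k; reflexivity|].
  change (enc (a :: l)) with (S (Cantor.to_nat (enc a, enc l))) in *.
  destruct k as [|k]; [lia|]. cbn [decode_list_fuel]. rewrite Cantor.cancel_of_to.
  pose proof (Cantor.to_nat_non_decreasing (enc a) (enc l)).
  rewrite IH by lia. reflexivity.
Qed.

Lemma decode_enc_rule (r : rule) : decode_rule (enc r) = r.
Proof.
  destruct r as [q t s s' m q'].
  change (enc (Rule q t s s' m q')) with (enc (q, (t, (s, (s', (m, q')))))).
  rewrite !enc_pair. unfold decode_rule. rewrite !Cantor.cancel_of_to.
  destruct s, s', m; reflexivity.
Qed.

Lemma nth_machine_enc (M : list rule) : nth_machine (enc M) = M.
Proof.
  unfold nth_machine. replace (enc M) with (enc (map enc M)).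
  - rewrite decode_enc_list, map_map. rewrite <- (map_id M) at 2.
    apply map_ext. apply decode_enc_rule.
  - induction M as [|r M IH]; [reflexivity|]. cbn [map].
    change (S (Cantor.to_nat (enc r, enc (map enc M))) = S (Cantor.to_nat (enc r, enc M))).
    now rewrite IH.
Qed.

Lemma cf_nth_machine {A} `{Enc A} (f : baire -> A -> nat) :
  CF f -> CF (fun p x => nth_machine (f p x) : list rule).
Proof.
  intro Hf. unfold nth_machine. apply (cf_map (fun _ _ => decode_rule)).
  - apply cf_decode_rule. cf.
  - apply (cf_recode f); [assumption|]. intros. symmetry. apply enc_decode_list.
Qed.

(** A concrete case of the s-m-n theorem: hard-wiring [n] adds one rule per unit, so the index is
    obtained by iteration. *)
Lemma cf_mach (c : cmd) : CF (fun _ n => enc (mach n c : list rule)).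
Proof.
  unfold mach. set (b := S (S (size c))).
  set (F (st : nat * list rule) :=
    (S (fst st), Rule (S (b + fst st)) 3 blank one go_right (b + fst st) :: snd st)).
  set (base := Rule b 3 blank blank go_left 1 :: compile c 1).
  apply (cf_ext (fun _ n => enc (Rule 0 3 blank blank go_right (b + n) ::
    snd (Nat.iter n F (0, base))))).
  - apply cf_enc, cf_cons; [cf|]. apply cf_snd.
    apply (cf_iter (fun _ n => n) (fun _ _ => F) (fun _ _ => (0, base))); unfold F; cf.
  - intros _ n. do 2 f_equal.
    assert (E : forall k, Nat.iter k F (0, base) = (k, nat_rect (fun _ => machine) base
      (fun k M => Rule (S (b + k)) 3 blank one go_right (b + k) :: M) k)).
    { induction k as [|k IH]; [reflexivity|]. rewrite Nat.iter_succ, IH. reflexivity. }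
    now rewrite E.
Qed.

(** One query settles whether [g] fails at every stage: [e n] is an index of the machine that has
    [n] built in and searches for a stage where [g] holds. The oracle of [g] is the zero sequence,
    whose code is the input 000... of the halting problem. *)
Lemma halting_reduction (g : baire -> nat * nat -> bool) : CF g ->
  exists e : nat -> nat, CF (fun _ n => e n) /\
    forall n, halting_problem (e n) = 0 <-> forall s, g (fun _ => 0) (n, s) = false.
Proof.
  intro Hg.
  (* The predecessor undoes the shift of the search, which tests only positive numbers. *)
  destruct (cf_comp (fun p y => if g p y then 0 else 1)
    (fun _ n => (fst (Cantor.of_nat n), pred (snd (Cantor.of_nat n))))) as [t Ht].
  { cf. } { cf. }
  exists (fun n => enc (mach n (search_cmd t) : list rule)). split; [apply cf_mach|].
  assert (E : forall n s p, eval p t (Cantor.to_nat (n, S s)) = if g p (n, s) then 0 else 1).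
  { intros. change (Cantor.to_nat (n, S s)) with (enc (Cantor.to_nat (n, S s))) at 1.
    rewrite Ht, Cantor.cancel_of_to. reflexivity. }
  intro n. unfold halting_problem. rewrite nth_machine_enc.
  destruct (excluded_middle_informative _) as [Hh|Hh]; rewrite search_halts in Hh.
  - split; [discriminate|]. destruct Hh as [s Hs]. rewrite E in Hs. intro F.
    rewrite F in Hs. discriminate.
  - split; [|reflexivity]. intros _ s. destruct (g (fun _ => 0) (n, s)) eqn:G; [|reflexivity].
    exfalso. apply Hh. exists s. now rewrite E, G.
Qed.

(** * Simulation of machines *)

(** The block containing a cell of the coding of [q], and the number of symbols [one]
    remaining in it. *)
Definition locate (q : baire) (j : nat) : nat * nat :=
  Nat.iter j (fun st => match snd st with
                        | 0 => (S (fst st), q (S (fst st)))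
                        | S m => (fst st, m)
                        end) (0, q 0).

Lemma code_locate q j : code q j = if snd (locate q j) =? 0 then zero else one.
Proof.
  assert (E : j + snd (locate q j) = pos q (fst (locate q j)) + q (fst (locate q j)) /\
    snd (locate q j) <= q (fst (locate q j))).
  { induction j as [|j IH]; [cbn; lia|].
    unfold locate in *. rewrite Nat.iter_succ.
    destruct (Nat.iter j _ _) as [n [|m]]; cbn [fst snd] in *; cbn [pos]; lia. }
  destruct (locate q j) as [n m]. cbn [fst snd] in *. destruct E as [E1 E2].
  replace j with (pos q n + (q n - m)) by lia. rewrite code_pos by lia.
  destruct (Nat.eqb_spec m 0), (Nat.ltb_spec (q n - m) (q n)); try lia; reflexivity.
Qed.

(** The input [Q] of the simulated machine is itself computed; it will be an approximated oracle, a
    shifted name or a constant sequence. *)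
Lemma cf_code {A} `{Enc A} (Q : baire -> A -> baire) (j : baire -> A -> nat) :
  CF (fun p (y : A * nat) => Q p (fst y) (snd y)) -> CF j ->
  CF (fun p x => code (Q p x) (j p x)).
Proof.
  intros HQ Hj.
  apply (cf_ext (fun p x => if snd (locate (Q p x) (j p x)) =? 0 then zero else one)).
  2:{ intros. now rewrite code_locate. }
  enough (CF (fun p x => locate (Q p x) (j p x))) by cf.
  apply (cf_iter j (fun p x (st : nat * nat) => match snd st with
    | 0 => (S (fst st), Q p x (S (fst st))) | S m => (fst st, m) end)
    (fun p x => (0, Q p x 0))); [assumption| |].
  - apply cf_pair; [cf|].
    apply (cf_comp _ (fun _ x => (x, 0)) HQ). cf.
  - apply (cf_natcase (fun _ y => snd (snd y))
      (fun p y => (S (fst (snd y)), Q p (fst y) (S (fst (snd y)))))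
      (fun _ y m => (fst (snd y), m))); [cf| |cf].
    apply cf_pair; [cf|].
    apply (cf_comp _ (fun _ y => (fst y, S (fst (snd y)))) HQ). cf.
Qed.

Lemma code_agree q q' j : (forall i, i <= j -> q i = q' i) -> code q j = code q' j.
Proof.
  intro E. rewrite !code_locate.
  assert (EL : locate q j = locate q' j /\ fst (locate q j) <= j).
  { induction j as [|j IH]; [cbn; rewrite E; auto|].
    destruct IH as [IH1 IH2]; [auto|]. unfold locate in *. rewrite !Nat.iter_succ.
    rewrite <- IH1. destruct (Nat.iter j _ _) as [n [|m]]; cbn [fst snd] in *.
    - rewrite E by lia. split; [reflexivity|lia].
    - split; [reflexivity|lia]. }
  destruct EL as [-> _]. reflexivity.
Qed.

(** A computation is recorded by the list of the executed rules, latest first;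
    [track t j s tr] is the position of the head of tape [t] and the content of its
    cell [j], initially [s]. *)
Definition track (t j : nat) (s : symbol) (tr : list rule) : nat * symbol :=
  fold_right (fun r hc =>
    if r_tape r =? t then
      (move_head (r_move r) (fst hc),
       if t =? 0 then snd hc else if j =? fst hc then r_write r else snd hc)
    else hc) (0, s) tr.

Definition tr_head (t : nat) (tr : list rule) : nat := fst (track t 0 blank tr).

Definition tr_cell (q : baire) (t j : nat) (tr : list rule) : symbol :=
  snd (track t j (if t =? 0 then code q j else blank) tr).

Definition tr_applicable (q : baire) (tr : list rule) (r : rule) : bool :=
  (r_state r =? match tr with [] => 0 | r' :: _ => r_next r' end) &&
  (enc (r_read r) =? enc (tr_cell q (r_tape r) (tr_head (r_tape r) tr) tr)).

Definition tr_next (q : baire) (M : list rule) (tr : list rule) : option rule :=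
  find (tr_applicable q tr) M.

(** A configuration contains infinite tapes and has no code. The list of executed rules has one, and
    any head or cell is recomputed from it on demand. *)
Definition trace (q : baire) (M : list rule) (n : nat) : list rule :=
  Nat.iter n (fun tr => match tr_next q M tr with Some r => r :: tr | None => tr end) [].

Lemma trace_S q M n : trace q M (S n) =
  match tr_next q M (trace q M n) with Some r => r :: trace q M n | None => trace q M n end.
Proof. reflexivity. Qed.

Definition conf (q : baire) (tr : list rule) : config := fold_right apply_rule (init q) tr.

Lemma track_cons t j s r tr : track t j s (r :: tr) =
  if r_tape r =? t then
    (move_head (r_move r) (fst (track t j s tr)),
     if t =? 0 then snd (track t j s tr)
     else if j =? fst (track t j s tr) then r_write r else snd (track t j s tr))
  else track t j s tr.
Proof. reflexivity. Qed.

Lemma track_head t j s tr : fst (track t j s tr) = tr_head t tr.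
Proof.
  unfold tr_head. induction tr as [|r tr IH]; [reflexivity|]. cbn [track fold_right].
  fold (track t j s tr) (track t 0 blank tr).
  destruct (r_tape r =? t); cbn [fst]; congruence.
Qed.

Lemma conf_tape q tr t : head (tapes (conf q tr) t) = tr_head t tr /\
  forall j, cell (tapes (conf q tr) t) j = tr_cell q t j tr.
Proof.
  induction tr as [|r tr [IH1 IH2]].
  - split; [reflexivity|]. intro j. cbn. unfold tr_cell, input. cbn.
    destruct (t =? 0); reflexivity.
  - cbn [conf fold_right]. fold (conf q tr). unfold apply_rule. cbn [tapes].
    unfold tr_head. rewrite (Nat.eqb_sym t).
    split; [|intro j; specialize (IH2 j); unfold tr_cell in *]; rewrite track_cons;
      (destruct (Nat.eqb_spec (r_tape r) t) as [Et|Et]; [|assumption]);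
      cbn [fst snd]; rewrite ?track_head, <- IH1, <- ?IH2;
      unfold act; rewrite Et; unfold input; destruct (t =? 0); reflexivity.
Qed.

Lemma enc_symbol_eqb x y :
  (enc x =? enc y) = if symbol_eq_dec x y then true else false.
Proof. destruct x, y; reflexivity. Qed.

Lemma tr_applicable_spec q tr r : tr_applicable q tr r = applicable (conf q tr) r.
Proof.
  unfold tr_applicable, applicable. f_equal.
  - destruct tr; reflexivity.
  - rewrite enc_symbol_eqb. unfold scanned.
    destruct (conf_tape q tr (r_tape r)) as [E1 E2]. rewrite E1, E2. reflexivity.
Qed.

Lemma step_conf q M tr :
  step M (conf q tr) = option_map (fun r => conf q (r :: tr)) (tr_next q M tr).
Proof.
  unfold step, tr_next. replace (find (tr_applicable q tr) M) with (find (applicable (conf q tr)) M).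
  - reflexivity.
  - induction M as [|r M IH]; [reflexivity|]. cbn [find].
    now rewrite tr_applicable_spec, IH.
Qed.

Lemma run_trace M q n : run M q n = conf q (trace q M n).
Proof.
  induction n as [|n IH]; [reflexivity|]. cbn [run]. rewrite IH, step_conf.
  rewrite trace_S.
  destruct (tr_next q M (trace q M n)); reflexivity.
Qed.

Lemma length_trace q M n : length (trace q M n) <= n.
Proof.
  unfold trace. induction n as [|n IH]; [cbn; lia|]. rewrite Nat.iter_succ.
  destruct (tr_next _ _ _); cbn [length]; lia.
Qed.

Lemma tr_head_le t tr : tr_head t tr <= length tr.
Proof.
  unfold tr_head. induction tr as [|r tr IH]; [cbn; lia|]. cbn [track fold_right length].
  fold (track t 0 blank tr). destruct (r_tape r =? t); cbn [fst]; [|lia].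
  destruct (r_move r); cbn [move_head]; lia.
Qed.

(** In [n] steps at most the first [n] cells of the input are read, and each term of the
    input occupies at least one cell. *)
Lemma trace_agree q q' M n :
  (forall i, i < n -> q i = q' i) -> trace q M n = trace q' M n.
Proof.
  intro E. assert (E' : forall j, j < n -> code q j = code q' j).
  { intros j Hj. apply code_agree. intros. apply E. lia. }
  clear E. induction n as [|n IH]; [reflexivity|]. rewrite !trace_S, <- IH by auto.
  replace (tr_next q' M (trace q M n)) with (tr_next q M (trace q M n)); [reflexivity|].
  unfold tr_next. pose proof (length_trace q M n) as L.
  generalize (trace q M n) L. intros tr Ltr. clear L IH.
  induction M as [|r M IH]; [reflexivity|]. cbn [find]. rewrite IH.
  enough (tr_applicable q tr r = tr_applicable q' tr r) as -> by reflexivity.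
  unfold tr_applicable, tr_cell. destruct (Nat.eqb_spec (r_tape r) 0) as [E0|]; [|reflexivity].
  rewrite E'; [reflexivity|]. pose proof (tr_head_le (r_tape r) tr). lia.
Qed.

Lemma cf_track {A} `{Enc A} (t j : baire -> A -> nat) (s : baire -> A -> symbol)
    (tr : baire -> A -> list rule) :
  CF t -> CF j -> CF s -> CF tr -> CF (fun p x => track (t p x) (j p x) (s p x) (tr p x)).
Proof.
  intros Ht Hj Hs Htr. unfold track.
  assert (Ht' : forall C (eC : Enc C), CF (fun p (y : A * C) => t p (fst y)))
    by (intros; apply (cf_comp t); cf).
  assert (Hj' : forall C (eC : Enc C), CF (fun p (y : A * C) => j p (fst y)))
    by (intros; apply (cf_comp j); cf).
  apply (cf_fold_right (fun p x r hc => if r_tape r =? t p x then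
      (move_head (r_move r) (fst hc),
       if t p x =? 0 then snd hc else if j p x =? fst hc then r_write r else snd hc)
    else hc)); [|cf|cf].
  repeat first [apply Ht' | apply Hj' | progress cf].
Qed.

Lemma cf_tr_head {A} `{Enc A} (t : baire -> A -> nat) (tr : baire -> A -> list rule) :
  CF t -> CF tr -> CF (fun p x => tr_head (t p x) (tr p x)).
Proof.
  intros. unfold tr_head. apply cf_fst.
  apply (cf_track t (fun _ _ => 0) (fun _ _ => blank)); cf.
Qed.

Lemma cf_tr_cell {A} `{Enc A} (Q : baire -> A -> baire) (t j : baire -> A -> nat)
    (tr : baire -> A -> list rule) :
  CF (fun p (y : A * nat) => Q p (fst y) (snd y)) -> CF t -> CF j -> CF tr ->
  CF (fun p x => tr_cell (Q p x) (t p x) (j p x) (tr p x)).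
Proof.
  intros HQ Ht Hj Htr. unfold tr_cell. apply cf_snd.
  apply (cf_track t j (fun p x => if t p x =? 0 then code (Q p x) (j p x) else blank)); try assumption.
  apply cf_if; [cf|apply cf_code; assumption|cf].
Qed.

Lemma cf_tr_next {A} `{Enc A} (Q : baire -> A -> baire) (M tr : baire -> A -> list rule) :
  CF (fun p (y : A * nat) => Q p (fst y) (snd y)) -> CF M -> CF tr ->
  CF (fun p x => tr_next (Q p x) (M p x) (tr p x)).
Proof.
  intros HQ HM Htr. unfold tr_next.
  assert (Htr' : CF (fun p (y : A * rule) => tr p (fst y))) by (apply (cf_comp tr); cf).
  apply (cf_find (fun p x => tr_applicable (Q p x) (tr p x))); [|assumption].
  unfold tr_applicable. apply cf_andb; apply cf_eqb; [cf| |cf|].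
  - apply (cf_listcase (fun p y => tr p (fst y)) (fun _ _ => 0) (fun _ _ r' _ => r_next r')); cf.
  - apply cf_enc.
    apply (cf_tr_cell (fun p (y : A * rule) => Q p (fst y)) (fun _ y => r_tape (snd y))
      (fun p y => tr_head (r_tape (snd y)) (tr p (fst y))) (fun p y => tr p (fst y))).
    + apply (cf_comp _ (fun _ (y : A * rule * nat) => (fst (fst y), snd y)) HQ). cf.
    + cf.
    + apply cf_tr_head; cf.
    + cf.
Qed.

Lemma cf_trace {A} `{Enc A} (Q : baire -> A -> baire) (M : baire -> A -> list rule)
    (n : baire -> A -> nat) :
  CF (fun p (y : A * nat) => Q p (fst y) (snd y)) -> CF M -> CF n ->
  CF (fun p x => trace (Q p x) (M p x) (n p x)).
Proof.
  intros HQ HM Hn. unfold trace.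
  apply (cf_iter n (fun p x tr => match tr_next (Q p x) (M p x) tr with
    | Some r => r :: tr | None => tr end) (fun _ _ => [])); [cf|cf|].
  apply (cf_optcase (fun p y => tr_next (Q p (fst y)) (M p (fst y)) (snd y))
    (fun _ y => snd y) (fun _ y r => r :: snd y)); [|cf|cf].
  apply (cf_tr_next (fun p (y : A * list rule) => Q p (fst y)) (fun p y => M p (fst y))).
  - apply (cf_comp _ (fun _ (y : A * list rule * nat) => (fst (fst y), snd y)) HQ). cf.
  - apply (cf_comp M); cf.
  - cf.
Qed.

(** The initial segment of length [h] of a tape with content [c], read as a coding of
    a sequence: [Some] of its [n]-th term, if the coding of this term is complete. *)
Definition read (c : nat -> symbol) (h n : nat) : option nat :=
  snd (snd (snd (Nat.iter h (fun st =>
    if enc (c (fst st)) =? 2 then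
      (S (fst st), (fst (snd st), (S (fst (snd (snd st))), snd (snd (snd st)))))
    else
      (S (fst st), (S (fst (snd st)),
        (0, if fst (snd st) =? n then Some (fst (snd (snd st))) else snd (snd (snd st)))))
    ) (0, (0, (0, None)))))).

Lemma read_code c q h n : (forall j, j < h -> c j = code q j) ->
  read c h n = if pos q (S n) <=? h then Some (q n) else None.
Proof.
  intro Hc. unfold read.
  match goal with |- context [Nat.iter h ?F ?X] => set (G := F); set (st0 := X) end.
  (* Here [i] blocks are complete and [v] symbols [one] of the next block have been read. *)
  assert (E : exists i v, Nat.iter h G st0 =
      (h, (i, (v, if n <? i then Some (q n) else None))) /\ h = pos q i + v /\ v <= q i).
  { induction h as [|h IH]; [exists 0, 0; cbn; split; [reflexivity|lia]|].
    destruct IH as (i & v & E1 & E2 & E3); [auto|].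
    rewrite Nat.iter_succ, E1. unfold G. cbn [fst snd].
    rewrite Hc by lia.
    replace (code q h) with (if v <? q i then one else zero)
      by (rewrite E2; symmetry; now apply code_pos).
    destruct (Nat.ltb_spec v (q i)).
    - cbn [enc enc_symbol Nat.eqb]. exists i, (S v). split; [reflexivity|lia].
    - cbn [enc enc_symbol Nat.eqb]. exists (S i), 0. cbn [pos]. split; [|lia].
      do 3 f_equal.
      destruct (Nat.eqb_spec i n) as [Ei|Ei], (Nat.ltb_spec n i), (Nat.ltb_spec n (S i));
        try lia; try reflexivity. rewrite <- Ei. f_equal. lia. }
  destruct E as (i & v & -> & E2 & E3). cbn [snd].
  destruct (Nat.ltb_spec n i) as [Hn|Hn], (Nat.leb_spec (pos q (S n)) h) as [Hp|Hp]; auto.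
  - pose proof (pos_mono q (S n) i). lia.
  - pose proof (pos_mono q i n Hn). cbn [pos] in Hp.
    destruct (Nat.eq_dec i n) as [->|]; [lia|].
    pose proof (pos_mono q (S i) n). cbn [pos] in *. lia.
Qed.

Lemma cf_read {A} `{Enc A} (c : baire -> A -> nat -> symbol) (h n : baire -> A -> nat) :
  CF (fun p (y : A * nat) => c p (fst y) (snd y)) -> CF h -> CF n ->
  CF (fun p x => read (c p x) (h p x) (n p x)).
Proof.
  intros Hc Hh Hn. unfold read. do 3 apply cf_snd.
  apply (cf_iter h (fun p x st =>
    if enc (c p x (fst st)) =? 2 then
      (S (fst st), (fst (snd st), (S (fst (snd (snd st))), snd (snd (snd st)))))
    else
      (S (fst st), (S (fst (snd st)),
        (0, if fst (snd st) =? n p x then Some (fst (snd (snd st))) else snd (snd (snd st))))))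
    (fun _ _ => (0, (0, (0, None))))); [cf|cf|].
  assert (CF (fun p (y : A * (nat * (nat * (nat * option nat)))) => n p (fst y)))
    by (apply (cf_comp n); cf).
  apply cf_if; [|cf|cf]. apply cf_eqb; [|cf]. apply cf_enc.
  apply (cf_comp _ (fun _ (y : A * (nat * (nat * (nat * option nat)))) =>
    (fst y, fst (snd y))) Hc). cf.
Qed.

(** * Machines with one-way output *)

Lemma one_way_step M p n : one_way M ->
  let o := tapes (run M p n) output in let o' := tapes (run M p (S n)) output in
  (forall j, head o <= j -> cell o j = blank) ->
  (forall j, head o' <= j -> cell o' j = blank) /\ head o <= head o' /\
  forall j, j < head o -> cell o' j = cell o j.
Proof.
  intros HM o o' Ho. subst o o'. cbn [run]. destruct (step M (run M p n)) as [c|] eqn:E; [|auto].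
  unfold step in E. destruct (find (applicable (run M p n)) M) as [r|] eqn:F; [|discriminate].
  cbn [option_map] in E. injection E as <-. apply find_some in F. destruct F as [F _].
  unfold apply_rule. cbn [tapes].
  destruct (Nat.eqb_spec output (r_tape r)) as [Er|Er]; [|auto].
  unfold act. rewrite <- Er, (HM r F (eq_sym Er)). change (output =? input) with false.
  cbn [write head cell move_head]. set (o := tapes (run M p n) output) in *.
  cbn [write head cell].
  split; [|split; [lia|]].
  - intros j Hj. destruct (Nat.eqb_spec j (head o)); [lia|]. apply Ho. lia.
  - intros j Hj. destruct (Nat.eqb_spec j (head o)); [lia|reflexivity].
Qed.

Lemma one_way_blank M p n : one_way M ->
  forall j, head (tapes (run M p n) output) <= j -> cell (tapes (run M p n) output) j = blank.
Proof.
  intro HM. induction n as [|n IH]; [reflexivity|].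
  destruct (one_way_step M p n HM IH) as (E & _). exact E.
Qed.

Lemma one_way_final M p n m : one_way M -> n <= m ->
  head (tapes (run M p n) output) <= head (tapes (run M p m) output) /\
  forall j, j < head (tapes (run M p n) output) ->
    cell (tapes (run M p m) output) j = cell (tapes (run M p n) output) j.
Proof.
  intro HM. induction 1 as [|m Hm [IH1 IH2]]; [auto|].
  destruct (one_way_step M p m HM (one_way_blank M p m HM)) as (_ & E1 & E2).
  split; [lia|]. intros j Hj. rewrite E2 by lia. auto.
Qed.

Lemma one_way_written M p q n j : one_way M -> outputs M p q ->
  j < head (tapes (run M p n) output) -> cell (tapes (run M p n) output) j = code q j.
Proof.
  intros HM HO Hj. destruct (HO j) as [n0 Hn0].
  rewrite <- (Hn0 (Nat.max n n0)) by lia. symmetry.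
  apply (one_way_final M p n); auto. lia.
Qed.

Lemma code_not_blank q j : code q j <> blank.
Proof. rewrite code_locate. destruct (_ =? _); discriminate. Qed.

(** Cells not yet passed by the head are blank, and codings contain no blanks, so producing cell [j]
    forces the head beyond it. *)
Lemma one_way_progress M p q : one_way M -> outputs M p q ->
  forall j, exists n, forall m, n <= m -> j < head (tapes (run M p m) output).
Proof.
  intros HM HO j. destruct (HO j) as [n Hn]. exists n. intros m Hm.
  destruct (Nat.lt_ge_cases j (head (tapes (run M p m) output))); auto.
  exfalso. apply (code_not_blank q j). rewrite <- (Hn m Hm).
  now apply one_way_blank.
Qed.

Definition out_head (M : list rule) (q : baire) (n : nat) : nat :=
  tr_head output (trace q M n).

Definition out_cell (M : list rule) (q : baire) (n j : nat) : symbol :=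
  tr_cell q output j (trace q M n).

Lemma out_head_run M q n : out_head M q n = head (tapes (run M q n) output).
Proof. rewrite run_trace. symmetry. apply conf_tape. Qed.

Lemma out_cell_run M q n j : out_cell M q n j = cell (tapes (run M q n) output) j.
Proof. rewrite run_trace. symmetry. apply conf_tape. Qed.

Lemma cf_out_head {A} `{Enc A} (Q : baire -> A -> baire) (M : baire -> A -> list rule)
    (n : baire -> A -> nat) :
  CF (fun p (y : A * nat) => Q p (fst y) (snd y)) -> CF M -> CF n ->
  CF (fun p x => out_head (M p x) (Q p x) (n p x)).
Proof. intros. apply cf_tr_head; [cf|]. apply cf_trace; assumption. Qed.

Lemma cf_out_cell {A} `{Enc A} (Q : baire -> A -> baire) (M : baire -> A -> list rule)
    (n j : baire -> A -> nat) :
  CF (fun p (y : A * nat) => Q p (fst y) (snd y)) -> CF M -> CF n -> CF j ->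
  CF (fun p x => out_cell (M p x) (Q p x) (n p x) (j p x)).
Proof. intros. apply cf_tr_cell; [assumption|cf|cf|]. apply cf_trace; assumption. Qed.

(** * Search, limits and the halting problem *)

(** Stages may disagree about the value; taking the least successful one makes the search
    single-valued. *)
Definition first (R : baire -> nat * nat -> option nat) (p : baire) (n v : nat) : Prop :=
  exists s, R p (n, s) = Some v /\ forall s', s' < s -> R p (n, s') = None.

Lemma first_functional R p n v v' : first R p n v -> first R p n v' -> v = v'.
Proof.
  intros (s & H1 & H2) (s' & H1' & H2').
  destruct (lt_eq_lt_dec s s') as [[E|E]|E].
  - rewrite (H2' s E) in H1. discriminate.
  - subst s'. congruence.
  - rewrite (H2 s' E) in H1'. discriminate.
Qed.

Lemma first_exists R p n : (exists s, R p (n, s) <> None) -> exists v, first R p n v.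
Proof.
  intros [s Hs]. revert Hs. induction s as [s IH] using lt_wf_ind. intro Hs.
  destruct (Classical_Prop.classic (exists i, i < s /\ R p (n, i) <> None)) as [(i & Hi & E)|H].
  - eauto.
  - destruct (R p (n, s)) as [v|] eqn:E; [|congruence]. exists v, s. split; [assumption|].
    intros s' Hs'. apply Classical_Prop.NNPP. intro H'. apply H. eauto.
Qed.

Definition search (R : baire -> nat * nat -> option nat) : pfun baire baire.
Proof.
  refine (PFun baire baire (fun p q => forall n, first R p n (q n)) _).
  intros p q q' Hq Hq'. apply functional_extensionality. intro n.
  exact (first_functional _ _ _ _ _ (Hq n) (Hq' n)).
Defined.

Lemma search_exists R p : (forall n, exists s, R p (n, s) <> None) ->
  exists q, search R p q.
Proof. intro H. apply (choice (first R p)). intro n. apply first_exists, H. Qed.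

Lemma search_computable R : CF R -> computable (search R).
Proof.
  intro HR.
  (* The state is a pair of the current question and its stage. Success opens the next question at
     stage 0, failure tries the next stage. *)
  set (nxt p z := match R p z with Some _ => (S (fst z), 0) | None => (fst z, S (snd z)) end).
  set (z p u := Nat.iter u (nxt p) (0, 0)).
  assert (Hz : CF z).
  { apply (cf_iter (fun _ u => u) (fun p _ => nxt p) (fun _ _ => (0, 0))); [cf|cf|].
    unfold nxt. apply (cf_optcase (fun p (y : nat * (nat * nat)) => R p (snd y))
      (fun _ y => (fst (snd y), S (snd (snd y)))) (fun _ y _ => (S (fst (snd y)), 0)));
      [|cf|cf]. apply (cf_comp R); cf. }
  destruct (cf_optcase (fun p u => R p (z p u)) (fun _ _ => 0) (fun _ _ v => S v))
    as [t Ht].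
  { apply (cf_comp R); assumption. } { cf. } { cf. }
  exists (stream_machine t). split; [apply stream_one_way|]. intros p q Hq.
  assert (zS : forall u, z p (S u) = nxt p (z p u)) by reflexivity.
  assert (Hnone : forall u s, s < snd (z p u) -> R p (fst (z p u), s) = None).
  { induction u as [|u IH]; [cbn; lia|]. intros s. rewrite zS. unfold nxt.
    destruct (R p (z p u)) eqn:E; cbn [fst snd]; [lia|]. intro Hs.
    destruct (Nat.eq_dec s (snd (z p u))) as [->|]; [|apply IH; lia].
    now rewrite <- surjective_pairing. }
  apply (stream_machine_outputs t p q (fun u => fst (z p u))); [reflexivity| |].
  - intro u. change (eval p t u) with (eval p t (enc u)). rewrite !Ht, zS.
    unfold nxt.
    destruct (R p (z p u)) as [v|] eqn:E; [right|left]; cbn [fst]; [|auto].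
    split; [|reflexivity]. change (S v = S (q (fst (z p u)))). f_equal.
    apply (first_functional R p (fst (z p u))); [|apply Hq].
    exists (snd (z p u)). rewrite <- surjective_pairing. split; [assumption|apply Hnone].
  - assert (Hreach : forall n, exists u, z p u = (n, 0)).
    { induction n as [|n [u Hu]]; [exists 0; reflexivity|].
      destruct (Hq n) as (s & H1 & H2).
      assert (Hk : forall k, k <= s -> z p (u + k) = (n, k)).
      { induction k as [|k IH]; intro Hk; [now rewrite Nat.add_0_r|].
        rewrite Nat.add_succ_r, zS, IH by lia. unfold nxt. now rewrite H2 by lia. }
      exists (S (u + s)). rewrite zS, Hk by lia. unfold nxt. now rewrite H1. }
    intro n. destruct (Hreach n) as [u Hu]. exists u. now rewrite Hu.
Qed.

Lemma approximable_limit_computable (F : pfun baire baire) (h : baire -> nat * nat -> bool) :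
  CF h ->
  (forall p q, F p q -> forall j, exists s0, forall s, s0 <= s ->
     (if h p (s, j) then one else zero) = code q j) ->
  limit_computable F.
Proof.
  intros [t Ht] H. exists (rewrite_machine t). intros p q Hpq.
  apply rewrite_machine_outputs. intro j. destruct (H p q Hpq j) as [s0 Hs0].
  exists s0. intros s Hs. rewrite <- (Hs0 s Hs).
  change (Cantor.to_nat (s, j)) with (enc (s, j)). rewrite Ht.
  destruct (h p (s, j)); reflexivity.
Qed.

(** * Approximating the halting problem in stages *)

Definition halted (i s : nat) : nat :=
  match tr_next (fun _ => 0) (nth_machine i) (trace (fun _ => 0) (nth_machine i) s) with
  | Some _ => 0
  | None => 1
  end.

Lemma cf_halted {A} `{Enc A} (i s : baire -> A -> nat) :
  CF i -> CF s -> CF (fun p x => halted (i p x) (s p x)).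
Proof.
  intros Hi Hs. unfold halted.
  apply (cf_optcase (fun p x => tr_next (fun _ => 0) (nth_machine (i p x))
    (trace (fun _ => 0) (nth_machine (i p x)) (s p x))) (fun _ _ => 1) (fun _ _ _ => 0));
    [|cf|cf].
  apply (cf_tr_next (fun _ _ _ => 0)); [cf|now apply cf_nth_machine|].
  apply (cf_trace (fun _ _ _ => 0)); [cf|now apply cf_nth_machine|cf].
Qed.

Lemma halted_limit i : exists s0, forall s, s0 <= s -> halted i s = halting_problem i.
Proof.
  assert (E : forall s, step (nth_machine i) (run (nth_machine i) (fun _ => 0) s) = None <->
    halted i s = 1).
  { intro s. rewrite run_trace, step_conf. unfold halted.
    destruct (tr_next _ _ _); cbn; split; intro; auto; discriminate. }
  unfold halting_problem. destruct (excluded_middle_informative _) as [[n Hn]|Hn].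
  - exists n. intros s Hs. apply E. now rewrite (run_stays _ _ n s).
  - exists 0. intros s _. unfold halted. destruct (tr_next _ _ _) eqn:F; [reflexivity|].
    exfalso. apply Hn. exists s. apply E. unfold halted. now rewrite F.
Qed.

Lemma halted_limit_prefix n : exists s0, forall s, s0 <= s -> forall i, i < n ->
  halted i s = halting_problem i.
Proof.
  induction n as [|n [s0 IH]]; [exists 0; lia|].
  destruct (halted_limit n) as [s1 Hs1]. exists (Nat.max s0 s1). intros s Hs i Hi.
  destruct (Nat.eq_dec i n) as [->|]; [apply Hs1|apply IH]; lia.
Qed.

Lemma pair_seq_even q p n : pair_seq q p (n + n) = q n.
Proof.
  unfold pair_seq. replace (n + n) with (2 * n) by lia.
  now rewrite Nat.even_even, Nat.div2_double.
Qed.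

Lemma pair_seq_odd q p n : pair_seq q p (S (n + n)) = p n.
Proof.
  unfold pair_seq. replace (S (n + n)) with (2 * n + 1) by lia.
  rewrite Nat.even_odd. f_equal. rewrite Nat.add_1_r. apply Nat.div2_succ_double.
Qed.

Lemma pair_seq_agree q q' p p' n :
  (forall i, i < n -> q i = q' i) -> (forall i, i < n -> p i = p' i) ->
  forall i, i < n -> pair_seq q p i = pair_seq q' p' i.
Proof.
  intros Hq Hp i Hi. unfold pair_seq.
  assert (Nat.div2 i <= i) by (apply Nat.div2_decr; lia).
  destruct (Nat.even i); [apply Hq|apply Hp]; lia.
Qed.

Lemma cf_pair_seq {A} `{Enc A} (q p : baire -> A -> nat -> nat) :
  CF (fun o (y : A * nat) => q o (fst y) (snd y)) ->
  CF (fun o (y : A * nat) => p o (fst y) (snd y)) ->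
  CF (fun o (y : A * nat) => pair_seq (q o (fst y)) (p o (fst y)) (snd y)).
Proof.
  intros Hq Hp. unfold pair_seq. apply cf_if; [cf| |].
  - apply (cf_comp _ (fun _ y => (fst y, Nat.div2 (snd y))) Hq). cf.
  - apply (cf_comp _ (fun _ y => (fst y, Nat.div2 (snd y))) Hp). cf.
Qed.

(** Stage [s] runs [s] steps with the approximation of stage [s]. The true run passes cell [j]
    within some [n] steps, using finitely many oracle values, which are correct for large [s]. After
    these [n] steps the approximate run may deviate, but being one-way it cannot return to cell
    [j]. *)
Lemma halting_computable_limit_computable F :
  computable_relative halting_problem F -> limit_computable F.
Proof.
  intros (G & (M & HM & HG) & HFG).
  set (Q p s := pair_seq (fun i => halted i s) p).
  apply (approximable_limit_computable F (fun p y =>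
    enc (out_cell M (Q p (fst y)) (fst y) (snd y)) =? 2)).
  - apply cf_eqb; [|cf]. apply cf_enc.
    apply (cf_out_cell (fun p y => Q p (fst y)) (fun _ _ => M) (fun _ y => fst y)
      (fun _ y => snd y)); [|cf|cf|cf].
    unfold Q. apply (cf_pair_seq (fun _ (x : nat * nat) i => halted i (fst x)) (fun p _ => p)).
    + apply cf_halted; cf.
    + cf.
  - intros p q Hpq j. pose proof (HG _ _ (HFG _ _ Hpq)) as HO.
    destruct (one_way_progress _ _ _ HM HO j) as [n Hn].
    destruct (halted_limit_prefix n) as [s0 Hs0].
    exists (Nat.max n s0). intros s Hs. cbn [fst snd].
    assert (E : trace (Q p s) M n = trace (pair_seq halting_problem p) M n).
    { apply trace_agree. apply pair_seq_agree; [|reflexivity].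
      intros i Hi. apply Hs0; lia. }
    pose proof (Hn n (le_n n)) as Hh. rewrite <- out_head_run in Hh. unfold out_head in Hh.
    rewrite <- E in Hh. fold (out_head M (Q p s) n) in Hh. rewrite out_head_run in Hh.
    assert (EC : out_cell M (Q p s) s j = code q j).
    { rewrite out_cell_run.
      rewrite (proj2 (one_way_final M (Q p s) n s HM ltac:(lia)) j Hh).
      rewrite <- out_cell_run. unfold out_cell. rewrite E. unfold tr_cell. cbn [Nat.eqb output].
      change (snd (track output j blank (trace (pair_seq halting_problem p) M n))) with
        (out_cell M (pair_seq halting_problem p) n j).
      rewrite out_cell_run. apply one_way_written; auto. }
    rewrite EC. destruct (code q j) eqn:Ec; [|reflexivity|reflexivity].
    exfalso. exact (code_not_blank q j Ec).
Qed.

(** * Names, moduli and the main theorem *)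

Lemma inv_pow_pos n : (0 < / 2 ^ n)%R.
Proof. apply Rinv_0_lt_compat, pow_lt. lra. Qed.

Lemma inv_pow_S n : (/ 2 ^ S n = / 2 ^ n / 2)%R.
Proof. simpl. rewrite Rinv_mult. lra. Qed.

Lemma inv_pow_le k n : k <= n -> (/ 2 ^ n <= / 2 ^ k)%R.
Proof.
  intro H. apply Rinv_le_contravar; [apply pow_lt; lra|]. apply Rle_pow; [lra|exact H].
Qed.

Lemma inv_pow_small eps : (0 < eps)%R -> exists n, (/ 2 ^ n < eps)%R.
Proof.
  intro H. destruct (pow_lt_1_zero (/ 2) ltac:(rewrite Rabs_pos_eq; lra) eps H) as [N HN].
  exists N. specialize (HN N (le_n N)). rewrite pow_inv, Rabs_pos_eq in HN; [exact HN|].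
  left. apply inv_pow_pos.
Qed.

Lemma name_dist (X : computable_metric_space) p (x : Base X) k :
  cauchy_name X p x -> (dist X (alpha X (p k)) x <= / 2 ^ k)%R.
Proof.
  intros [H1 H2]. apply Rnot_lt_le. intro Hlt.
  destruct (H2 (dist X (alpha X (p k)) x - / 2 ^ k)%R ltac:(lra)) as [N HN].
  specialize (HN (Nat.max N k) ltac:(lia)). specialize (H1 k (Nat.max N k) ltac:(lia)).
  pose proof (dist_tri X (alpha X (p k)) x (alpha X (p (Nat.max N k)))) as T.
  rewrite (dist_sym X (alpha X (p k)) (alpha X (p (Nat.max N k)))) in T.
  cbv beta in HN. lra.
Qed.

Lemma converges_of_dist (X : computable_metric_space) p (x : Base X) n0 :
  (forall n, n0 <= n -> (dist X (alpha X (p n)) x <= / 2 ^ n)%R) ->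
  converges (fun n => alpha X (p n)) x.
Proof.
  intros H eps Heps. destruct (inv_pow_small eps Heps) as [N HN].
  exists (Nat.max n0 N). intros n Hn. specialize (H n ltac:(lia)).
  pose proof (inv_pow_le N n ltac:(lia)). lra.
Qed.

Lemma name_of_dist (X : computable_metric_space) p (x : Base X) :
  (forall n, (dist X (alpha X (p n)) x < / 2 ^ S n)%R) -> cauchy_name X p x.
Proof.
  intro H. split.
  - intros k n Hkn.
    pose proof (dist_tri X (alpha X (p n)) (alpha X (p k)) x) as T.
    rewrite (dist_sym X x (alpha X (p k))) in T.
    pose proof (H n). pose proof (H k). pose proof (inv_pow_le _ _ Hkn).
    rewrite inv_pow_S in *. lra.
  - apply (converges_of_dist X p x 0). intros n _. pose proof (H n) as H1.
    rewrite inv_pow_S in H1. pose proof (inv_pow_pos n). lra.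
Qed.

Lemma name_shift (X : computable_metric_space) p (x : Base X) :
  cauchy_name X p x -> cauchy_name X (fun n => p (n + 2)) x.
Proof.
  intro H. pose proof H as [H1 H2]. split.
  - intros k n Hkn. specialize (H1 (k + 2) (n + 2) ltac:(lia)).
    pose proof (inv_pow_le k (k + 2) ltac:(lia)). lra.
  - apply (converges_of_dist X _ x 0). intros n _.
    pose proof (name_dist X p x (n + 2) H). pose proof (inv_pow_le n (n + 2) ltac:(lia)). lra.
Qed.

(** The shift by two leaves room in the strict inequalities required of a name. *)
Lemma name_extend (X : computable_metric_space) p (x y : Base X) k :
  cauchy_name X p x -> (dist X x y < / 2 ^ (k + 2))%R ->
  exists q, cauchy_name X q y /\ forall i, i < k -> q i = p (i + 2).
Proof.
  intros Hp Hy.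
  destruct (choice (fun j n => (dist X (alpha X n) y < / 2 ^ (j + 3))%R)) as [b Hb].
  { intro j. apply alpha_dense, inv_pow_pos. }
  set (q j := if j <? k then p (j + 2) else b j).
  assert (Hq : forall j, k <= j -> (dist X (alpha X (q j)) y < / 2 ^ (j + 3))%R).
  { intros j Hj. unfold q. destruct (Nat.ltb_spec j k); [lia|apply Hb]. }
  exists q. split; [split|].
  - intros i j Hij.
    destruct (Nat.lt_ge_cases j k) as [Hj|Hj]; [|destruct (Nat.lt_ge_cases i k) as [Hi|Hi]].
    + unfold q. destruct (Nat.ltb_spec j k), (Nat.ltb_spec i k); try lia.
      apply (proj1 (name_shift X p x Hp)). assumption.
    (* From [q j] via [y] and [x] to [q i]: 2^-(i+3) + 2^-(i+3) + 2^-(i+2) is below 2^-i. *)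
    + pose proof (Hq j Hj) as H1.
      assert (Ei : q i = p (i + 2)) by (unfold q; destruct (Nat.ltb_spec i k); [auto|lia]).
      rewrite Ei. pose proof (name_dist X p x (i + 2) Hp) as H2.
      pose proof (dist_tri X (alpha X (q j)) (alpha X (p (i + 2))) y) as T1.
      pose proof (dist_tri X y (alpha X (p (i + 2))) x) as T2.
      rewrite (dist_sym X y x), (dist_sym X x (alpha X (p (i + 2)))) in T2.
      pose proof (inv_pow_le (i + 3) (j + 3) ltac:(lia)) as L1.
      pose proof (inv_pow_le (i + 3) (k + 2) ltac:(lia)) as L2.
      replace (i + 3) with (S (i + 2)) in * by lia. replace (i + 2) with (S (S i)) in * by lia.
      rewrite !inv_pow_S in *. pose proof (inv_pow_pos i). lra.
    + pose proof (Hq j Hj) as H1. pose proof (Hq i Hi) as H2.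
      pose proof (dist_tri X (alpha X (q j)) (alpha X (q i)) y) as T.
      rewrite (dist_sym X y (alpha X (q i))) in T.
      pose proof (inv_pow_le (i + 3) (j + 3) ltac:(lia)) as L1.
      replace (i + 3) with (S (S (S i))) in * by lia.
      rewrite !inv_pow_S in *. pose proof (inv_pow_pos i). lra.
  - apply (converges_of_dist X q y k). intros n Hn. pose proof (Hq n Hn).
    pose proof (inv_pow_le n (n + 3) ltac:(lia)). lra.
  - intros i Hi. unfold q. destruct (Nat.ltb_spec i k); [reflexivity|lia].
Qed.

Lemma constant_name (X : computable_metric_space) i :
  cauchy_name X (fun _ => i) (alpha X i).
Proof.
  assert (E : dist X (alpha X i) (alpha X i) = 0%R) by now apply dist_refl.
  split; [intros k n _|intros eps Heps; exists 0; intros n _]; rewrite E; auto.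
  apply inv_pow_pos.
Qed.

(** Used in both directions: to place each point in the domain of the global modulus, outside of
    which a realizer promises nothing, and to obtain continuity from computed moduli. *)
Lemma continuous_iff_modulus (X Y : Metric_Space) (f : Base X -> Base Y) :
  continuous f <-> forall x, exists m, modulus_at f x m.
Proof.
  split.
  - intros Hf x.
    destruct (choice (fun n k => forall y, (dist X x y < / 2 ^ k)%R ->
      (dist Y (f x) (f y) < / 2 ^ n)%R)) as [m Hm].
    + intro n. destruct (Hf x (/ 2 ^ n)%R (inv_pow_pos n)) as (d & Hd & H).
      destruct (inv_pow_small d Hd) as [k Hk]. exists k. intros y Hy.
      rewrite dist_sym. apply H. split; [exact I|]. rewrite dist_sym. lra.
    + exists m. intros y n. apply Hm.
  - intros H x eps Heps. destruct (H x) as [m Hm]. destruct (inv_pow_small eps Heps) as [n Hn].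
    exists (/ 2 ^ m n)%R. split; [apply inv_pow_pos|]. intros y [_ Hy].
    change (dist X y x < / 2 ^ m n)%R in Hy. change (dist Y (f y) (f x) < eps)%R.
    rewrite dist_sym in Hy. apply Hm in Hy. rewrite dist_sym. lra.
Qed.

(** The length [h] is a separate argument: on a one-way tape it is the head position, but with
    revisable output it has to be guessed and certified as stable. *)
Definition result (M : list rule) (q : baire) (s h n : nat) : option nat :=
  read (out_cell M q s) h n.

Lemma cf_result {A} `{Enc A} (Q : baire -> A -> baire) (M : baire -> A -> list rule)
    (s h n : baire -> A -> nat) :
  CF (fun p (y : A * nat) => Q p (fst y) (snd y)) -> CF M -> CF s -> CF h -> CF n ->
  CF (fun p x => result (M p x) (Q p x) (s p x) (h p x) (n p x)).
Proof.
  intros HQ HM Hs Hh Hn. unfold result.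
  apply (cf_read (fun p x => out_cell (M p x) (Q p x) (s p x)) h n); [|assumption|assumption].
  apply (cf_out_cell (fun p y => Q p (fst y)) (fun p y => M p (fst y))
    (fun p y => s p (fst y)) (fun _ y => snd y)).
  - apply (cf_comp _ (fun _ (y : A * nat * nat) => (fst (fst y), snd y)) HQ). cf.
  - apply (cf_comp M); cf.
  - apply (cf_comp s); cf.
  - cf.
Qed.

Lemma one_way_result M p q s n : one_way M -> outputs M p q ->
  result M p s (out_head M p s) n =
    if pos q (S n) <=? out_head M p s then Some (q n) else None.
Proof.
  intros HM HO. apply read_code. intros j Hj. rewrite out_cell_run.
  rewrite out_head_run in Hj. now apply one_way_written.
Qed.

Lemma one_way_result_exists M p q n : one_way M -> outputs M p q ->
  exists s, result M p s (out_head M p s) n = Some (q n).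
Proof.
  intros HM HO. destruct (one_way_progress M p q HM HO (pos q (S n))) as [s Hs].
  exists s. rewrite (one_way_result M p q s n HM HO).
  specialize (Hs s (le_n s)). rewrite <- out_head_run in Hs.
  destruct (Nat.leb_spec (pos q (S n)) (out_head M p s)); [reflexivity|lia].
Qed.

Lemma one_way_result_some M p q s n v : one_way M -> outputs M p q ->
  result M p s (out_head M p s) n = Some v -> v = q n.
Proof.
  intros HM HO. rewrite (one_way_result M p q s n HM HO).
  destruct (_ <=? _); congruence.
Qed.

(** * A modulus from a realizer *)

Definition search_after (o : baire) (R : baire -> nat * nat -> option nat) :
  pfun baire baire :=
  PFun baire baire (fun p q => search R (pair_seq o p) q)
    (fun p => graph_functional _ _ (search R) (pair_seq o p)).

Lemma search_computable_relative o R :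
  CF R -> computable_relative o (search_after o R).
Proof. intro HR. exists (search R). split; [now apply search_computable|auto]. Qed.

Definition shifted (z : baire) : baire :=
  pair_seq (fun i => z (i + i)) (fun n => z (S (n + 2 + (n + 2)))).

Lemma shifted_pair_seq o p : shifted (pair_seq o p) = pair_seq o (fun n => p (n + 2)).
Proof.
  unfold shifted. f_equal; apply functional_extensionality; intro n.
  - apply pair_seq_even.
  - apply pair_seq_odd.
Qed.

(** The 2 in the value is that of [name_extend]. The 2 in [fst x + 2] gives precision: two points
    sharing this output term have images at distance at most 2^-(n+1), strictly below 2^-n, while
    term n+1 would only give a non-strict bound. *)
Definition modulus_search (M : list rule) (z : baire) (x : nat * nat) : option nat :=
  match result M (shifted z) (snd x) (out_head M (shifted z) (snd x)) (fst x + 2) with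
  | Some _ => Some (snd x + 2)
  | None => None
  end.

Lemma cf_modulus_search M : CF (modulus_search M).
Proof.
  assert (HQ : CF (fun p (y : nat * nat * nat) => shifted p (snd y))).
  { unfold shifted. apply (cf_pair_seq (fun p (_ : nat * nat) i => p (i + i))
      (fun p _ n => p (S (n + 2 + (n + 2))))); cf. }
  unfold modulus_search.
  apply (cf_optcase (fun p x => result M (shifted p) (snd x)
    (out_head M (shifted p) (snd x)) (fst x + 2)) (fun _ _ => None)
    (fun _ x _ => Some (snd x + 2))); [|cf|cf].
  apply (cf_result (fun p _ => shifted p) (fun _ _ => M)); [exact HQ|cf|cf| |cf].
  apply (cf_out_head (fun p _ => shifted p) (fun _ _ => M)); [exact HQ|cf|cf].
Qed.

(** Continuity is not assumed, so that it can be read off from the moduli obtained here. *)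
Lemma halting_computable_modulus_of_map (X Y : computable_metric_space)
    (f : Base X -> Base Y) :
  halting_computable_map X Y f ->
  exists F : pfun baire baire, computable_relative halting_problem F /\
    forall p x, cauchy_name X p x -> exists m, F p m /\ modulus_at f x m.
Proof.
  intros (F & HF & G & (M & HM & HG) & HFG).
  assert (Hout : forall p x, cauchy_name X p x -> exists r,
    outputs M (pair_seq halting_problem p) r /\ cauchy_name Y r (f x)).
  { intros p x Hp. destruct (HF p x Hp (ex_intro _ (f x) eq_refl)) as (r & y & H1 & H2 & H3).
    unfold single_valued in H3. subst y. exists r. split; [|exact H2]. auto. }
  exists (search_after halting_problem (modulus_search M)).
  split; [apply search_computable_relative, cf_modulus_search|].
  intros p x Hp.
  destruct (Hout _ _ (name_shift X p x Hp)) as (r & Hr & Hrx).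
  destruct (search_exists (modulus_search M) (pair_seq halting_problem p)) as [m Hm].
  { intro n. unfold modulus_search. rewrite shifted_pair_seq. cbn [fst snd].
    destruct (one_way_result_exists M _ r (n + 2) HM Hr) as [s Hs].
    exists s. rewrite Hs. discriminate. }
  exists m. split; [exact Hm|]. intros y n Hy.
  destruct (Hm n) as (s & Hs & _). unfold modulus_search in Hs. cbn [fst snd] in Hs.
  rewrite shifted_pair_seq in Hs.
  destruct (result M _ s _ (n + 2)) as [v|] eqn:E; [|discriminate].
  injection Hs as Hs. rewrite <- Hs in Hy.
  destruct (name_extend X p x y s Hp Hy) as (q & Hq & Hqp).
  destruct (Hout q y Hq) as (r' & Hr' & Hry).
  (* The two names agree on the first [s] terms and the oracle part is the same, so [s] steps cannot
     tell them apart. *)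
  assert (ET : trace (pair_seq halting_problem q) M s =
    trace (pair_seq halting_problem (fun n => p (n + 2))) M s).
  { apply trace_agree, pair_seq_agree; [reflexivity|assumption]. }
  pose proof E as E'.
  unfold result, out_head, out_cell in E'. rewrite <- ET in E'. unfold tr_cell in E'.
  assert (E'' : result M (pair_seq halting_problem q) s
    (out_head M (pair_seq halting_problem q) s) (n + 2) = Some v) by exact E'.
  apply (one_way_result_some M _ r s (n + 2) v HM Hr) in E.
  apply (one_way_result_some M _ r' s (n + 2) v HM Hr') in E''.
  pose proof (name_dist Y r (f x) (n + 2) Hrx) as D1.
  pose proof (name_dist Y r' (f y) (n + 2) Hry) as D2.
  rewrite <- E in D1. rewrite <- E'' in D2.
  pose proof (dist_tri Y (f x) (f y) (alpha Y v)) as T.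
  rewrite (dist_sym Y (f x) (alpha Y v)) in T.
  replace (n + 2) with (S (S n)) in * by lia. rewrite !inv_pow_S in *.
  pose proof (inv_pow_pos n). lra.
Qed.

(** With [c] coding [(i, (s, h))] and [t] coding [(u, j)], [unstable L (c, t)] says that
    [j < h] and that cell [j] of the output of [L] on the input [i,i,i,...] differs at
    times [s] and [u >= s]. *)
Definition unstable (L : list rule) (x : nat * nat) : bool :=
  let c := Cantor.of_nat (fst x) in let i := fst c in
  let s := fst (Cantor.of_nat (snd c)) in let h := snd (Cantor.of_nat (snd c)) in
  let t := Cantor.of_nat (snd x) in
  (s <=? fst t) && (snd t <? h) &&
  negb (enc (out_cell L (fun _ => i) (fst t) (snd t)) =?
        enc (out_cell L (fun _ => i) s (snd t))).

Lemma cf_unstable L : CF (fun _ : baire => unstable L).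
Proof.
  unfold unstable. cbv zeta. apply cf_andb; [cf|]. apply cf_negb.
  apply cf_eqb; apply cf_enc.
  - apply (cf_out_cell (fun _ (x : nat * nat) _ => fst (Cantor.of_nat (fst x)))
      (fun _ _ => L)); cf.
  - apply (cf_out_cell (fun _ (x : nat * nat) _ => fst (Cantor.of_nat (fst x)))
      (fun _ _ => L)); cf.
Qed.

Lemma enc_symbol_inj (x y : symbol) : enc x = enc y -> x = y.
Proof. destruct x, y; cbn; congruence. Qed.

Lemma stable_iff L i q s h : outputs L (fun _ => i) q ->
  (forall t, unstable L (Cantor.to_nat (i, Cantor.to_nat (s, h)), t) = false) <->
  forall u j, s <= u -> j < h -> out_cell L (fun _ => i) u j = code q j.
Proof.
  intro HO. unfold unstable. cbn [fst snd]. rewrite !Cantor.cancel_of_to. cbn [fst snd].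
  rewrite !Cantor.cancel_of_to. cbn [fst snd]. split.
  - intros H.
    assert (E : forall u j, s <= u -> j < h ->
      out_cell L (fun _ => i) u j = out_cell L (fun _ => i) s j).
    { intros u j Hu Hj. specialize (H (Cantor.to_nat (u, j))).
      rewrite Cantor.cancel_of_to in H. cbn [fst snd] in H.
      apply enc_symbol_inj. apply Nat.eqb_eq.
      destruct (Nat.leb_spec s u); [|lia]. destruct (Nat.ltb_spec j h); [|lia].
      cbn [andb] in H. now apply negb_false_iff in H. }
    (* Being constant from time [s] on, the cell already has at time [s] its content at a time when
       it is known to be final. *)
    intros u j Hu Hj. rewrite E by assumption. destruct (HO j) as [n0 Hn0].
    rewrite <- (E (Nat.max s n0)) by lia. rewrite out_cell_run. apply Hn0. lia.
  - intros H t. destruct (Cantor.of_nat t) as [u j]. cbn [fst snd].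
    destruct (Nat.leb_spec s u), (Nat.ltb_spec j h); try reflexivity. cbn [andb].
    rewrite (H u j), (H s j) by lia. now rewrite Nat.eqb_refl.
Qed.

Lemma stable_exists L i q h : outputs L (fun _ => i) q ->
  exists s, forall u j, s <= u -> j < h -> out_cell L (fun _ => i) u j = code q j.
Proof.
  intro HO. induction h as [|h [s IH]]; [exists 0; lia|].
  destruct (HO h) as [n0 Hn0]. exists (Nat.max s n0). intros u j Hu Hj.
  destruct (Nat.eq_dec j h) as [->|]; [|apply IH; lia].
  rewrite out_cell_run. apply Hn0. lia.
Qed.

(** The stage codes three guesses: a running time [a] for the modulus machine, a time [s] for the
    limit machine and a length [h] of its output. Once [M] yields [m], the index [i] is term [m + 1]
    of the name, and the oracle at [k] certifies that the first [h] cells are stable from time [s]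
    on. *)
Definition map_search (M L : list rule) (e : nat -> nat) (z : baire) (x : nat * nat) :
    option nat :=
  let a := fst (Cantor.of_nat (snd x)) in let c := snd (Cantor.of_nat (snd x)) in
  let s := fst (Cantor.of_nat c) in let h := snd (Cantor.of_nat c) in
  match result M z a (out_head M z a) (fst x + 2) with
  | None => None
  | Some m =>
      let i := z (S (S m + S m)) in
      let k := e (Cantor.to_nat (i, c)) in
      if z (k + k) =? 0 then result L (fun _ => i) s h (fst x + 2) else None
  end.

Lemma cf_map_search M L e : CF (fun _ : baire => e) -> CF (map_search M L e).
Proof.
  intro He. unfold map_search. cbv zeta.
  apply (cf_optcase
    (fun p x => result M p (fst (Cantor.of_nat (snd x)))
      (out_head M p (fst (Cantor.of_nat (snd x)))) (fst x + 2))
    (fun _ _ => None)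
    (fun p x m =>
      if p (e (Cantor.to_nat (p (S (S m + S m)), snd (Cantor.of_nat (snd x)))) +
            e (Cantor.to_nat (p (S (S m + S m)), snd (Cantor.of_nat (snd x))))) =? 0
      then result L (fun _ => p (S (S m + S m)))
             (fst (Cantor.of_nat (snd (Cantor.of_nat (snd x)))))
             (snd (Cantor.of_nat (snd (Cantor.of_nat (snd x))))) (fst x + 2)
      else None)).
  - apply (cf_result (fun p _ => p) (fun _ _ => M)); [cf|cf|cf| |cf].
    apply (cf_out_head (fun p _ => p) (fun _ _ => M)); cf.
  - cf.
  - assert (Hk : CF (fun p (y : nat * nat * nat) => e (Cantor.to_nat
      (p (S (S (snd y) + S (snd y))), snd (Cantor.of_nat (snd (fst y))))))).
    { apply (cf_comp (fun _ => e)); [assumption|cf]. }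
    apply cf_if; [cf| |cf].
    apply (cf_result (fun p (y : nat * nat * nat) _ => p (S (S (snd y) + S (snd y))))
      (fun _ _ => L)); cf.
Qed.

Lemma halting_computable_map_of_modulus (X Y : computable_metric_space)
    (f : Base X -> Base Y) :
  limit_computable_map X Y f -> continuous f -> halting_computable_modulus X Y f ->
  halting_computable_map X Y f.
Proof.
  intros (FL & HFL & L & HL) Hcont (FM & HFM & G & (M & HM & HG) & HFG).
  destruct (halting_reduction (fun _ => unstable L) (cf_unstable L)) as (e & He & Hhp).
  exists (search_after halting_problem (map_search M L e)).
  split; [|apply search_computable_relative, cf_map_search, He].
  intros p x Hp _.
  destruct (HFM p x Hp) as (m & m' & Hm & Hm' & Hmod).
  { apply continuous_iff_modulus, Hcont. }
  cbn in Hm'. subst m'. pose proof (HG _ _ (HFG _ _ Hm)) as HO. clear Hm.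
  assert (Hq : forall i, exists q, outputs L (fun _ => i) q /\ cauchy_name Y q (f (alpha X i))).
  { intro i. destruct (HFL _ _ (constant_name X i) (ex_intro _ _ eq_refl))
      as (q & y & H1 & H2 & H3).
    unfold single_valued in H3. subst y. exists q. split; [|exact H2]. auto. }
  apply (choice (fun i q => outputs L (fun _ => i) q /\ cauchy_name Y q (f (alpha X i)))) in Hq.
  destruct Hq as [q Hq].
  set (z := pair_seq halting_problem p) in *.
  set (i n := p (S (m (n + 2)))).
  (* Every certified stage gives the same value, so it does not matter at which one the search
     stops. *)
  assert (Hsome : forall n s v, map_search M L e z (n, s) = Some v -> v = q (i n) (n + 2)).
  { intros n s v. unfold map_search. cbn [fst snd].
    destruct (result M z _ _ (n + 2)) as [k|] eqn:E; [|discriminate].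
    apply (one_way_result_some M z m _ _ _ HM HO) in E. subst k.
    unfold z. rewrite pair_seq_odd, pair_seq_even. fold (i n).
    destruct (Cantor.of_nat (snd (Cantor.of_nat s))) as [u h] eqn:Eu. cbn [fst snd].
    replace (snd (Cantor.of_nat s)) with (Cantor.to_nat (u, h))
      by (rewrite <- Eu; apply Cantor.cancel_to_of).
    destruct (Nat.eqb_spec (halting_problem (e (Cantor.to_nat (i n, Cantor.to_nat (u, h))))) 0)
      as [Eh|]; [|discriminate].
    pose proof (proj1 (Hhp _) Eh) as Eh'. destruct (Hq (i n)) as [Hqo _].
    unfold result. rewrite (read_code _ (q (i n))).
    - destruct (_ <=? _); congruence.
    - intros j Hj. apply (proj1 (stable_iff L (i n) (q (i n)) u h Hqo)); auto. }
  destruct (search_exists (map_search M L e) z) as [r Hr].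
  { intro n. destruct (one_way_result_exists M z m (n + 2) HM HO) as [a Ha].
    destruct (Hq (i n)) as [Hqo _].
    (* The least length that contains the complete block of term [n + 2]. *)
    set (h := pos (q (i n)) (S (n + 2))).
    destruct (stable_exists L (i n) (q (i n)) h Hqo) as [s Hs].
    exists (Cantor.to_nat (a, Cantor.to_nat (s, h))). unfold map_search. cbn [fst snd].
    rewrite !Cantor.cancel_of_to. cbn [fst snd]. rewrite !Cantor.cancel_of_to. cbn [fst snd].
    rewrite Ha. unfold z. rewrite pair_seq_odd, pair_seq_even. fold (i n).
    rewrite (proj2 (Hhp _)); [|apply (stable_iff L (i n) (q (i n)) s h Hqo); exact Hs].
    cbn [Nat.eqb]. unfold result. rewrite (read_code _ (q (i n))) by (intros; apply Hs; auto).
    unfold h. rewrite Nat.leb_refl. discriminate. }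
  exists r, (f x). split; [exact Hr|]. split; [|reflexivity].
  (* The error allowed is 2^-(n+1): one half is spent on approximating the image of [alpha X (i n)]
     by term [n + 2] of its name, the other on the modulus at [n + 2]. *)
  apply name_of_dist. intro n.
  destruct (Hr n) as (s & Hs & _). rewrite (Hsome n s _ Hs).
  destruct (Hq (i n)) as [_ Hn]. pose proof (name_dist Y _ _ (n + 2) Hn) as D1.
  pose proof (name_dist X p x (S (m (n + 2))) Hp) as D2. fold (i n) in D2.
  assert (D3 : (dist Y (f x) (f (alpha X (i n))) < / 2 ^ (n + 2))%R).
  (* Term [m + 1] of the name is within 2^-(m+1) of [x], which meets the strict inequality of the
     modulus. *)
  { apply Hmod. rewrite dist_sym. rewrite inv_pow_S in D2.
    pose proof (inv_pow_pos (m (n + 2))). lra. }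
  pose proof (dist_tri Y (alpha Y (q (i n) (n + 2))) (f x) (f (alpha X (i n)))) as T.
  rewrite (dist_sym Y (f (alpha X (i n))) (f x)) in T.
  replace (n + 2) with (S (S n)) in * by lia. rewrite (inv_pow_S (S n)) in *. lra.
Qed.

Theorem theorem6p3 (X Y : computable_metric_space) (f : Base X -> Base Y) :
  halting_computable_map X Y f <->
  limit_computable_map X Y f /\ continuous f /\ halting_computable_modulus X Y f.
Proof.
  split.
  - intro H. destruct (halting_computable_modulus_of_map X Y f H) as (F & HF & HFm).
    split; [|split].
    + destruct H as (F' & HF' & H'). exists F'. split; [exact HF'|].
      now apply halting_computable_limit_computable.
    + apply continuous_iff_modulus. intro x. destruct (cauchy_name_onto X x) as [p Hp].
      destruct (HFm p x Hp) as (m & _ & Hm). eauto.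
    + exists F. split; [|exact HF]. intros p x Hp _.
      destruct (HFm p x Hp) as (m & H1 & H2). exists m, m. split; [exact H1|].
      split; [reflexivity|exact H2].
  - intros (H1 & H2 & H3). now apply halting_computable_map_of_modulus.
Qed.
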